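(* Every normal domain $R$ with finite divisor class group $\operatorname{Cl}(R)$ is $\mathfrak{S}_0$-finite (that is, $\mathfrak{S}_0(R)$ is a finite set), and every Cohen-Macaulay normal domain $R$ with finite divisor class group is $\mathfrak{S}$-finite (that is, $\mathfrak{S}(R)$ is a finite set).
   Context: All rings are commutative Noetherian with identity. A finitely generated $R$-module $C$ is semidualizing if the homothety map $R\to\operatorname{Hom}_R(C,C)$ is an isomorphism and $\operatorname{Ext}^i_R(C,C)=0$ for all $i\geq 1$; $\mathfrak{S}_0(R)$ is the set of isomorphism classes of semidualizing $R$-modules. An $R$-complex $K$ whose total homology module is finitely generated is semidualizing if the homothety morphism $R\to\mathbf{R}\mathrm{Hom}_R(K,K)$ is an isomorphism in the derived category $\mathsf{D}(R)$; $\mathfrak{S}(R)$ is the set of shift-isomorphism classes of semidualizing $R$-complexes (isomorphism in $\mathsf{D}(R)$ up to a shift). The divisor class group $\operatorname{Cl}(R)$ of a normal domain is the group of isomorphism classes of reflexive $R$-modules of rank 1, with $[M]+[N]=[(M\otimes_R N)^{\star\star}]$, where $(-)^\star=\operatorname{Hom}_R(-,R)$. *)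

(* Defs.v *)
From HB Require Import structures.
From mathcomp Require Import all_boot all_order all_algebra.
From mathcomp Require Import ring_quotient boolp.

Set Implicit Arguments.
Unset Strict Implicit.
Unset Printing Implicit Defensive.

Import GRing.Theory.
Local Open Scope ring_scope.

(* [{x : T | P x}] modulo the equivalence [E] is finite.  MathComp-Analysis'
   [finite_set] cannot be applied to sets of modules: [set (lmodType R)] is
   rejected as a universe inconsistency. *)
Definition finitely_many_classes (T : Type) (P : T -> Prop)
    (E : T -> T -> Prop) : Prop :=
  exists (n : nat) (x : 'I_n -> T),
    (forall i, P (x i)) /\ (forall y, P y -> exists i, E y (x i)).

Definition is_greatest (P : nat -> Prop) (d : nat) : Prop :=
  P d /\ forall n, P n -> (n <= d)%N.

(** * Modules *)

Section Modules.
Variable R : comNzRingType.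

Definition spanned (M : lmodType R) (s : seq M) (x : M) : Prop :=
  exists c : 'I_(size s) -> R, x = \sum_i c i *: s`_i.

Definition finitely_generated (M : lmodType R) : Prop :=
  exists s : seq M, forall x, spanned s x.

Definition isomorphic (M N : lmodType R) : Prop :=
  exists f : {linear M -> N}, bijective f.

Definition projective (P : lmodType R) : Prop :=
  forall (A B : lmodType R) (g : {linear A -> B}) (f : {linear P -> B}),
    (forall b, exists a, g a = b) ->
    exists h : {linear P -> A}, forall x, g (h x) = f x.

Definition noetherian : Prop :=
  forall I : {pred R^o}, submod_closed I ->
    exists s : seq R^o, forall x, x \in I <-> spanned s x.

End Modules.

(** ** Direct products, and the module of linear maps *)

(* A named copy of [forall i, M i]: putting the module structure on the bare
   product would overlap with the instances of MathComp-Analysis on [T -> V]. *)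
Definition dfam (R : comNzRingType) (I : Type) (M : I -> lmodType R) : Type :=
  forall i, M i.

Section DirectProduct.
Variables (R : comNzRingType) (I : Type) (M : I -> lmodType R).
Local Notation V := (dfam M).
Implicit Types f g h : V.

HB.instance Definition _ := gen_eqMixin V.
HB.instance Definition _ := gen_choiceMixin V.

Let zero : V := fun i => 0.
Let opp f : V := fun i => - f i.
Let add f g : V := fun i => f i + g i.
Let scale (a : R) f : V := fun i => a *: f i.

Let dfamP f g : (forall i, f i = g i) -> f = g.
Proof. exact: functional_extensionality_dep. Qed.

Let addA : associative add.
Proof. by move=> f g h; apply: dfamP => i; apply: addrA. Qed.
Let addC : commutative add.
Proof. by move=> f g; apply: dfamP => i; apply: addrC. Qed.
Let add0 : left_id zero add.
Proof. by move=> f; apply: dfamP => i; apply: add0r. Qed.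
Let addN : left_inverse zero opp add.
Proof. by move=> f; apply: dfamP => i; apply: addNr. Qed.
HB.instance Definition _ := GRing.isZmodule.Build V addA addC add0 addN.

Let scaleA a b f : scale a (scale b f) = scale (a * b) f.
Proof. by apply: dfamP => i; apply: scalerA. Qed.
Let scale1 : left_id 1 scale.
Proof. by move=> f; apply: dfamP => i; apply: scale1r. Qed.
Let scaleDr : right_distributive scale +%R.
Proof. by move=> a f g; apply: dfamP => i; apply: scalerDr. Qed.
Let scaleDl f : {morph scale^~ f : a b / a + b}.
Proof. by move=> a b; apply: dfamP => i; apply: scalerDl. Qed.
HB.instance Definition _ :=
  GRing.Zmodule_isLmodule.Build R V scaleA scale1 scaleDr scaleDl.

End DirectProduct.

Section Hom.
Variables (R : comNzRingType) (M N : lmodType R).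

Definition linear_map_pred : {pred dfam (fun _ : M => N)} :=
  fun f => `[< linear (f : M -> N) >].

Fact linear_map_submod_closed : submod_closed linear_map_pred.
Proof.
split=> [|a f g /asboolP lf /asboolP lg]; apply/asboolP => b x y.
  by rewrite scaler0 addr0.
change (a *: f (b *: x + y) + g (b *: x + y)
        = b *: (a *: f x + g x) + (a *: f y + g y)).
by rewrite lf lg !scalerDr !scalerA [b * a]mulrC addrACA.
Qed.

HB.instance Definition _ :=
  GRing.isSubmodClosed.Build R (dfam (fun _ : M => N)) linear_map_pred
    linear_map_submod_closed.

Record HomMod : Type :=
  MkHom { hom_val : dfam (fun _ : M => N); _ : hom_val \in linear_map_pred }.
HB.instance Definition _ := [isSub for hom_val].
HB.instance Definition _ := [Choice of HomMod by <:].
HB.instance Definition _ := [SubChoice_isSubLmodule of HomMod by <:].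

Definition hom_fun (f : HomMod) : M -> N := hom_val f.

Fact hom_fun_linear f : linear (hom_fun f).
Proof. by case: f => f /= /asboolP. Qed.
HB.instance Definition _ f :=
  GRing.isLinear.Build R M N *:%R (hom_fun f) (hom_fun_linear f).

Fact linear_in (f : {linear M -> N}) :
  (f : dfam (fun _ : M => N)) \in linear_map_pred.
Proof. by apply/asboolP; exact: linearP. Qed.
Definition to_hom (f : {linear M -> N}) : HomMod := MkHom (linear_in f).

End Hom.
Coercion hom_fun : HomMod >-> Funclass.

Section HomTheory.
Variables (R : comNzRingType) (M N : lmodType R).

Lemma homP (f g : HomMod M N) : (forall x, f x = g x) -> f = g.
Proof. by move=> fg; apply/val_inj/functional_extensionality_dep. Qed.
Lemma hom0E x : (0 : HomMod M N) x = 0. Proof. by []. Qed.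
Lemma homPZE a (f g : HomMod M N) x : (a *: f + g) x = a *: f x + g x.
Proof. by []. Qed.

End HomTheory.

(** * Divisor classes *)

Section DivisorClasses.
Variable R : comNzRingType.

Definition module_dual (M : lmodType R) : lmodType R := HomMod M R^o.

Section Biduality.
Variable M : lmodType R.

Definition eval_at (x : M) (f : module_dual M) : R^o := hom_fun f x.
Fact eval_at_linear x : linear (eval_at x). Proof. by []. Qed.
HB.instance Definition _ x :=
  GRing.isLinear.Build R (module_dual M) R^o *:%R (eval_at x) (eval_at_linear x).

Definition biduality (x : M) : module_dual (module_dual M) := to_hom (eval_at x).

End Biduality.

Definition reflexive_module (M : lmodType R) : Prop :=
  finitely_generated M /\ bijective (@biduality M).

Definition linearly_independent (M : lmodType R) n (v : 'I_n -> M) : Prop :=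
  forall c : 'I_n -> R, \sum_i c i *: v i = 0 -> forall i, c i = 0.

(* Over a domain with fraction field K this is dim_K(K (x)_R M). *)
Definition has_rank (M : lmodType R) : nat -> Prop :=
  is_greatest (fun n => exists v : 'I_n -> M, linearly_independent v).

(* Finiteness of Cl(R) depends on its underlying set only, so the group law
   is not needed. *)
Definition finite_divisor_class_group : Prop :=
  finitely_many_classes
    (fun M : lmodType R => reflexive_module M /\ has_rank M 1) (@isomorphic R).

End DivisorClasses.

(** * Normal and Cohen-Macaulay domains *)

Definition normal_domain (R : idomainType) : Prop :=
  forall z : {fraction R}, integralOver (@tofrac R) z -> exists a, z = tofrac a.

Section CohenMacaulay.
Variable S : comNzRingType.

Definition prime_chain (n : nat) : Prop :=
  exists p : 'I_n.+1 -> prime_idealr S, forall i j : 'I_n.+1, (i < j)%N ->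
    {subset p i <= p j} /\ exists2 x, x \in p j & x \notin p i.

Definition regular_sequence (s : seq S) : Prop :=
  (forall i y, (i < size s)%N ->
    spanned (M := S^o) (take i s) (s`_i * y) -> spanned (M := S^o) (take i s) y)
  /\ ~ spanned (M := S^o) s 1.

Definition krull_dim : nat -> Prop := is_greatest prime_chain.

(* For [S] local: a regular sequence generates a proper ideal, hence lies in
   the maximal ideal. *)
Definition depth : nat -> Prop :=
  is_greatest (fun n => exists2 s, size s = n & regular_sequence s).

Definition local_cohen_macaulay : Prop :=
  exists d, krull_dim d /\ depth d.

Definition maximal_ideal (m : idealr S) : Prop :=
  forall J : idealr S, {subset m <= J} -> {subset J <= m}.

End CohenMacaulay.

(* The localization of a domain at a prime, inside the fraction field. *)
Section Localization.
Variables (R : idomainType) (p : prime_idealr R).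

Definition localization_pred : {pred {fraction R}} := fun z =>
  `[< exists a s, s \notin p /\ z = tofrac a / tofrac s >].

Fact localization_subring_closed : subring_closed localization_pred.
Proof.
have nz s : s \notin p -> tofrac s != 0.
  by rewrite tofrac_eq0; apply: contraNneq => ->; apply: idealr0.
have pM s t : s \notin p -> t \notin p -> s * t \notin p.
  by move=> sp tp; rewrite prime_idealrM negb_or sp.
split=> [|x y /asboolP[a [s [sp ->]]] /asboolP[b [t [tp ->]]]
         |x y /asboolP[a [s [sp ->]]] /asboolP[b [t [tp ->]]]]; apply/asboolP.
- by exists 1, 1; rewrite idealr1 tofrac1 divr1.
- exists (a * t - b * s), (s * t); split; first exact: pM.
  rewrite tofracB !tofracM -mulNr addf_div ?nz // mulNr //.
- by exists (a * b), (s * t); split; [exact: pM | rewrite !tofracM mulf_div].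
Qed.

HB.instance Definition _ :=
  GRing.isSubringClosed.Build {fraction R} localization_pred
    localization_subring_closed.

Record localization : Type := MkLocalization
  { loc_val : {fraction R}; _ : loc_val \in localization_pred }.
HB.instance Definition _ := [isSub for loc_val].
HB.instance Definition _ := [Choice of localization by <:].
HB.instance Definition _ := [SubChoice_isSubComNzRing of localization by <:].

End Localization.

Definition cohen_macaulay (R : idomainType) : Prop :=
  forall p : prime_idealr R,
    maximal_ideal p -> local_cohen_macaulay (localization p).

(** * Complexes, graded homologically *)

(* Differentials between all pairs of degrees, zero except for [n + 1 -> n], to
   avoid transports along equalities of degrees. *)
Record complex (R : comNzRingType) := Complex {
  cobj :> int -> lmodType R;
  diff : forall i j, {linear cobj i -> cobj j};
  diff_shape : forall i j, i != j + 1 -> forall x, diff i j x = 0;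
  diff_diff : forall i j k x, diff j k (diff i j x) = 0 }.

Section Complexes.
Variable R : comNzRingType.
Implicit Types X Y Z : complex R.

Record chain_map X Y := ChainMap {
  cmap :> forall n, {linear X n -> Y n};
  cmap_diff : forall i j x, cmap j (diff X i j x) = diff Y i j (cmap i x) }.

Definition chain_id X : chain_map X X :=
  @ChainMap X X (fun n => idfun) (fun i j x => erefl).

Definition chain_comp X Y Z (g : chain_map Y Z) (f : chain_map X Y) : chain_map X Z :=
  @ChainMap X Z (fun n => g n \o f n)
    (fun i j x => etrans (congr1 (g j) (cmap_diff f j x)) (cmap_diff g j _)).

Definition cycle X n (x : X n) : Prop := diff X n (n - 1) x = 0.
Definition boundary X n (x : X n) : Prop := exists y, x = diff X (n + 1) n y.

Definition zero_homology X n : Prop :=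
  forall x : X n, cycle x -> boundary x.

(* [H_n(f)] is injective and surjective for all [n]. *)
Definition quasi_iso X Y (f : chain_map X Y) : Prop := forall n,
  (forall x : X n, cycle x -> boundary (f n x) -> boundary x) /\
  (forall y : Y n, cycle y -> exists2 x : X n, cycle x & boundary (f n x - y)).

Definition homotopic X Y (f g : chain_map X Y) : Prop :=
  exists h : forall i j, {linear X i -> Y j}, forall n x,
    f n x - g n x
    = diff Y (n + 1) n (h n (n + 1) x) + h (n - 1) n (diff X n (n - 1) x).

(* Cycles of the total complex, i.e. of the direct sum of the [X n]. *)
Definition total_cycle X (z : forall n, X n) : Prop :=
  (forall n, cycle (z n)) /\ exists N : nat, forall n, (N < `|n|)%N -> z n = 0.

(* The direct sum of all [H_n(X)] is finitely generated. *)
Definition homologically_finite X : Prop :=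
  exists m (z : 'I_m -> forall n, X n), (forall k, total_cycle (z k)) /\
    forall x : forall n, X n, total_cycle x ->
      exists a : 'I_m -> R, forall n, boundary (x n - \sum_k a k *: z k n).

(** ** The derived category: calculus of fractions *)

(* A morphism [X -> Y] of D(R) is a class, for [roof_eq], of fractions
   [X <- apex -> Y]. *)
Record roof X Y := Roof {
  apex : complex R;
  denom : chain_map apex X;
  denom_qis : quasi_iso denom;
  numer : chain_map apex Y }.

Definition roof_eq X Y (a b : roof X Y) : Prop :=
  exists (V : complex R) (u : chain_map V (apex a)) (v : chain_map V (apex b)),
    [/\ quasi_iso (chain_comp (denom a) u),
        homotopic (chain_comp (denom a) u) (chain_comp (denom b) v)
      & homotopic (chain_comp (numer a) u) (chain_comp (numer b) v)].

(* [c] represents the composite of [a] followed by [b]. *)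
Definition roof_comp X Y Z (a : roof X Y) (b : roof Y Z) (c : roof X Z) : Prop :=
  exists (V : complex R) (u : chain_map V (apex a)) (v : chain_map V (apex b))
         (q : quasi_iso (chain_comp (denom a) u)),
    homotopic (chain_comp (numer a) u) (chain_comp (denom b) v) /\
    roof_eq (Roof q (chain_comp (numer b) v)) c.

Fact chain_id_qis X : quasi_iso (chain_id X).
Proof.
move=> n; split=> // y cy; exists y => //; exists 0.
by rewrite linear0 subrr.
Qed.

Definition roof_of X Y (f : chain_map X Y) : roof X Y := Roof (chain_id_qis X) f.

Definition derived_iso X Y (a : roof X Y) : Prop :=
  exists b : roof Y X,
    roof_comp a b (roof_of (chain_id X)) /\ roof_comp b a (roof_of (chain_id Y)).

End Complexes.

Section Shift.
Variables (R : comNzRingType) (X : complex R) (s : int).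

Definition shift_diff i j : {linear X (i - s) -> X (j - s)} :=
  (-1) ^+ `|s|%N \*: diff X (i - s) (j - s).

Fact shift_shape i j : i != j + 1 -> forall x, shift_diff i j x = 0.
Proof.
move=> nij x; rewrite /= diff_shape ?scaler0 //.
by apply: contraNneq nij => e; rewrite -[i](subrK s) e addrAC subrK.
Qed.

Fact shift_diff_diff i j k x : shift_diff j k (shift_diff i j x) = 0.
Proof. by rewrite /= linearZ /= diff_diff !scaler0. Qed.

Definition shift : complex R := Complex shift_shape shift_diff_diff.

End Shift.

Definition shift_isomorphic (R : comNzRingType) (X Y : complex R) : Prop :=
  exists (s : int) (a : roof X (shift Y s)), derived_iso a.

(** ** A module as a complex concentrated in degree 0 *)

Section Stalk.
Variables (R : comNzRingType) (M : lmodType R).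

Definition stalk_pred (n : int) : {pred M} := fun x => (n == 0) || (x == 0).

Fact stalk_submod_closed n : submod_closed (stalk_pred n).
Proof.
rewrite /stalk_pred; split=> [|a x y]; rewrite !unfold_in ?eqxx ?orbT //.
by case: (n == 0) => //= /eqP-> /eqP->; rewrite scaler0 addr0.
Qed.
HB.instance Definition _ n :=
  GRing.isSubmodClosed.Build R M (stalk_pred n) (stalk_submod_closed n).

Record stalk_obj (n : int) : Type :=
  MkStalk { stalk_val : M; _ : stalk_val \in stalk_pred n }.
HB.instance Definition _ n := [isSub for @stalk_val n].
HB.instance Definition _ n := [Choice of stalk_obj n by <:].
HB.instance Definition _ n := [SubChoice_isSubLmodule of stalk_obj n by <:].

Definition stalk_diff (i j : int) : {linear stalk_obj i -> stalk_obj j} := \0.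

Definition stalk : complex R :=
  @Complex R stalk_obj stalk_diff (fun _ _ _ _ => erefl) (fun _ _ _ _ => erefl).

End Stalk.

(** ** The complex of homomorphisms *)

Section HomComplex.
Variables (R : comNzRingType) (X Y : complex R).

Definition hom_family : lmodType R :=
  dfam (fun i : int => dfam (fun j : int => HomMod (X i) (Y j) : lmodType R)).

(* Degree [n]: the product of the [HomMod (X i) (Y (i + n))]. *)
Definition homc_pred (n : int) : {pred hom_family} := fun f =>
  `[< forall i j, j != i + n -> (f i j : HomMod (X i) (Y j)) = 0 >].

Fact homc_submod_closed n : submod_closed (homc_pred n).
Proof.
split=> [|a f g /asboolP fn /asboolP gn]; apply/asboolP => i j ij //.
change (a *: f i j + g i j = 0).
by rewrite fn // gn // scaler0 addr0.
Qed.
HB.instance Definition _ n :=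
  GRing.isSubmodClosed.Build R hom_family (homc_pred n) (homc_submod_closed n).

Record homc_obj (n : int) : Type :=
  MkHomc { homc_val : hom_family; _ : homc_val \in homc_pred n }.
HB.instance Definition _ n := [isSub for @homc_val n].
HB.instance Definition _ n := [Choice of homc_obj n by <:].
HB.instance Definition _ n := [SubChoice_isSubLmodule of homc_obj n by <:].

Definition homc_at n (f : homc_obj n) i j : HomMod (X i) (Y j) := homc_val f i j.

Lemma homc_at0 n (f : homc_obj n) i j : j != i + n -> homc_at f i j = 0.
Proof. by case: f => f /= /asboolP; apply. Qed.

Lemma homc_ext n (f g : homc_obj n) :
  (forall i j x, homc_at f i j x = homc_at g i j x) -> f = g.
Proof.
move=> fg; apply: val_inj; apply: functional_extensionality_dep => i.
by apply: functional_extensionality_dep => j; apply: homP; apply: fg.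
Qed.

Lemma homc_atPZ n a (f g : homc_obj n) i j x :
  homc_at (a *: f + g) i j x = a *: homc_at f i j x + homc_at g i j x.
Proof. by []. Qed.

(* d f = d^Y \o f - (-1)^n f \o d^X for [f] of degree [n]. *)
Definition homc_diff_family n (f : homc_obj n) : hom_family := fun i j =>
  to_hom (diff Y (j + 1) j \o homc_at f i (j + 1))
  - (-1) ^+ `|n|%N *: to_hom (homc_at f (i - 1) j \o diff X i (i - 1)).

Definition homc_diff_val n m (f : homc_obj n) : hom_family :=
  if n == m + 1 then homc_diff_family f else 0.

Fact homc_diff_in n m (f : homc_obj n) : homc_diff_val m f \in homc_pred m.
Proof.
apply/asboolP => i j ij; rewrite /homc_diff_val.
case: eqP => [nm|_] //; apply: homP => x.
change (diff Y (j + 1) j (homc_at f i (j + 1) x)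
  - (-1) ^+ `|n|%N *: homc_at f (i - 1) j (diff X i (i - 1) x) = 0).
have ij1 : j + 1 != i + n by rewrite nm addrA (inj_eq (addIr _)).
have ij2 : j != i - 1 + n by rewrite nm [m + 1]addrC addrA subrK.
by rewrite (homc_at0 f ij1) (homc_at0 f ij2) !hom0E linear0 scaler0 subrr.
Qed.

Definition homc_diff_fun n m (f : homc_obj n) : homc_obj m :=
  MkHomc (homc_diff_in m f).

Lemma homc_diffE n m (f : homc_obj n) i j x : n = m + 1 ->
  homc_at (homc_diff_fun m f) i j x = diff Y (j + 1) j (homc_at f i (j + 1) x)
    - (-1) ^+ `|n|%N *: homc_at f (i - 1) j (diff X i (i - 1) x).
Proof. by move=> nm; rewrite /homc_at /= /homc_diff_val (introT eqP nm). Qed.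

Lemma homc_diff0 n m (f : homc_obj n) : n != m + 1 -> homc_diff_fun m f = 0.
Proof.
by move=> /negPf nm; apply: val_inj; rewrite /= /homc_diff_val nm.
Qed.

Fact homc_diff_linear n m : linear (@homc_diff_fun n m).
Proof.
move=> a f g; have [nm|nm] := eqVneq n (m + 1); last first.
  by rewrite !homc_diff0 // scaler0 addr0.
apply: homc_ext => i j x; rewrite homc_atPZ !homc_diffE // !homc_atPZ.
rewrite linearP /= scalerBr !scalerDr opprD !scalerA [_ * a]mulrC.
by rewrite addrACA.
Qed.
HB.instance Definition _ n m :=
  GRing.isLinear.Build R (homc_obj n) (homc_obj m) *:%R (@homc_diff_fun n m)
    (@homc_diff_linear n m).

Definition homc_diff n m : {linear homc_obj n -> homc_obj m} :=
  @homc_diff_fun n m.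

Fact homc_diff_shape n m : n != m + 1 -> forall f, homc_diff n m f = 0.
Proof. by move=> nm f; exact: homc_diff0. Qed.

Fact homc_diff_diff n m k f : homc_diff m k (homc_diff n m f) = 0.
Proof.
have [mk|mk] := eqVneq m (k + 1); last exact: homc_diff0.
have [nm|nm] := eqVneq n (m + 1); last first.
  by rewrite /homc_diff /= (homc_diff0 _ nm) linear0.
apply: homc_ext => i j x; rewrite /homc_diff /= !homc_diffE //.
have -> : (-1) ^+ `|n|%N = - (-1) ^+ `|m|%N :> R.
  rewrite nm; case: m {mk nm f} => [p|[|p]].
  - by rewrite -PoszD absz_nat addn1 exprS mulN1r.
  - by rewrite expr1 expr0 opprK.
  - have -> : Negz p.+1 + 1 = Negz p by rewrite !NegzE -addn1 PoszD opprD addrNK.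
    change ((-1) ^+ p.+1 = - (-1) ^+ p.+2 :> R).
    by rewrite [in RHS]exprS mulN1r opprK.
rewrite diff_diff linear0 scaler0 subr0 scaleNr opprK linearD linearZ /=.
by rewrite diff_diff add0r subrr.
Qed.

Definition hom_complex : complex R :=
  Complex homc_diff_shape homc_diff_diff.

End HomComplex.

(** ** The homothety morphism *)

Section Homothety.
Variables (R : comNzRingType) (P : complex R).

Definition transport i j (e : i = j) (x : P i) : P j :=
  eq_rect i (fun k => P k : Type) x j e.

Fact transport_linear i j (e : i = j) : linear (transport e).
Proof. by case: j / e. Qed.

HB.instance Definition _ i j (e : i = j) :=
  GRing.isLinear.Build R (P i) (P j) *:%R (transport e) (transport_linear e).

(* The identity of [P], as a family of maps [P i -> P j]. *)
Definition id_family : hom_family P P := fun i j =>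
  if i =P j is ReflectT e then to_hom (transport e) else 0.

Lemma id_family_diag i x : (id_family i i : HomMod (P i) (P i)) x = x.
Proof.
by rewrite /id_family; case: eqP => // e; rewrite (eq_irrelevance e erefl).
Qed.

Lemma id_family_diff k i j x : i = j ->
  (id_family i j : HomMod (P i) (P j)) (diff P k i x) = diff P k j x.
Proof. by move=> <-; apply: id_family_diag. Qed.

Lemma id_family_off i j : i != j -> id_family i j = 0.
Proof. by rewrite /id_family; case: eqP. Qed.

Definition homothety_val n (a : stalk R^o n) : hom_family P P :=
  (stalk_val a : R) *: id_family.

Fact homothety_in n (a : stalk R^o n) : homothety_val a \in homc_pred n.
Proof.
apply/asboolP => i j ij.
change ((stalk_val a : R) *: (id_family i j : HomMod (P i) (P j)) = 0).
case: a => a /= /orP[/eqP n0|/eqP->]; last by rewrite scale0r.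
by rewrite id_family_off ?scaler0 // eq_sym -[i in _ != i]addr0 -n0.
Qed.

(* [a |-> a * id_P]: nonzero in degree 0 only. *)
Definition homothety_fun n (a : stalk R^o n) : hom_complex P P n :=
  MkHomc (homothety_in a).

Fact homothety_linear n : linear (@homothety_fun n).
Proof.
move=> a x y; apply: val_inj => /=; rewrite /homothety_val.
change ((a * stalk_val x + stalk_val y) *: id_family
  = a *: (stalk_val x *: id_family) + stalk_val y *: id_family).
by rewrite scalerDl scalerA.
Qed.
HB.instance Definition _ n :=
  GRing.isLinear.Build R (stalk R^o n) (hom_complex P P n) *:%R
    (@homothety_fun n) (@homothety_linear n).

Fact homothety_diff i j (a : stalk R^o i) :
  homothety_fun (diff (stalk R^o) i j a)
  = diff (hom_complex P P) i j (homothety_fun a).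
Proof.
rewrite [LHS](_ : _ = 0); last exact: (linear0 (@homothety_fun j)).
apply/esym; have [ij|ij] := eqVneq i (j + 1); last exact: homc_diff0.
apply: homc_ext => k l x; rewrite [LHS]homc_diffE //.
have atE n (b : stalk R^o n) k' l' (y : P k') :
    homc_at (homothety_fun b) k' l' y
    = (stalk_val b : R) *: (id_family k' l' : HomMod (P k') (P l')) y by [].
rewrite !atE linearZ /=; case: a => a /= /orP[/eqP i0|/eqP->]; last first.
  by rewrite !scale0r scaler0 subrr.
rewrite i0 expr0 scale1r; apply/eqP; rewrite subr_eq0; apply/eqP.
congr (_ *: _); have [kl|kl] := eqVneq k (l + 1).
  by subst k; rewrite id_family_diag id_family_diff // addrK.
rewrite !id_family_off ?hom0E ?linear0 //.
by apply: contraNneq kl => <-; rewrite subrK.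
Qed.

Definition homothety : chain_map (stalk R^o) (hom_complex P P) :=
  @ChainMap R _ _ (fun n => @homothety_fun n) homothety_diff.

End Homothety.

(** * Semidualizing modules and complexes *)

Section Semidualizing.
Variable R : comNzRingType.

(* [P] is a bounded below complex of projectives quasi-isomorphic to [X], so
   that RHom(X, Y) = Hom(P, Y). *)
Definition projective_resolution (X P : complex R) : Prop :=
  [/\ forall n, projective (P n),
      exists N : int, forall n, (n < N)%R -> forall x : P n, x = 0
    & exists f : chain_map P X, quasi_iso f].

(* Ext^n(M, N) = H_{-n}(RHom(M, N)). *)
Definition ext_vanishes (n : nat) (M N : lmodType R) : Prop :=
  exists P, projective_resolution (stalk M) P /\
    zero_homology (hom_complex P (stalk N)) (- n%:Z).

Definition module_homothety (C : lmodType R) (a : R) : HomMod C C :=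
  to_hom ( *:%R a).

Definition semidualizing_module (C : lmodType R) : Prop :=
  [/\ finitely_generated C,
      bijective (@module_homothety C)
    & forall n : nat, (1 <= n)%N -> ext_vanishes n C C].

Definition semidualizing_complex (K : complex R) : Prop :=
  homologically_finite K /\
  exists P, projective_resolution K P /\ derived_iso (roof_of (homothety P)).

Definition S0_finite : Prop :=
  finitely_many_classes semidualizing_module (@isomorphic R).

Definition S_finite : Prop :=
  finitely_many_classes semidualizing_complex (@shift_isomorphic R).

End Semidualizing.

(* Main.v *)
(** Semidualizing modules.  If [C] is semidualizing, a map [C -> R / p -> C] is an
    endomorphism, hence a scalar killed by [p]; so [C] is torsion-free, and the
    same trick makes any nonzero functional [C -> R] injective.  Since
    [Ext^1(C, C) = 0], a map [C -> R / p -> C / x C] also lifts to a scalar, so a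
    prime associated to [C / x C] is associated to [R / x R], say [p = (x : r)].
    If [C] were not reflexive, such a [p] would contain all values of all
    functionals; then [r / x] maps the nonzero fractional ideal [C*] to itself, is
    integral, and lies in [R] by normality, a contradiction.  So the semidualizing
    modules are among the finitely many elements of [Cl(R)].

    Semidualizing complexes.  Let [P] be a projective resolution of one, [m] a
    maximal ideal, and [i] the lowest degree with [H_i(P)_m <> 0].  Let [Y] be the
    Koszul complex on [P] of a regular sequence of length [dim R_m].  At [m],
    [Hom(P, Y)] has homology in degree 0 only, because [Hom(P, P)] is [R].  By
    Nakayama the highest degree [s'] with [H_s'(Y)_m <> 0] is at least that of [P],
    and [m] is associated to [H_s'(Y)] because a smaller prime containing the
    sequence would have too large a height.  The map
    [P -> H_i(P) -> R / m -> H_s'(Y)] lifts to a map [P -> Y] of degree [s' - i]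
    which is not null-homotopic at [m]; hence [s' = i] and [H(P)_m] lives in one
    degree, the one where [H(P)] is not torsion.  So the complex is a shift of a
    semidualizing module.

    The complexes at hand are resolutions by arbitrary projectives, for which [Hom]
    does not commute with localization; statements at [p] therefore always hold up to
    multiplication by an element outside [p]. *)
Require Import Defs.
From HB Require Import structures.
From mathcomp Require Import all_boot all_order all_algebra.
From mathcomp Require Import generic_quotient ring_quotient boolp ring zify.
(* Importing [Defs] again makes [cycle] its own and not that of [path]. *)
Import Defs.

Set Implicit Arguments.
Unset Strict Implicit.
Unset Printing Implicit Defensive.

Import Order.TTheory GRing.Theory Num.Theory.
Local Open Scope ring_scope.

(** * Submodules and linear relations *)

(** Denominators shape the lifting arguments. Each degree of a lifting may cost one, and infinitely
    many elements outside [p] need not have a common multiple outside [p]. Hence the role of bounded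
    homology: from some degree on it vanishes, lifting is free, and finitely many factors remain to
    be multiplied. Maps into [R / p] are handled as linear relations with values in [R], so that
    these arguments form neither quotients nor localized modules; a total linear relation on a
    projective contains the graph of a linear map. Regularity of the sequence enters only through
    Hom(P, Y): a further cone on [x] turns its homology [R / I] into [R / (I + x)], and nothing
    appears in degree 1 because [x] is regular on [R / I]. The Cohen-Macaulay property makes the
    sequence so long that [m] is the only prime inside [m] containing it. Two complexes with the
    same homology module are linked by a fibre product of truncations rather than by a comparison of
    their resolutions. *)

Section Submodules.
Variable R : comNzRingType.

Definition submodule (M : lmodType R) (N : M -> Prop) : Prop :=
  N 0 /\ forall a x y, N x -> N y -> N (a *: x + y).

Section Theory.
Variables (M : lmodType R) (N : M -> Prop).
Hypothesis subN : submodule N.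

Lemma submodule0 : N 0. Proof. by case: subN. Qed.
Lemma submoduleZ a x : N x -> N (a *: x).
Proof. by case: subN => N0 /(_ a x 0) NZ Nx; move: (NZ Nx N0); rewrite addr0. Qed.
Lemma submoduleD x y : N x -> N y -> N (x + y).
Proof. by case: subN => _ /(_ 1 x y); rewrite scale1r. Qed.
Lemma submoduleN x : N x -> N (- x).
Proof. by rewrite -scaleN1r; apply: submoduleZ. Qed.
Lemma submoduleB x y : N x -> N y -> N (x - y).
Proof. by move=> Nx /submoduleN; apply: submoduleD. Qed.
Lemma submodule_sum (I : Type) (r : seq I) (P : pred I) (F : I -> M) :
  (forall i, P i -> N (F i)) -> N (\sum_(i <- r | P i) F i).
Proof.
by move=> NF; apply: (big_ind N) => //; [exact: submodule0|exact: submoduleD].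
Qed.
Lemma submodule_cancel x y : N (x - y) -> N y -> N x.
Proof. by move=> Nxy Ny; rewrite -[x](subrK y); apply: submoduleD. Qed.

End Theory.

Lemma submodule_zero (M : lmodType R) : submodule (fun x : M => x = 0).
Proof. by split=> // a x y -> ->; rewrite scaler0 addr0. Qed.

Definition linear_relation (M N : lmodType R) (Q : M -> N -> Prop) : Prop :=
  forall a x x' y y', Q x y -> Q x' y' -> Q (a *: x + x') (a *: y + y').

Definition linear_map (M N : lmodType R) (f : M -> N) (fl : linear f) :
  {linear M -> N} := HB.pack f (GRing.isLinear.Build R M N *:%R f fl).

(** Maps out of a quotient are built in this way: well-definedness becomes single-valuedness of
    [Q]. *)
Lemma functional_relation (M N : lmodType R) (Q : M -> N -> Prop) :
  linear_relation Q -> (forall x, exists y, Q x y) ->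
  (forall x y y', Q x y -> Q x y' -> y = y') ->
  exists f : {linear M -> N}, forall x, Q x (f x).
Proof.
move=> Qlin Qtot Qfun; have [f fP] := choice Qtot.
have fl : linear f by move=> a x y; apply: Qfun (fP _) _; apply: Qlin.
by exists (linear_map fl).
Qed.

End Submodules.

Section SubmoduleType.
Variables (R : comNzRingType) (M : lmodType R) (N : M -> Prop).
Hypothesis subN : submodule N.

Definition submodule_pred (_ : submodule N) : {pred M} := fun x => `[< N x >].

Fact submodule_pred_closed : submod_closed (submodule_pred subN).
Proof.
split=> [|a x y /asboolP Nx /asboolP Ny]; apply/asboolP; first exact: submodule0.
by apply: (submoduleD subN) => //; apply: submoduleZ.
Qed.

HB.instance Definition _ :=
  GRing.isSubmodClosed.Build R M (submodule_pred subN) submodule_pred_closed.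

Record submodule_type : Type :=
  SubmoduleElt { submodule_val : M; _ : submodule_val \in submodule_pred subN }.
HB.instance Definition _ := [isSub for submodule_val].
HB.instance Definition _ := [Choice of submodule_type by <:].
HB.instance Definition _ := [SubChoice_isSubLmodule of submodule_type by <:].

Definition submodule_incl : submodule_type -> M := submodule_val.
Fact submodule_incl_linear : linear submodule_incl. Proof. by []. Qed.
HB.instance Definition _ :=
  GRing.isLinear.Build R submodule_type M *:%R submodule_incl submodule_incl_linear.

Lemma submodule_inclP x : N (submodule_incl x).
Proof. by case: x => x /= /asboolP. Qed.
Lemma submodule_incl_inj : injective submodule_incl.
Proof. exact: val_inj. Qed.
Definition submodule_elt x (Nx : N x) : submodule_type :=
  SubmoduleElt (introT (asboolP (N x)) Nx).

End SubmoduleType.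

(** [Q] is a submodule of the product whose first projection is onto; projectivity splits that
    projection, and the second component of the splitting is [f]. In later uses [Q] spells out the
    lifting condition. *)
Lemma projective_relation (R : comNzRingType) (P N : lmodType R) (Q : P -> N -> Prop) :
  projective P -> linear_relation Q -> (forall x, exists y, Q x y) ->
  exists f : {linear P -> N}, forall x, Q x (f x).
Proof.
move=> Pproj Qlin Qtot.
have sQ : submodule (fun u : P * N => Q u.1 u.2).
  split=> [|a u v] /=; last exact: Qlin.
  have [y Qy] := Qtot 0; have := Qlin (-1) _ _ _ _ Qy Qy.
  by rewrite scaler0 addr0 scaleN1r addNr.
have fst_lin : linear (fun u : submodule_type sQ => (submodule_incl u).1) by [].
have snd_lin : linear (fun u : submodule_type sQ => (submodule_incl u).2) by [].
have [|h hP] := Pproj _ _ (linear_map fst_lin) idfun.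
  move=> x; have [y Qxy] := Qtot x.
  by exists (submodule_elt sQ (Qxy : (fun u => Q u.1 u.2) (x, y))).
exists (linear_map snd_lin \o h) => x /=; rewrite -{1}[x]hP; exact: (submodule_inclP (h x)).
Qed.

Section QuotientModule.
Variables (R : comNzRingType) (M : lmodType R) (N : M -> Prop).
Hypothesis subN : submodule N.
Local Open Scope quotient_scope.

Definition quotient_type : Type := Quotient.quot (submodule_pred subN).
HB.instance Definition _ := GRing.Zmodule.on quotient_type.
HB.instance Definition _ := EqQuotient.on quotient_type.

Let cls (x : M) : quotient_type := \pi_quotient_type x.
Let rep (u : quotient_type) : M := repr u.

Let clsK u : cls (rep u) = u. Proof. exact: reprK. Qed.
Let clsP x y : cls x = cls y <-> N (x - y).
Proof.
rewrite /cls; split=> [/eqmodP|Nxy]; last apply/eqmodP.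
  by move/asboolP.
by apply/asboolP.
Qed.
Let rep_cls x : N (rep (cls x) - x). Proof. by apply/clsP/clsK. Qed.
Let clsD x y : cls (x + y) = cls x + cls y.
Proof. exact: Quotient.pi_add. Qed.
Let cls_ind (P : quotient_type -> Prop) : (forall x, P (cls x)) -> forall u, P u.
Proof. by move=> Pc u; rewrite -[u]clsK. Qed.

Let scale a (u : quotient_type) : quotient_type := cls (a *: rep u).
Let scale_cls a x : scale a (cls x) = cls (a *: x).
Proof. by apply/clsP; rewrite -scalerBr; apply: submoduleZ (rep_cls x). Qed.
Let scaleA a b u : scale a (scale b u) = scale (a * b) u.
Proof. by elim/cls_ind: u => x; rewrite !scale_cls scalerA. Qed.
Let scale1 : left_id 1 scale.
Proof. by elim/cls_ind => x; rewrite scale_cls scale1r. Qed.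
Let scaleDr : right_distributive scale +%R.
Proof.
move=> a; elim/cls_ind=> x; elim/cls_ind=> y.
by rewrite -clsD !scale_cls -clsD scalerDr.
Qed.
Let scaleDl u : {morph scale^~ u : a b / a + b}.
Proof. by move=> a b; elim/cls_ind: u => x; rewrite !scale_cls -clsD scalerDl. Qed.
HB.instance Definition _ :=
  GRing.Zmodule_isLmodule.Build R quotient_type scaleA scale1 scaleDr scaleDl.

Lemma quotient_module : exists (Q : lmodType R) (q : {linear M -> Q}),
  (forall y, exists x, q x = y) /\ (forall x, q x = 0 <-> N x).
Proof.
have cls_lin : linear cls by move=> a x y; rewrite clsD -scale_cls.
exists quotient_type, (linear_map cls_lin); split=> [y|x]; first by exists (rep y).
have cls0 : cls 0 = 0 by apply: (addIr (cls 0)); rewrite -clsD !add0r.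
by rewrite /= -cls0 clsP subr0.
Qed.

End QuotientModule.

(** * Noetherian modules *)

Section Span.
Variable R : comNzRingType.
Implicit Types M : lmodType R.

(** The submodule [B + R s], by recursion on the list so that generators can be treated one at a
    time; [span_modP] recovers the usual sum. *)
Fixpoint span_mod M (B : M -> Prop) (s : seq M) (x : M) : Prop :=
  if s is v :: s' then exists a : R, span_mod B s' (x - a *: v) else B x.

(* [B] need not be contained in [Z]. *)
Definition fg_mod M (Z B : M -> Prop) : Prop :=
  exists s : seq M, (forall v, v \in s -> Z v) /\ forall z, Z z -> span_mod B s z.

Lemma span_mod_submodule M (B : M -> Prop) s : submodule B -> submodule (span_mod B s).
Proof.
move=> sB; elim: s => //= v s IHs; split=> [|a x y [b xb] [c yc]].
  by exists 0; rewrite scale0r subr0; apply: submodule0.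
exists (a * b + c); rewrite scalerDl -scalerA opprD addrACA -scalerBr.
by apply: submoduleD => //; apply: submoduleZ.
Qed.

Lemma span_mod_sub M (B B' : M -> Prop) s x :
  (forall y, B y -> B' y) -> span_mod B s x -> span_mod B' s x.
Proof.
move=> BB'; elim: s x => [|v s IHs] x /=; first exact: BB'.
by move=> [a /IHs xa]; exists a.
Qed.

Lemma span_mod_base M (B : M -> Prop) s x : submodule B -> B x -> span_mod B s x.
Proof.
move=> sB; elim: s x => [|v s IHs] x //= Bx; exists 0.
by rewrite scale0r subr0; apply: IHs.
Qed.

Lemma span_mod_mem M (B : M -> Prop) s v : submodule B -> v \in s -> span_mod B s v.
Proof.
move=> sB; elim: s => //= u s IHs; rewrite inE => /predU1P[->|/IHs vs].
  by exists 1; rewrite scale1r subrr; exact: submodule0 (span_mod_submodule s sB).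
by exists 0; rewrite scale0r subr0.
Qed.

Lemma span_mod_cat M (B : M -> Prop) s1 s2 x :
  span_mod B (s1 ++ s2) x <-> span_mod (span_mod B s2) s1 x.
Proof.
by elim: s1 x => [|v s1 IHs] x //=; split=> -[a /IHs xa]; exists a.
Qed.

Lemma span_mod_closed M (B Z : M -> Prop) s x : submodule Z ->
  (forall y, B y -> Z y) -> (forall v, v \in s -> Z v) -> span_mod B s x -> Z x.
Proof.
move=> sZ BZ; elim: s x => [|v s IHs] x sZs /=; first exact: BZ.
move=> [a /IHs xa]; apply: (submodule_cancel sZ) (submoduleZ sZ a (sZs v _)).
  by apply: xa => u us; apply: sZs; rewrite inE us orbT.
by rewrite inE eqxx.
Qed.

Lemma span_modP M (B : M -> Prop) s x : span_mod B s x <->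
  exists c : 'I_(size s) -> R, B (x - \sum_i c i *: s`_i).
Proof.
elim: s x => [|v s IHs] x /=.
  split=> [Bx|[c]]; last by rewrite big_ord0 subr0.
  by exists (fun=> 0); rewrite big_ord0 subr0.
split=> [[a /IHs[c Bc]]|[c]].
  exists (fun i => if unlift ord0 i is Some j then c j else a).
  rewrite big_ord_recl unlift_none /= opprD addrA.
  by under eq_bigr do rewrite liftK.
rewrite big_ord_recl opprD addrA => Bc; exists (c ord0); apply/IHs.
by exists (fun i => c (lift ord0 i)).
Qed.

Lemma spanned_span M (s : seq M) x : spanned s x <-> span_mod (fun y => y = 0) s x.
Proof.
rewrite span_modP; split=> -[c xc]; exists c; first by rewrite xc subrr.
by apply/eqP; rewrite -subr_eq0 xc.
Qed.

End Span.

Section Noetherian.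
Variable R : comNzRingType.
Hypothesis noethR : noetherian R.
Implicit Types M : lmodType R.

Lemma noetherian_ideal (I : R^o -> Prop) : submodule I ->
  exists s : seq R^o, forall x, I x <-> span_mod (fun y => y = 0) s x.
Proof.
move=> sI; have [s sP] := noethR (submodule_pred_closed sI).
by exists s => x; rewrite -spanned_span -sP; split=> /asboolP.
Qed.

(** Induction on the generators of [Z] modulo [B]. The coefficients of the first generator [v] in
    elements of [Z'] form an ideal [I]; lifts of its generators ([s1]) and generators of the
    elements whose coefficient can be taken to be 0 ([s2]) together generate [Z']. *)
Lemma fg_mod_sub M (Z Z' B : M -> Prop) : submodule Z' -> submodule B ->
  (forall z, Z' z -> Z z) -> fg_mod Z B -> fg_mod Z' B.
Proof.
move=> sZ' sB ZZ' [s [_ sZ]].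
have {Z ZZ' sZ} : forall z, Z' z -> span_mod B s z by move=> z /ZZ'/sZ.
elim: s Z' sZ' => [|v s IHs] Z' sZ' /= sZ; first by exists [::].
pose I (a : R^o) := exists2 z, Z' z & span_mod B s (z - a *: v).
have sS := span_mod_submodule s sB.
have sI : submodule I.
  split=> [|a x y [z Zz zx] [t Zt ty]].
    by exists 0; [exact: submodule0|rewrite scale0r subr0; exact: submodule0].
  exists (a *: z + t); first by apply: submoduleD (submoduleZ _ _ _) _.
  rewrite scalerDl -scalerA opprD addrACA -scalerBr.
  by apply: submoduleD (submoduleZ _ _ _) _.
have [t tP] := noetherian_ideal sI.
have [| |s2 [s2Z' s2P]] := IHs (fun z => Z' z /\ span_mod B s z).
- split=> [|a x y [Zx sx] [Zy sy]]; first by split; apply: submodule0.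
  by split; apply: submoduleD (submoduleZ _ _ _) _.
- by move=> z [].
have [s1 s1Z' s1P] : exists2 s1 : seq M, (forall z, z \in s1 -> Z' z) &
    forall (a : R^o), span_mod (fun y => y = 0) t a ->
    exists2 z, span_mod (fun y => y = 0) s1 z & span_mod B s (z - a *: v).
  have: forall a, a \in t -> I a.
    by move=> a ta; apply/tP; exact: span_mod_mem (submodule_zero _) ta.
  elim: t {tP} => [|b t IHt] tI.
    by exists [::] => //= a ->; exists 0 => //; rewrite scale0r subr0; apply: submodule0.
  have [|s1 s1Z' s1P] := IHt; first by move=> a ta; apply: tI; rewrite inE ta orbT.
  have [w Zw wb] : I b by apply: tI; rewrite inE eqxx.
  exists (w :: s1) => [z|a /= [c /s1P[z z1 zP]]].
    by rewrite inE => /predU1P[->|/s1Z'].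
  exists (c *: w + z); first by exists c; rewrite addrAC subrr add0r.
  rewrite -[a](subrKC (c *: b)) scalerDl opprD addrACA -[(c *: b) *: v]scalerA -scalerBr.
  by apply: submoduleD => //; apply: submoduleZ.
exists (s1 ++ s2); split=> [z|z Zz]; first by rewrite mem_cat => /orP[/s1Z'|/s2Z'[]].
have [a za] := sZ z Zz.
have [|w w1 wa] := s1P a; first by apply/tP; exists z.
have sS2 := span_mod_submodule s2 sB.
have sS12 : submodule (span_mod (span_mod B s2) s1) by apply: span_mod_submodule.
apply/span_mod_cat; rewrite -[z](subrK w); apply: (submoduleD sS12).
  apply: span_mod_base => //; apply: s2P; split.
    apply: (submoduleB sZ') => //.
    by apply: span_mod_closed w1 => // y ->; apply: submodule0.
  have -> : z - w = (z - a *: v) - (w - a *: v) by rewrite opprB addrA subrK.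
  exact: submoduleB sS _ _ za wa.
apply: span_mod_sub w1 => y ->; exact: submodule0.
Qed.

(** Without a maximal element, [next] builds a strictly increasing chain in [F]; its union is
    generated by finitely many elements, which already lie in one member [c n]. *)
Lemma noetherian_max (F : (R^o -> Prop) -> Prop) : (exists I, F I) ->
  (forall I, F I -> submodule I) ->
  exists2 I, F I & forall J, F J -> (forall x, I x -> J x) -> forall x, J x -> I x.
Proof.
move=> [I0 FI0] Fsub; apply: contrapT => noMax.
have step I : exists J, F I -> [/\ F J, forall x, I x -> J x & exists2 x, J x & ~ I x].
  have [FI|] := pselect (F I); last by exists I.
  apply: contrapT => /forallNP noJ; apply: noMax; exists I => // J FJ IJ x Jx.
  by apply: contrapT => nIx; apply: (noJ J) => _; split=> //; exists x.
have [next nextP] := choice step.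
pose c := fix c n := if n is n'.+1 then next (c n') else I0.
have Fc n : F (c n) by elim: n => //= n /nextP[].
have cS n x : c n x -> c n.+1 x by have [_ /(_ x)] := nextP _ (Fc n).
have cle m n x : (m <= n)%N -> c m x -> c n x.
  move=> /subnKC<-; elim: (n - m)%N => [|k IHk]; rewrite ?addn0 // addnS => cmx.
  exact/cS/IHk.
have sU : submodule (fun x => exists n, c n x).
  split=> [|a x y [m cx] [n cy]]; first by exists 0%N; exact: submodule0 (Fsub _ (Fc 0%N)).
  have sc := Fsub _ (Fc (maxn m n)).
  exists (maxn m n); apply: submoduleD (submoduleZ _ _ _) _ => //.
    by apply: cle cx; rewrite leq_maxl.
  by apply: cle cy; rewrite leq_maxr.
have [s sP] := noetherian_ideal sU.
have [n nP] : exists n, forall x, x \in s -> c n x.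
  have: forall x, x \in s -> exists n, c n x.
    by move=> x xs; apply/sP; exact: span_mod_mem (submodule_zero _) xs.
  elim: s {sP} => [|v s IHs] sc; first by exists 0%N.
  have [|n nP] := IHs; first by move=> x xs; apply: sc; rewrite inE xs orbT.
  have [|k kP] := sc v; first by rewrite inE eqxx.
  exists (maxn n k) => x; rewrite inE => /predU1P[->|/nP cx].
    by apply: cle kP; rewrite leq_maxr.
  by apply: cle cx; rewrite leq_maxl.
have [_ _ [x cx]] := nextP _ (Fc n); apply.
have: span_mod (fun y => y = 0) s x by apply/sP; exists n.+1.
by apply: span_mod_closed => // [|y ->]; [exact/Fsub|exact: submodule0 (Fsub _ (Fc n))].
Qed.

End Noetherian.

(** * Prime ideals, Nakayama's lemma and associated primes *)

Section Primes.
Variable R : comNzRingType.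
Implicit Types M : lmodType R.

Definition mult_closed (S : R -> Prop) : Prop :=
  S 1 /\ forall a b, S a -> S b -> S (a * b).

Lemma mult_closed_one : mult_closed (fun t => t = 1).
Proof. by split=> // a b -> ->; rewrite mulr1. Qed.

Definition ideal (I : R -> Prop) : Prop := @submodule R R^o I.

Definition prime_ideal (p : R -> Prop) : Prop :=
  [/\ ideal p, ~ p 1 & forall a b, p (a * b) -> p a \/ p b].

Definition outside (p : R -> Prop) : R -> Prop := fun t => ~ p t.

Lemma outside_mult p : prime_ideal p -> mult_closed (outside p).
Proof. by move=> [_ p1 pM]; split=> // a b na nb /pM[]. Qed.

Lemma ideal0 (I : R -> Prop) : ideal I -> I 0.
Proof. exact: (@submodule0 R R^o). Qed.
Lemma idealD (I : R -> Prop) a b : ideal I -> I a -> I b -> I (a + b).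
Proof. by move=> sI; apply: (@submoduleD R R^o). Qed.
Lemma idealB (I : R -> Prop) a b : ideal I -> I a -> I b -> I (a - b).
Proof. by move=> sI; apply: (@submoduleB R R^o). Qed.
Lemma ideal_mull (I : R -> Prop) a b : ideal I -> I b -> I (a * b).
Proof. by move=> sI; apply: (@submoduleZ R R^o). Qed.
Lemma ideal_mulr (I : R -> Prop) a b : ideal I -> I a -> I (a * b).
Proof. by move=> sI Ia; rewrite mulrC; apply: ideal_mull. Qed.

Lemma ideal_prod_congr (I : R -> Prop) n (a b : 'I_n -> R) : ideal I ->
  (forall i, I (a i - b i)) -> I (\prod_i a i - \prod_i b i).
Proof.
move=> sI ab; apply: (big_ind2 (fun x y => I (x - y))) => // [|x y z t xy zt].
  by rewrite subrr; apply: ideal0.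
have -> : x * z - y * t = (x - y) * z + y * (z - t) by ring.
by apply: idealD => //; [apply: ideal_mulr|apply: ideal_mull].
Qed.

Lemma ideal_det_congr (I : R -> Prop) n (A B : 'M[R]_n) : ideal I ->
  (forall i j, I (A i j - B i j)) -> I (\det A - \det B).
Proof.
move=> sI AB; apply: (big_ind2 (fun x y => I (x - y))) => [|x y z t xy zt|s _].
- by rewrite subrr; apply: ideal0.
- by rewrite opprD addrACA; apply: idealD.
by rewrite -mulrBr; apply: ideal_mull => //; apply: ideal_prod_congr.
Qed.

(** The rows of the adjugate combine the given relations into [\det A *: v j]. *)
Lemma cramer_mod M (N : M -> Prop) n (A : 'M[R]_n) (v : 'I_n -> M) : submodule N ->
  (forall i, N (\sum_j A i j *: v j)) -> forall j, N (\det A *: v j).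
Proof.
move=> sN NA k.
have -> : \det A *: v k = \sum_i \adj A k i *: \sum_j A i j *: v j.
  under [RHS]eq_bigr do rewrite scaler_sumr.
  rewrite exchange_big /= (bigD1 k) //= [X in _ + X]big1 => [|j jk].
    under eq_bigr do rewrite scalerA.
    have /matrixP/(_ k k) := mul_adj_mx A.
    by rewrite !mxE eqxx mulr1n => <-; rewrite addr0 scaler_suml.
  under eq_bigr do rewrite scalerA.
  have /matrixP/(_ k j) := mul_adj_mx A.
  by rewrite !mxE eq_sym (negPf jk) mulr0n -scaler_suml => ->; rewrite scale0r.
by apply: submodule_sum => // i _; apply: submoduleZ.
Qed.

(** The submodule [I s + N], which for [I = p] is the one that Nakayama's lemma compares with the
    span of [s]. *)
Definition ideal_span (I : R -> Prop) M (N : M -> Prop) (s : seq M) (x : M) : Prop :=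
  exists2 c : 'I_(size s) -> R, forall i, I (c i) & N (x - \sum_i c i *: s`_i).

Lemma ideal_span_submodule (I : R -> Prop) M (N : M -> Prop) s : ideal I -> submodule N ->
  submodule (ideal_span I N s).
Proof.
move=> sI sN; split=> [|a x y [c Ic Nc] [d Id Nd]].
  exists (fun=> 0) => [i|]; first exact: ideal0.
  by rewrite big1 ?subr0 => [|i _]; [exact: submodule0|rewrite scale0r].
exists (fun i => a * c i + d i) => [i|].
  by apply: idealD => //; apply: ideal_mull.
under eq_bigr do rewrite scalerDl -scalerA.
rewrite big_split /= -scaler_sumr opprD addrACA -scalerBr.
by apply: submoduleD => //; apply: submoduleZ.
Qed.

Lemma ideal_span_base (I : R -> Prop) M (N : M -> Prop) s x : ideal I ->
  N x -> ideal_span I N s x.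
Proof.
move=> sI Nx; exists (fun=> 0) => [i|]; first exact: ideal0.
by rewrite big1 ?subr0 // => i _; rewrite scale0r.
Qed.

Lemma ideal_span_scale (I : R -> Prop) M (N : M -> Prop) s a x : ideal I -> submodule N ->
  I a -> span_mod N s x -> ideal_span I N s (a *: x).
Proof.
move=> sI sN Ia /span_modP[c Nc]; exists (fun i => a * c i) => [i|].
  exact: ideal_mulr.
under eq_bigr do rewrite -scalerA.
by rewrite -scaler_sumr -scalerBr; apply: submoduleZ.
Qed.

(** The hypotheses are relations with matrix [A], the diagonal of the [T i] minus entries [C i j] in
    [p]. Then [\det A] kills the generators modulo [N], and it is congruent modulo [p] to the
    product of the [T i], so it lies outside [p]. *)
Lemma nakayama (p : R -> Prop) M (N : M -> Prop) (s : seq M) :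
  prime_ideal p -> submodule N ->
  (forall v, v \in s -> exists2 t, ~ p t & ideal_span p N s (t *: v)) ->
  exists2 t, ~ p t & forall v, v \in s -> N (t *: v).
Proof.
move=> pp sN ps; have [sp p1 pM] := pp.
have /choice[T TP] : forall i : 'I_(size s), exists t, ~ p t /\ ideal_span p N s (t *: s`_i).
  by move=> i; have [|t] := ps s`_i; [exact: mem_nth|exists t].
have /choice[C CP] : forall i : 'I_(size s), exists c : 'I_(size s) -> R,
    (forall j, p (c j)) /\ N (T i *: s`_i - \sum_j c j *: s`_j).
  by move=> i; have [_ [c]] := TP i; exists c.
pose D := diag_mx (\row_i T i); pose A := D - \matrix_(i, j) C i j.
exists (\det A) => [pA|v /(nthP 0)[k ks <-]].
  have : p (\det D).
    rewrite -[\det D](subKr (\det A)); apply: idealB => //.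
    apply: ideal_det_congr => // i j; rewrite !mxE addrAC subrr add0r -mulN1r.
    by apply: ideal_mull => //; case: (CP i).
  rewrite det_diag; under eq_bigr do rewrite mxE.
  apply: (big_ind (fun x => ~ p x)) => // [x y nx ny /pM[]//|i _].
  by case: (TP i).
rewrite -[k]/(nat_of_ord (Ordinal ks)); move: (Ordinal ks) => {ks}k.
apply: (cramer_mod (v := fun i => s`_i) sN) => i.
have [_] := CP i; congr N.
under [RHS]eq_bigr do rewrite !mxE scalerBl.
rewrite sumrB; congr (_ - _); rewrite (bigD1 i) //= eqxx mulr1n big1 ?addr0 //.
by move=> j ji; rewrite eq_sym (negPf ji) mulr0n scale0r.
Qed.

(** The product of the denominators of finitely many generators serves all of [Z]. *)
Lemma common_denominator M (Z N L : M -> Prop) (S : R -> Prop) : mult_closed S ->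
  submodule L -> (forall z, N z -> L z) -> fg_mod Z N ->
  (forall z, Z z -> exists2 t, S t & L (t *: z)) ->
  exists2 t, S t & forall z, Z z -> L (t *: z).
Proof.
move=> [S1 SM] sL NL [s [sZ sP]] ZL.
suff [t St tP] : exists2 t, S t & forall v, v \in s -> L (t *: v).
  exists t => // z /sP; apply: (span_mod_closed (Z := fun x => L (t *: x))) => //.
    split=> [|a x y Lx Ly]; first by rewrite scaler0; apply: submodule0.
    by rewrite scalerDr scalerA mulrC -scalerA; apply: submoduleD (submoduleZ _ _ _) _.
  by move=> y /NL Ly; apply: submoduleZ.
have {sP} : forall v, v \in s -> exists2 t, S t & L (t *: v) by move=> v /sZ/ZL.
elim: s {sZ} => [|v s IHs] sL'; first by exists 1.
have [|t St tP] := IHs; first by move=> w ws; apply: sL'; rewrite inE ws orbT.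
have [|u Su uP] := sL' v; first by rewrite inE eqxx.
exists (t * u) => [|w]; first exact: SM.
rewrite inE => /predU1P[->|/tP tw]; rewrite ?[t * u]mulrC -scalerA; last exact: submoduleZ.
by rewrite scalerA mulrC -scalerA; apply: submoduleZ.
Qed.

(* [Phi z a] says that a nonzero map [Z / N -> R / p] takes [z] to the class of [a]. *)
Lemma residue_functional (p : R -> Prop) M (Z N : M -> Prop) :
  prime_ideal p -> submodule Z -> submodule N -> fg_mod Z N ->
  (forall t, ~ p t -> exists2 z, Z z & ~ N (t *: z)) ->
  exists Phi : M -> R^o -> Prop,
  [/\ linear_relation Phi, forall z, Z z -> exists a, Phi z a,
      forall z a, N z -> Phi z a -> p a & exists z a, [/\ Z z, Phi z a & ~ p a]].
Proof.
move=> pp sZ sN fgZ nZ; have [s [sZs sP]] := fgZ; have [sp p1 pM] := pp.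
have nM a b : ~ p a -> ~ p b -> ~ p (a * b) by move=> na nb /pM[].
(* Induction on a list [r] generating [Z] modulo [L], where [L] contains [N] and [p Z] and is
   saturated at [p]. Thus [Z / L] is torsion-free over [R / p], and [L] grows until this quotient
   has rank one. *)
suff ind : forall (r : seq M) (L : M -> Prop), (forall v, v \in r -> Z v) ->
    submodule L -> (forall z, N z -> L z) -> (forall a z, p a -> Z z -> L (a *: z)) ->
    (forall t z, ~ p t -> L (t *: z) -> L z) -> (forall z, Z z -> span_mod L r z) ->
    (exists2 z, Z z & ~ L z) -> exists Phi : M -> R^o -> Prop,
  [/\ linear_relation Phi, forall z, Z z -> exists a, Phi z a,
      forall z a, N z -> Phi z a -> p a & exists z a, [/\ Z z, Phi z a & ~ p a]].
  (* The saturation of [p Z + N]; by Nakayama's lemma it is not all of [Z]. *)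
  pose L0 z := exists2 t, ~ p t & ideal_span p N s (t *: z).
  have sI := ideal_span_submodule s sp sN.
  apply: (ind s L0) => //.
  - split=> [|a x y [t nt tx] [u nu uy]].
      by exists 1 => //; rewrite scaler0; apply: submodule0 sI.
    exists (t * u); first exact: nM.
    have -> : (t * u) *: (a *: x + y) = (u * a) *: (t *: x) + t *: (u *: y).
      by rewrite scalerDr !scalerA; congr (_ *: _ + _); ring.
    by apply: submoduleD => //; apply: submoduleZ.
  - by move=> z Nz; exists 1 => //; rewrite scale1r; apply: ideal_span_base.
  - by move=> a z pa /sP; exists 1 => //; rewrite scale1r; apply: ideal_span_scale.
  - move=> t z nt [u nu uz]; exists (u * t); first exact: nM.
    by rewrite -scalerA.
  - move=> z /sP; apply: span_mod_sub => y Ny; exists 1 => //.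
    by rewrite scale1r; apply: ideal_span_base.
  apply: contrapT => /forall2NP L0Z.
  have [|t nt tP] := nakayama (s := s) pp sN.
    by move=> v /sZs Zv; have [//|/contrapT] := L0Z v.
  have [z /sP Zz] := nZ t nt; apply.
  apply: (span_mod_closed (Z := fun x => N (t *: x))) Zz => //.
    split=> [|a x y Lx Ly]; first by rewrite scaler0; apply: submodule0.
    by rewrite scalerDr scalerA mulrC -scalerA; apply: submoduleD (submoduleZ _ _ _) _.
  by move=> y Ny; apply: submoduleZ.
elim=> [|v r IHr] L rZ sL NL pL Lsat Lr [z0 Zz0 nz0]; first by case: nz0; apply: Lr.
have Zv : Z v by apply: rZ; rewrite inE eqxx.
(* The saturation of [L + R v]. If it misses part of [Z], it replaces [L] and the induction drops
   [v]; otherwise [Z / L] has rank one, spanned by [v], and the coefficient of [v] is the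
   functional. *)
pose L1 z := exists2 t, ~ p t & exists a, L (t *: z - a *: v).
have LL1 z : L z -> L1 z.
  by exists 1 => //; exists 0; rewrite scale1r scale0r subr0.
have sL1 : submodule L1.
  split=> [|a x y [t nt [b xb]] [u nu [c yc]]]; first by apply: LL1; exact: submodule0 sL.
  exists (t * u); [exact: nM|exists (u * a * b + t * c)].
  have -> : (t * u) *: (a *: x + y) - (u * a * b + t * c) *: v =
     (u * a) *: (t *: x - b *: v) + t *: (u *: y - c *: v).
    rewrite !scalerDr !scalerN scalerDl !scalerA opprD addrACA.
    by congr (_ *: _ - _ + _); ring.
  by apply: submoduleD => //; apply: submoduleZ.
have [[z1 Zz1 nz1]|L1Z] := pselect (exists2 z, Z z & ~ L1 z).
  apply: (IHr L1) => //.
  - by move=> w wr; apply: rZ; rewrite inE wr orbT.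
  - by move=> z /NL/LL1.
  - by move=> a z pa Zz; apply/LL1/pL.
  - move=> t z nt [u nu [a uz]]; exists (u * t); first exact: nM.
    by exists a; rewrite -scalerA.
  - move=> z Zz; have [a /(span_mod_sub LL1) za] := Lr z Zz.
    have sS := span_mod_submodule r sL1.
    apply: (submodule_cancel sS) za _; apply: submoduleZ => //.
    apply: span_mod_base => //; exists 1 => //; exists 1.
    by rewrite subrr; apply: submodule0.
  - by exists z1.
have {}L1Z z : Z z -> L1 z.
  by move=> Zz; apply: contrapT => nz; apply: L1Z; exists z.
have sLv := span_mod_submodule [:: v] sL.
have [z Nz|z /L1Z[t nt [a az]]|t nt tP] :=
    common_denominator (outside_mult pp) sLv _ fgZ.
- by apply: span_mod_base => //; apply: NL.
- by exists t => //; exists a.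
have nv : ~ L v.
  move=> Lv; apply: nz0; have [t' nt' [a az]] := L1Z _ Zz0.
  apply: Lsat nt' _; apply: (submodule_cancel sL) az _; exact: submoduleZ.
(* As [t] is a common denominator, [v] itself is sent to the class of [t], which is nonzero in
   [R / p]. *)
exists (fun z a => L (t *: z - (a : R) *: v)); split.
- move=> a x x' b b' /= xb xb'.
  have -> : t *: (a *: x + x') - (a * b + b' : R) *: v =
     a *: (t *: x - b *: v) + (t *: x' - b' *: v).
    rewrite !scalerDr !scalerN scalerDl !scalerA opprD addrACA.
    by congr (_ *: _ - _ + _); ring.
  by apply: submoduleD => //; apply: submoduleZ.
- by move=> z /tP[a]; exists a.
- move=> z a Nz Lz; apply: contrapT => na; apply: nv; apply: (Lsat a) => //.
  have -> : a *: v = t *: z - (t *: z - a *: v) by rewrite subKr.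
  by apply: submoduleB => //; apply: submoduleZ => //; apply: NL.
exists v, t; split=> //; rewrite subrr; exact: submodule0.
Qed.

Definition annihilator M (N : M -> Prop) (x : M) : R -> Prop := fun r => N (r *: x).

Lemma annihilator_ideal M (N : M -> Prop) x : submodule N -> ideal (annihilator N x).
Proof.
move=> sN; split=> [|a b c Nb Nc]; rewrite /annihilator.
  by rewrite scale0r; apply: submodule0.
by rewrite scalerDl -scalerA; apply: submoduleD => //; apply: submoduleZ.
Qed.

Hypothesis noethR : noetherian R.

(** Among the annihilators of multiples of [u] that avoid [S], a maximal one is prime. For [S] the
    complement of a prime [q] this yields an associated prime inside [q]; for [S] reduced to 1, some
    associated prime. *)
Lemma associated_prime M (N : M -> Prop) (S : R -> Prop) u : submodule N ->
  mult_closed S -> (forall t, S t -> ~ N (t *: u)) ->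
  exists b, prime_ideal (annihilator N (b *: u)) /\
    forall t, S t -> ~ annihilator N (b *: u) t.
Proof.
move=> sN [S1 SM] uS.
pose F (I : R -> Prop) := (exists b, I = annihilator N (b *: u)) /\ forall t, S t -> ~ I t.
have [||I [[b Ib] IS] Imax] := @noetherian_max R noethR F.
- exists (annihilator N (1 *: u)); split; first by exists 1.
  by rewrite scale1r => t /uS.
- by move=> I [[b ->] _]; apply: annihilator_ideal.
exists b; rewrite -Ib; split=> //.
have sI : ideal I by rewrite Ib; apply: annihilator_ideal.
have grow c : (forall t, S t -> ~ I (t * c)) -> forall x, I (x * c) -> I x.
  move=> cS x xc; apply: (Imax (annihilator N ((c * b) *: u))).
  - split; first by exists (c * b).
    by move=> t /cS; rewrite Ib /annihilator !scalerA mulrA.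
  - move=> y; rewrite Ib /annihilator !scalerA => yb.
    by rewrite mulrCA -scalerA; apply: submoduleZ.
  by move: xc; rewrite Ib /annihilator !scalerA mulrA.
split=> [//||x y xy]; first exact: IS.
have [[t St ty]|nt] := pselect (exists2 t, S t & I (t * y)).
  right; apply: (grow t) => [v Sv vt|]; last by rewrite mulrC.
  exact: (IS _ (SM _ _ Sv St)).
left; apply: (grow y) => // t St ty; apply: nt; by exists t.
Qed.

(** An associated prime of [R / I]: the annihilator of a multiple of the class of 1. *)
Lemma exists_prime_ideal (I : R -> Prop) (S : R -> Prop) : ideal I -> mult_closed S ->
  (forall t, S t -> ~ I t) ->
  exists p, [/\ prime_ideal p, forall x, I x -> p x & forall t, S t -> ~ p t].
Proof.
move=> sI mS IS; have [|b [pb bS]] := @associated_prime R^o I S 1 sI mS.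
  by move=> t /IS; rewrite /GRing.scale /= mulr1.
exists (annihilator (I : R^o -> Prop) (b *: (1 : R^o))); split=> // x Ix.
exact: (ideal_mulr _ sI).
Qed.

Lemma exists_maximal_ideal (I : R -> Prop) : ideal I -> ~ I 1 ->
  exists m, [/\ prime_ideal m, forall x, I x -> m x &
    forall J, ideal J -> (forall x, m x -> J x) -> ~ J 1 -> forall x, J x -> m x].
Proof.
move=> sI I1.
pose F (J : R -> Prop) := [/\ ideal J, ~ J 1 & forall x, I x -> J x].
have [||m [sm m1 Im] mmax] := @noetherian_max R noethR F; first by exists I.
  by move=> J [].
have {}mmax J : ideal J -> (forall x, m x -> J x) -> ~ J 1 -> forall x, J x -> m x.
  by move=> sJ mJ J1; apply: mmax => //; split=> // x /Im/mJ.
exists m; split=> //; split=> // a b mab.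
have [ma|na] := pselect (m a); [by left|right].
pose J x := exists c, m (x - c * a).
have sJ : ideal J.
  split=> [|d x y [c xc] [e ye]]; first by exists 0; rewrite mul0r subr0; apply: ideal0.
  exists (d * c + e); have -> : d * x + y - (d * c + e) * a = d * (x - c * a) + (y - e * a) by ring.
  by apply: idealD => //; apply: ideal_mull.
have [[c c1]|nJ1] := pselect (J 1).
  have -> : b = (1 - c * a) * b + c * (a * b) by ring.
  by apply: idealD; [|exact: ideal_mulr|exact: ideal_mull].
case: na; apply: mmax sJ _ nJ1 _ _ => [x mx|].
  by exists 0; rewrite mul0r subr0.
by exists 1; rewrite mul1r subrr; apply: ideal0.
Qed.

End Primes.

Lemma prime_zero (R : idomainType) : prime_ideal (fun r : R => r = 0).
Proof.
split; first exact: submodule_zero; first by apply/eqP; apply: oner_neq0.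
by move=> a b /eqP; rewrite mulf_eq0 => /orP[]/eqP->; [left|right].
Qed.

(** * Semidualizing modules over normal domains *)

Section StalkMaps.
Variables (R : comNzRingType) (C : lmodType R).

Fact stalk_elt_in (n : int) (x : C) : (if n == 0 then x else 0) \in @stalk_pred R C n.
Proof. by rewrite unfold_in; case: (n == 0); rewrite ?eqxx ?orbT. Qed.

(** Set to 0 off degree 0, so that it is linear in every degree and asks for no proof of [n = 0]. *)
Definition stalk_elt (n : int) (x : C) : stalk_obj C n := MkStalk (stalk_elt_in n x).

Fact stalk_elt_linear n : linear (stalk_elt n).
Proof.
move=> a x y; apply: val_inj => /=; change ((if n == 0 then a *: x + y else 0) =
  a *: (if n == 0 then x else 0) + (if n == 0 then y else 0)).
by case: ifP => // _; rewrite scaler0 addr0.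
Qed.

HB.instance Definition _ n :=
  GRing.isLinear.Build R C (stalk_obj C n) *:%R (stalk_elt n) (stalk_elt_linear n).

Lemma stalk_val0 n (x : stalk_obj C n) : n != 0 -> x = 0.
Proof.
case: x => x xn n0; apply: val_inj => /=.
by have := xn; rewrite unfold_in (negPf n0) => /eqP.
Qed.

Lemma stalk_eltK n x : n = 0 -> stalk_val (stalk_elt n x) = x.
Proof. by move=> ->. Qed.

Fact stalk_val_linear n : linear (@stalk_val R C n). Proof. by []. Qed.
HB.instance Definition _ n :=
  GRing.isLinear.Build R (stalk_obj C n) C *:%R (@stalk_val R C n) (@stalk_val_linear n).

End StalkMaps.

(** An elementary form of [Ext^1(C, C) = 0]. Conditions on [eps] concern cycles of [P 0], since [P]
    may have nonzero terms in negative degrees. *)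
Lemma ext1_vanishes (R : comNzRingType) (C : lmodType R) : ext_vanishes 1 C C ->
  exists (P : complex R) (eps : {linear P 0 -> C}),
  [/\ forall n, projective (P n),
      forall x : P 1, eps (diff P 1 0 x) = 0,
      forall c, exists2 x : P 0, cycle x & eps x = c,
      forall x : P 0, cycle x -> eps x = 0 -> exists y, x = diff P 1 0 y
    & forall k : {linear P 1 -> C}, (forall x, k (diff P 2 1 x) = 0) ->
      exists l : {linear P 0 -> C}, forall x, k x = l (diff P 1 0 x)].
Proof.
move=> [P [[Pproj _ [f fq]] extP]].
exists P, (@stalk_val R C 0 \o f 0); split=> //=.
- by move=> x; rewrite (cmap_diff f).
- move=> c; have [_ /(_ (stalk_elt 0 c))[//|x cx [y xy]]] := fq 0.
  exists x => //; move: xy => /eqP; rewrite subr_eq0 => /eqP->.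
  exact: stalk_eltK.
- move=> x cx fx; have [/(_ x cx) + _] := fq 0; apply.
  by exists 0; apply: val_inj; rewrite linear0.
move=> k kd.
(* [k] as an element of degree -1 of Hom(P, C): the component from degree 1 to degree 0 is [k] and
   the others vanish. *)
pose F0 i j := @stalk_elt R C j \o (k \o id_family P i 1).
pose F : hom_family P (stalk C) := fun i j => to_hom (F0 i j).
have F_in : F \in homc_pred (-1).
  apply/asboolP => i j ij; apply: homP => x.
  have [j0|j0] := eqVneq j 0; last by apply: stalk_val0.
  change (F0 i j x = 0); rewrite /F0 /= id_family_off ?hom0E ?linear0 //.
  by apply: contraNneq ij => ->; rewrite j0.
have [|G FG] := extP (MkHomc F_in).
  apply: homc_ext => i j x; rewrite homc_diffE //.
  change (0 - (-1) ^+ 1 *: F0 (i - 1) j (diff P i (i - 1) x) = 0).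
  rewrite sub0r expr1 scaleN1r opprK /F0 /=.
  have -> : id_family P (i - 1) 1 (diff P i (i - 1) x) = diff P i 1 x.
    have [e|ne] := eqVneq (i - 1) 1; first by rewrite id_family_diff.
    by rewrite id_family_off // hom0E diff_shape // -subr_eq.
  have [e|ne] := eqVneq i 2; last by rewrite diff_shape ?linear0.
  by rewrite e in x *; rewrite kd linear0.
(* The sign comes from the differential of Hom in degree 0, which sends [G] to [- G d]. *)
exists (@stalk_val R C 0 \o (- homc_at G 0 0 : HomMod _ _)) => x.
have -> : k x = stalk_val (homc_at (MkHomc F_in) 1 0 x).
  change (k x = stalk_val (stalk_elt 0 (k (id_family P 1 1 x)))).
  by rewrite stalk_eltK // id_family_diag.
rewrite FG [homc_at _ _ _ _]homc_diffE //.
change (stalk_val (0 - 1 *: homc_at G 0 0 (diff P 1 0 x)) =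
  stalk_val (- homc_at G 0 0 (diff P 1 0 x))).
by rewrite sub0r scale1r.
Qed.

Section SemidualizingModule.
Variables (R : idomainType) (C : lmodType R).
Hypothesis noethR : noetherian R.
Hypothesis sC : semidualizing_module C.

Let fgC (N : C -> Prop) : submodule N -> fg_mod (fun=> True) N.
Proof.
move=> sN; have [[s sP] _ _] := sC; exists s; split=> // z _.
by have /spanned_span := sP z; apply: span_mod_sub => y ->; apply: submodule0.
Qed.

Let submoduleT : submodule (fun x : C => True). Proof. by []. Qed.

Lemma homothety_inj (r : R) : (forall x : C, r *: x = 0) -> r = 0.
Proof.
move=> r0; have [_ /bij_inj inj _] := sC; apply: inj; apply: homP => x.
by change (r *: x = 0 *: x); rewrite scale0r.
Qed.

Lemma endomorphism_scalar (f : {linear C -> C}) : exists r : R, forall x, f x = r *: x.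
Proof.
have [_ [g _ gK] _] := sC; exists (g (to_hom f)) => x.
by rewrite -[LHS]/(to_hom f x) -{1}[to_hom f]gK.
Qed.

(** [C] is faithful and finitely generated, so it vanishes at no prime; [Phi] encodes a nonzero map
    [C -> R / p]. *)
Lemma semidualizing_residue (p : R -> Prop) : prime_ideal p ->
  exists Phi : C -> R^o -> Prop,
  [/\ linear_relation Phi, forall z, exists a, Phi z a,
      forall a, Phi 0 a -> p a & exists z a, Phi z a /\ ~ p a].
Proof.
move=> pp; have s0 := submodule_zero C.
have [|Phi [lP tP nP [z [a [_ za na]]]]] :=
    residue_functional pp submoduleT s0 (fgC s0).
  move=> t nt; apply: contrapT => /forall2NP tC; apply: nt.
  have -> : t = 0; last by case: pp => /ideal0.
  by apply: homothety_inj => x; case: (tC x) => // /contrapT.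
exists Phi; split=> //; [by move=> y; apply: tP|by move=> b; apply: nP|].
by exists z, a.
Qed.

(* A [w] with prime annihilator [p] gives an endomorphism [C -> R / p -> C];
   it is multiplication by some [r], and [r p = 0]. *)
Lemma semidualizing_torsionfree (r : R) (x : C) : r *: x = 0 -> r = 0 \/ x = 0.
Proof.
move=> rx; have [->|/eqP x0] := eqVneq x 0; [by right|left].
have [|b [pp pS]] := associated_prime (N := fun y : C => y = 0) (u := x) noethR
    (submodule_zero C) (mult_closed_one R).
  by move=> t ->; rewrite scale1r.
set w := b *: x in pp pS; set p := annihilator _ w in pp pS.
have pr : p r by rewrite /p /annihilator /w scalerA mulrC -scalerA rx scaler0.
have [Phi [lP tP nP [z [a [za na]]]]] := semidualizing_residue pp.
have well c a1 a2 : Phi c a1 -> Phi c a2 -> a1 *: w = a2 *: w.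
  move=> c1 c2; apply/eqP; rewrite -subr_eq0 -scalerBl; apply/eqP/nP.
  have := lP (-1) _ _ _ _ c2 c1.
  by rewrite !scaleN1r addNr addrC.
have [|||f fP] := functional_relation (Q := fun c y => exists2 a1, Phi c a1 & y = a1 *: w).
- move=> c x1 x2 y1 y2 [a1 xa1 ->] [a2 xa2 ->].
  exists (c *: a1 + a2); first exact: lP.
  by rewrite scalerA -scalerDl.
- by move=> c; have [a1 ca1] := tP c; exists (a1 *: w), a1.
- by move=> c y1 y2 [a1 ca1 ->] [a2 ca2 ->]; apply: well ca2.
have [q qP] := endomorphism_scalar f.
have fa c a1 : Phi c a1 -> q *: c = a1 *: w.
  by move=> ca1; have [a2 ca2] := fP c; rewrite -qP => ->; apply: well ca1.
(* [q] maps [C] into the multiples of [w], which [r] kills; and [q] is nonzero because it takes [z]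
   to [a *: w]. *)
have /eqP : r * q = 0.
  apply: homothety_inj => c; have [a1 /fa qc] := tP c.
  by rewrite -scalerA qc scalerA mulrC -scalerA (pr : r *: w = 0) scaler0.
rewrite mulf_eq0 => /orP[/eqP//|/eqP q0].
by case: na; move: (fa _ _ za); rewrite q0 scale0r.
Qed.

(** The zero prime provides a nonzero functional [f]. If [f x = 0], the endomorphism
    [v |-> f v *: x] is a scalar [r] with [r *: x = 0]; by torsion-freeness [x = 0], or [r = 0] and
    then [f z *: x = 0] gives [x = 0] again. *)
Lemma semidualizing_embedding : exists f : {linear C -> R^o}, injective f.
Proof.
have [Phi [lP tP nP [z [a [za na]]]]] := semidualizing_residue (prime_zero R).
have well c a1 a2 : Phi c a1 -> Phi c a2 -> a1 = a2.
  move=> c1 c2; apply/eqP; rewrite -subr_eq0; apply/eqP/nP.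
  have := lP (-1) _ _ _ _ c2 c1.
  by rewrite !scaleN1r addNr addrC.
have [f fP] := functional_relation lP tP well.
have fz : f z != 0 by rewrite -(well _ _ _ za (fP z)); apply/eqP.
exists f; apply: raddf_inj => x fx.
have lin : linear (fun v : C => (f v : R) *: x).
  by move=> c u v; rewrite linearP scalerDl scalerA.
have [r rP] := endomorphism_scalar (linear_map lin).
have rx : (r : R) *: x = 0 by rewrite -rP /= fx scale0r.
have [r0|//] := semidualizing_torsionfree rx.
have := rP z; rewrite r0 scale0r /= => /semidualizing_torsionfree[f0|//].
by rewrite f0 eqxx in fz.
Qed.

Lemma semidualizing_nonzero (f : {linear C -> R^o}) : injective f -> exists c, f c != 0.
Proof.
move=> f_inj; apply: contrapT => /forallNP f0; have /eqP := oner_neq0 R; apply.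
apply: homothety_inj => c; apply: f_inj; rewrite scale1r linear0.
by apply/eqP; apply: contrapT => /negP/f0.
Qed.

(* [Ext^1(C, C) = 0] lifts the map [C -> R / p -> C / x C] given by [w] to an
   endomorphism of [C], that is to a multiplication by some [r]. *)
Lemma semidualizing_associated (x : R) (w : C) : x != 0 ->
  let p := annihilator (fun y : C => exists c, y = x *: c) w in
  prime_ideal p -> exists r : R, forall b, p b <-> exists y, b * r = x * y.
Proof.
move=> x0 p pp; have xK (c d : C) : x *: c = x *: d -> c = d.
  move=> cd; apply/eqP; rewrite -subr_eq0; apply/eqP.
  have [|e|//] := @semidualizing_torsionfree x (c - d).
    by rewrite scalerBr cd subrr.
  by rewrite e eqxx in x0.
have [_ _ /(_ 1%N (leqnn _))/ext1_vanishes[P [eps [Pproj epsd epsP eps0 Pext]]]] := sC.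
have [Phi [lP tP nP [z [a [za na]]]]] := semidualizing_residue pp.
(* [h] lifts [P 0 -> C -> R / p -> C / x C] to [C]. On boundaries its values lie in [x C], and
   division by [x] gives the cocycle [k]. *)
have [||h hP] := projective_relation (Pproj 0) (N := C)
    (Q := fun u y => exists a1 c, Phi (eps u) a1 /\ y = (a1 : R) *: w + x *: c).
- move=> k u1 u2 y1 y2 [a1 [c1 [ua1 ->]]] [a2 [c2 [ua2 ->]]].
  exists (k *: a1 + a2), (k *: c1 + c2); split; first by rewrite linearP; apply: lP.
  rewrite !scalerDr scalerDl !scalerA addrACA; congr (_ + (_ *: _ + _)).
  by rewrite mulrC.
- by move=> u; have [a1 ua1] := tP (eps u); exists (a1 *: w), a1, 0; rewrite scaler0 addr0.
have [|||k kP] := functional_relation (Q := fun (u : P 1) y => h (diff P 1 0 u) = x *: y).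
- move=> c u1 u2 y1 y2 e1 e2.
  by rewrite scalerDr !scalerA [x * c]mulrC -!scalerA -e1 -e2 !linearP.
- move=> u; have [a1 [c [ua1 ->]]] := hP (diff P 1 0 u).
  move: ua1; rewrite epsd => /nP[c' ->].
  by exists (c' + c); rewrite scalerDr.
- by move=> u y1 y2 -> /xK.
have [|l lk] := Pext k.
  by move=> u; apply: xK; rewrite -kP diff_diff linear0 scaler0.
(* Since [k = l d], the map [h - x l] vanishes on boundaries; it induces an endomorphism of [C] that
   still lifts the map to [C / x C]. *)
have [|||f fP] := functional_relation
    (Q := fun c y => exists u : P 0, [/\ cycle u, eps u = c & y = h u - x *: l u]).
- move=> c c1 c2 y1 y2 [u1 [cu1 <- ->]] [u2 [cu2 <- ->]].
  exists (c *: u1 + u2); split; first by rewrite /cycle linearP cu1 cu2 scaler0 addr0.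
    by rewrite linearP.
  by rewrite (linearP h) (linearP l) !scalerDr !scalerN opprD addrACA !scalerA [x * c]mulrC.
- by move=> c; have [u cu <-] := epsP c; exists (h u - x *: l u), u.
- move=> c y1 y2 [u1 [cu1 e1 ->]] [u2 [cu2 e2 ->]].
  have [||v uv] := eps0 (u1 - u2).
  + by rewrite /cycle linearB cu1 cu2 subrr.
  + by rewrite linearB e1 e2 subrr.
  have : h (u1 - u2) = x *: l (u1 - u2) by rewrite uv kP lk.
  rewrite (raddfB h) (raddfB l) scalerBr => e; rewrite -[h u1](subrK (h u2)) e.
  by rewrite addrAC [X in X + _]addrAC subrr sub0r addrC.
have [r rP] := endomorphism_scalar f.
have rc c : exists a1 d, Phi c a1 /\ r *: c = (a1 : R) *: w + x *: d.
  have [u [cu <- e]] := fP c; have [a1 [d [ua1 hu]]] := hP u.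
  by exists a1, (d - l u); rewrite -rP e hu scalerBr addrA.
(* If [b] is in [p], then [b r C] lies in [x C], and division by [x] is an endomorphism, hence a
   scalar [y]. Conversely [b r = x y] puts [b a1 w] in [x C], where [a1] is the value at [z] and is
   not in [p]. *)
exists r => b; split=> [pb|[y by_]].
  have [|||g gP] := functional_relation (Q := fun c y : C => (b * r) *: c = x *: y).
  - move=> c u1 u2 y1 y2 e1 e2.
    rewrite scalerDr [RHS]scalerDr -e2 [RHS]addrC [LHS]addrC; congr (_ + _).
    have -> : x *: (c *: y1) = c *: (x *: y1) by rewrite !scalerA mulrC.
    by rewrite -e1 !scalerA mulrC.
  - move=> c; have [a1 [d [_ cd]]] := rc c; have [c' bw] := pb.
    exists (a1 *: c' + b *: d); rewrite -scalerA cd.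
    have -> : b *: ((a1 : R) *: w + x *: d) = (a1 : R) *: (b *: w) + x *: (b *: d).
      by rewrite scalerDr !scalerA; congr (_ *: _ + _ *: _); rewrite mulrC.
    by rewrite bw scalerDr !scalerA [x * a1]mulrC.
  - by move=> c y1 y2 -> /xK.
  have [y yP] := endomorphism_scalar g; exists y.
  apply/eqP; rewrite -subr_eq0; apply/eqP/homothety_inj => c.
  by rewrite scalerBl gP yP scalerA subrr.
have [a1 [d [za1 zd]]] := rc z.
have [_ _ pM] := pp; suff /pM[//|pa1] : p (b * a1).
  have [sp _ _] := pp; case: na; rewrite -[a](subrK a1); apply: idealD => //.
  by apply: nP; have := lP (-1) _ _ _ _ za1 za; rewrite !scaleN1r addNr addrC.
exists (y *: z - b *: d).
have E : x *: (y *: z) = b *: (r *: z) by rewrite !scalerA by_.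
by rewrite scalerBr E zd scalerDr !scalerA [x * b]mulrC addrK.
Qed.

End SemidualizingModule.

Lemma inj_surj_bij (A B : Type) (f : A -> B) :
  injective f -> (forall y, exists x, f x = y) -> bijective f.
Proof.
move=> finj /choice[g gK]; exists g => // x; apply: finj; exact: gK.
Qed.

(* [r / x] is an eigenvalue of a matrix over [R], hence integral. *)
Lemma normal_ratio (R : idomainType) (J : R -> Prop) (r x : R) :
  noetherian R -> normal_domain R -> x != 0 -> ideal J ->
  (exists2 j, J j & j != 0) -> (forall j, J j -> exists2 j', J j' & r * j = x * j') ->
  exists a, r = x * a.
Proof.
move=> noethR normR x0 sJ [j0 Jj0 j00] rJ.
have [s sP] := noetherian_ideal noethR sJ.
have Js v : v \in s -> J v.
  by move=> vs; apply/sP; exact: (span_mod_mem (submodule_zero _) vs).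
have /choice[A AP] : forall i : 'I_(size s), exists c : 'I_(size s) -> R,
    r * s`_i = x * \sum_j c j * s`_j.
  move=> i; have [|j /sP/spanned_span[c ->] ->] := rJ s`_i; last by exists c.
  by apply: Js; apply: mem_nth.
(* Transposed, since [eigenvalue] concerns row vectors; the generators of [J] form the eigenvector,
   nonzero because [J] is. *)
pose g := \matrix_(j, i) A i j; pose gK := map_mx (@tofrac R) g.
pose z := tofrac r / tofrac x.
have xF0 : tofrac x != 0 by rewrite tofrac_eq0.
have zg : eigenvalue gK z.
  apply/eigenvalueP; exists (\row_i tofrac (s`_i : R)).
    apply/rowP => i; rewrite !mxE; apply: (mulfI xF0).
    rewrite [RHS]mulrA [z]mulrC mulVKf // -!tofracM AP tofracM rmorph_sum.
    by congr (_ * _); apply: eq_bigr => j _; rewrite !mxE -tofracM mulrC.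
  apply: contraNneq j00 => /rowP s0; have /sP/spanned_span[c ->] := Jj0.
  rewrite big1 // => i _; have /eqP := s0 i; rewrite !mxE tofrac_eq0 => /eqP->.
  exact: mulr0.
have [|a za] := normR z.
  exists (char_poly g); first exact: char_poly_monic.
  by rewrite map_char_poly -eigenvalue_root_char.
exists a; apply/eqP; rewrite -tofrac_eq tofracM -za; apply/eqP.
by rewrite mulrC divfK.
Qed.

(** * Reflexivity and rank of semidualizing modules *)

Section DivisorClass.
Variables (R : idomainType) (C : lmodType R).
Hypotheses (noethR : noetherian R) (normR : normal_domain R).
Hypothesis sC : semidualizing_module C.

Lemma semidualizing_reflexive : reflexive_module C.
Proof.
have [f f_inj] := semidualizing_embedding noethR sC.
pose F : module_dual C := to_hom f.
have fM (c d : C) : (f c : R) *: d = (f d : R) *: c.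
  by apply: f_inj; rewrite !linearZ /=; apply: mulrC.
have gM (g : module_dual C) c d : (f c : R) * g d = g c * f d.
  have := congr1 (hom_fun g) (fM c d); rewrite !linearZ => e.
  by rewrite [RHS]mulrC; exact: e.
split; first by case: sC.
apply: inj_surj_bij => [c d cd|Psi].
  by apply: f_inj; apply: (congr1 (fun H : module_dual (module_dual C) => H F) cd).
have [c0 fc0] := semidualizing_nonzero sC f_inj.
(* [Psi] is determined by [Psi F], so it is evaluation at [c] as soon as [f c = Psi F]. *)
have PsiM (g : module_dual C) c : g c * Psi F = (f c : R) * Psi g.
  have -> : g c * Psi F = Psi (g c *: F) by rewrite linearZ.
  have <- : Psi (f c *: g) = (f c : R) * Psi g by rewrite linearZ.
  by congr (hom_fun Psi _); apply: homP => d; apply/esym/gM.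
have [[c cP]|nz] := pselect (exists c, f c = Psi F).
  exists c; apply: homP => g; apply: (mulfI fc0).
  by rewrite [LHS]gM cP; apply: PsiM.
set x : R := f c0 in fc0; set z : R := Psi F in nz PsiM.
pose N (y : C) := exists c, y = x *: c.
have sN : submodule N.
  split=> [|a u v [c ->] [d ->]]; first by exists 0; rewrite scaler0.
  by exists (a *: c + d); rewrite scalerDr !scalerA mulrC.
(* If [z *: c0 = x *: c], applying [f] gives [f c = z], which is excluded; so the class of [z *: c0]
   in [C / x C] is nonzero and has a multiple with prime annihilator. *)
have [|b [pp _]] := associated_prime (u := z *: c0) noethR sN (mult_closed_one R).
  move=> t -> [c]; rewrite scale1r => /(congr1 f); rewrite !linearZ /= => e.
  apply: nz; exists c; apply/esym/(mulfI fc0).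
  by rewrite [LHS]mulrC; exact: e.
have [r rP] := semidualizing_associated noethR sC fc0 pp.
(* Values of functionals kill that class: [g c] times [z *: c0] is [Psi g * f c] times [c0], and
   [f c *: c0 = x *: c]. *)
have pg (g : module_dual C) c : annihilator N (b *: (z *: c0)) (g c).
  exists ((b * Psi g) *: c); rewrite !scalerA.
  have -> : g c * b * z = b * Psi g * f c by rewrite mulrAC PsiM; ring.
  by rewrite -scalerA fM -/x !scalerA mulrC.
(* The dual of [C] evaluated at [c0]. All values of [g] lie in [p = (x : r)], so [r g / x] is again
   a functional and [r J] is contained in [x J]. *)
pose J j := exists g : module_dual C, j = g c0.
have [|||a ra] := @normal_ratio R J r x noethR normR fc0.
- split=> [|a j k [g ->] [h ->]]; first by exists 0.
  by exists (a *: g + h).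
- by exists x => //; exists F.
- move=> j [g ->].
  have [|||h hP] := functional_relation (N := R^o) (Q := fun c y => r * g c = x * y).
  + move=> k c d y y' e e'; rewrite linearP.
    by rewrite !mulrDr [x * _]mulrCA -e -e' [k * _]mulrCA.
  + by move=> c; have /rP[y e] := pg g c; exists y; rewrite -e mulrC.
  + by move=> c y y' -> /(mulfI fc0).
  by exists (h c0); [exists (to_hom h)|apply: hP].
by have [_ p1 _] := pp; case: p1; apply/rP; exists a; rewrite mul1r.
Qed.

(** The relation [f c *: d = f d *: c] rules out two independent elements. *)
Lemma semidualizing_rank1 : has_rank C 1.
Proof.
have [f f_inj] := semidualizing_embedding noethR sC.
have fM (c d : C) : (f c : R) *: d = (f d : R) *: c.
  by apply: f_inj; rewrite !linearZ /=; apply: mulrC.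
have [c0 fc0] := semidualizing_nonzero sC f_inj.
split=> [|n [v vind]].
  exists (fun=> c0) => c; rewrite big_ord1 => e i; rewrite ord1.
  have [//|c00] := semidualizing_torsionfree noethR sC e.
  by rewrite c00 linear0 eqxx in fc0.
case: n v vind => [|[|n]] // v vind; exfalso.
pose i0 : 'I_n.+2 := ord0; pose i1 : 'I_n.+2 := lift ord0 ord0.
have sum01 (a b : R) : \sum_i (if i == i0 then a else if i == i1 then b else 0) *: v i
    = a *: v i0 + b *: v i1.
  rewrite (bigD1 i0) //= (bigD1 i1) //= big1 ?addr0 // => i /andP[/negPf-> /negPf->].
  by rewrite scale0r.
have v1 : f (v i1) = 0.
  have := vind (fun i => if i == i0 then f (v i1) else if i == i1 then - (f (v i0) : R) else 0).
  by rewrite sum01 scaleNr fM subrr => /(_ erefl i0); rewrite eqxx.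
have := vind (fun i => if i == i0 then 0 else if i == i1 then 1 else 0).
have v10 : v i1 = 0 by apply: f_inj; rewrite v1 linear0.
by rewrite sum01 v10 scaler0 scale0r addr0 => /(_ erefl i1) /eqP; rewrite /= oner_eq0.
Qed.

End DivisorClass.

(** The [x i] are only labels, whereas [finitely_many_classes] wants representatives satisfying [P]:
    keep the labels that occur and choose one element for each. *)
Lemma finitely_many_preimage (T I : Type) (n : nat) (x : 'I_n -> I) (P : T -> Prop)
    (F : T -> I -> Prop) (E : T -> T -> Prop) :
  (forall y, P y -> exists i, F y (x i)) ->
  (forall y y' i, P y -> P y' -> F y i -> F y' i -> E y y') -> finitely_many_classes P E.
Proof.
move=> PF FE; pose A := [set i | `[< exists2 y, P y & F y (x i) >]].
have /choice[y yP] : forall k : 'I_#|A|, exists y, P y /\ F y (x (enum_val k)).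
  by move=> k; have := enum_valP k; rewrite inE => /asboolP[y]; exists y.
exists #|A|, y; split=> [k|t Pt]; first by case: (yP k).
have [i ti] := PF t Pt; have iA : i \in A by rewrite inE; apply/asboolP; exists t.
exists (enum_rank_in iA i); have [Py Fy] := yP (enum_rank_in iA i).
by apply: FE Pt Py ti _; rewrite enum_rankK_in in Fy.
Qed.

Lemma isomorphic_sym (R : comNzRingType) (M N : lmodType R) :
  isomorphic M N -> isomorphic N M.
Proof.
move=> [f [g fK gK]].
by exists (linear_map (can2_linear fK gK)); exists f.
Qed.

Lemma isomorphic_trans (R : comNzRingType) (M N L : lmodType R) :
  isomorphic M N -> isomorphic N L -> isomorphic M L.
Proof. by move=> [f fb] [g gb]; exists (g \o f); apply: bij_comp. Qed.

Lemma semidualizing_classes (R : idomainType) : noetherian R -> normal_domain R ->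
  finite_divisor_class_group R -> exists (n : nat) (x : 'I_n -> lmodType R),
  forall C : lmodType R, semidualizing_module C -> exists i, isomorphic C (x i).
Proof.
move=> noethR normR [n [x [_ xP]]]; exists n, x => C sC; apply: xP.
by split; [apply: semidualizing_reflexive|apply: semidualizing_rank1].
Qed.

Lemma normal_S0_finite (R : idomainType) : noetherian R -> normal_domain R ->
  finite_divisor_class_group R -> S0_finite R.
Proof.
move=> noethR normR fCl.
have [n [x xP]] := semidualizing_classes noethR normR fCl.
apply: finitely_many_preimage xP _ => C C' D _ _ CD C'D.
exact: isomorphic_trans CD (isomorphic_sym C'D).
Qed.

(** * Maps from complexes of projectives *)

(* A complex given by one module with an endomorphism [gd] and submodules
   [gr n] of elements of degree [n]: no transport along equalities of degrees is
   ever needed.  The [gr n] need not decompose the module. *)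
Record graded (R : comNzRingType) := Graded {
  gmod :> lmodType R;
  gd : {linear gmod -> gmod};
  gr : int -> gmod -> Prop;
  gr_submodule : forall n, submodule (gr n);
  gr_d : forall n y, gr n y -> gr (n - 1) (gd y);
  gd_gd : forall y, gd (gd y) = 0 }.

Arguments gd {R g}.
Arguments gr {R g} n y.
Arguments gr_submodule {R} g n.

Section Homology.
Variables (R : comNzRingType) (Y : graded R).

Lemma gr0 n : gr n (0 : Y). Proof. exact: submodule0 (gr_submodule Y n). Qed.
Lemma grD n (y z : Y) : gr n y -> gr n z -> gr n (y + z).
Proof. exact: submoduleD (gr_submodule Y n) _ _. Qed.
Lemma grZ n a (y : Y) : gr n y -> gr n (a *: y).
Proof. exact: submoduleZ (gr_submodule Y n) _ _. Qed.
Lemma grN n (y : Y) : gr n y -> gr n (- y).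
Proof. exact: submoduleN (gr_submodule Y n) _. Qed.
Lemma grB n (y z : Y) : gr n y -> gr n z -> gr n (y - z).
Proof. exact: submoduleB (gr_submodule Y n) _ _. Qed.

Definition gcycle n (y : Y) : Prop := gr n y /\ gd y = 0.
Definition gboundary n (y : Y) : Prop := exists2 z : Y, gr (n + 1) z & y = gd z.
Definition kills (b : R) n : Prop := forall y : Y, gcycle n y -> gboundary n (b *: y).

Lemma gcycle_submodule n : submodule (gcycle n).
Proof.
have sn := gr_submodule Y n; split=> [|a x y [nx dx] [ny dy]].
  by split; [exact: submodule0|exact: linear0].
split; first by apply: submoduleD => //; apply: submoduleZ.
by rewrite linearP dx dy scaler0 addr0.
Qed.

Lemma gboundary_submodule n : submodule (gboundary n).
Proof.
have sn := gr_submodule Y (n + 1); split=> [|a x y [z nz ->] [t nt ->]].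
  by exists 0; [exact: submodule0|rewrite linear0].
exists (a *: z + t); last by rewrite linearP.
by apply: submoduleD => //; apply: submoduleZ.
Qed.

Lemma gboundary_cycle n y : gboundary n y -> gcycle n y.
Proof.
move=> [z nz ->]; split; last exact: gd_gd.
by rewrite -[n](addrK 1); apply: gr_d.
Qed.

End Homology.
Arguments kills {R} Y b n.

Lemma dep_update (T : int -> Type) (h : forall i, T i) (a : int) (k : T a) :
  exists2 h' : forall i, T i, h' a = k & forall i, i != a -> h' i = h i.
Proof.
exists (fun i => if a =P i is ReflectT e then eq_rect a T k i e else h i) => [|i].
  by case: eqP => // e; rewrite (eq_irrelevance e erefl).
by case: eqP => // e /eqP[]; rewrite e.
Qed.

Section Cochains.
Variables (R : comNzRingType) (P : complex R) (Y : graded R).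
Local Notation family := (forall i, {linear P i -> Y}).
Local Notation dP i := (diff P i (i - 1)).

Definition sg (n : int) : R := (-1) ^+ `|n|%N.

Lemma sgB1 n : sg (n - 1) = - sg n.
Proof.
rewrite /sg -[in LHS]signr_odd -[in RHS]signr_odd.
have -> : odd `|n - 1|%N = ~~ odd `|n|%N by lia.
by rewrite signrN.
Qed.

Definition degree n (f : family) : Prop := forall i x, gr (i + n) (f i x).

(** The differential [d f - (-1)^n f d] of Hom(P, Y). Thus [dhom m h = g] says that [h] is a
    null-homotopy of [g]. *)
Definition dhom n (f : family) i (x : P i) : Y :=
  gd (f i x) - sg n *: f (i - 1) (dP i x).

Arguments dhom : clear implicits.

Definition cocycle n (f : family) : Prop := forall i x, dhom n f i x = 0.

Definition scale_family (b : R) (f : family) : family := fun i => b \*: f i.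

Lemma scale_familyE b f i x : scale_family b f i x = b *: f i x. Proof. by []. Qed.

Lemma dhom_scale b n f i x : dhom n (scale_family b f) i x = b *: dhom n f i x.
Proof.
by rewrite /dhom !scale_familyE linearZ scalerBr !scalerA [b * _]mulrC.
Qed.

Lemma degree_scale b n f : degree n f -> degree n (scale_family b f).
Proof.
by move=> nf i x; rewrite scale_familyE; apply: submoduleZ (nf i x); apply: gr_submodule.
Qed.

Lemma cocycle_scale b n f : cocycle n f -> cocycle n (scale_family b f).
Proof. by move=> cf i x; rewrite dhom_scale cf scaler0. Qed.

(** Where [h] already solves the equation below degree [a], the element [g + (-1)^m h d] in degree
    [a] is a cycle; [b] times it is a boundary, and projectivity chooses the new component linearly.
    The old components are multiplied by [b]. *)
Lemma lift_step (m : int) (g h : family) (b : R) (a : int) : projective (P a) ->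
  degree (m - 1) g -> cocycle (m - 1) g -> degree m h ->
  (forall i, i < a -> forall x, dhom m h i x = g i x) -> kills Y b (a + (m - 1)) ->
  exists h' : family, [/\ degree m h',
    forall i, i <= a -> forall x, dhom m h' i x = b *: g i x
    & forall i, i < a -> forall x, h' i x = b *: h i x].
Proof.
move=> Pa gdeg gco hdeg hg kb.
have cyc x : gcycle (a + (m - 1)) (g a x + sg m *: h (a - 1) (dP a x)).
  split.
    apply: submoduleD (gdeg _ _) _; first exact: gr_submodule.
    apply: submoduleZ; first exact: gr_submodule.
    by have -> : a + (m - 1) = a - 1 + m by ring.
  have /eqP := gco a x; rewrite subr_eq0 => /eqP ga.
  rewrite linearD linearZ /= ga sgB1.
  have /eqP := hg (a - 1) ltac:(lia) (dP a x).
  rewrite /dhom diff_diff linear0 scaler0 subr0 => /eqP->.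
  by rewrite scaleNr addNr.
have [||k kP] := projective_relation (N := Y) (Q := fun x y => gr (a + m) y /\
    gd y = b *: (g a x + sg m *: h (a - 1) (dP a x))) Pa.
- move=> c x x' y y' [ay dy] [ay' dy']; split.
    have sa := gr_submodule Y (a + m).
    by apply: submoduleD => //; apply: submoduleZ.
  rewrite linearP dy dy' !linearP /=.
  rewrite [c *: (b *: _)]scalerA [c * b]mulrC -scalerA -scalerDr.
  by rewrite addrACA -scalerDr.
- move=> x; have [y ya ->] := kb _ (cyc x); exists y; split=> //.
  by move: ya; congr (gr _ y); ring.
have [h' h'a h'i] := @dep_update (fun i => {linear P i -> Y}) (scale_family b h) a k.
exists h'; split=> [i x|i ia x|i ia x].
- have [e|ne] := eqVneq i a; last by rewrite h'i //; apply: degree_scale.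
  by subst i; rewrite h'a; case: (kP x).
- have [e|ne] := eqVneq i a.
    subst i; rewrite /dhom h'a h'i; last by lia.
    have [_ ->] := kP x; rewrite scale_familyE scalerDr !scalerA [b * _]mulrC.
    by rewrite addrK.
  rewrite /dhom !h'i //; last by lia.
  by rewrite -hg ?dhom_scale -?dhom_scale //; lia.
by rewrite h'i //; lia.
Qed.

Lemma lift_finite (S : R -> Prop) (m : int) (g h : family) (a : int) (k : nat) :
  mult_closed S -> (forall i, projective (P i)) ->
  degree (m - 1) g -> cocycle (m - 1) g -> degree m h ->
  (forall i, i < a -> forall x, dhom m h i x = g i x) ->
  (forall i, a <= i < a + k%:Z -> exists2 b, S b & kills Y b (i + (m - 1))) ->
  exists b (h' : family), [/\ S b, degree m h',
    forall i, i < a + k%:Z -> forall x, dhom m h' i x = b *: g i x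
    & forall i, i < a -> forall x, h' i x = b *: h i x].
Proof.
move=> [S1 SM] Pproj gdeg gco hdeg hg; elim: k => [|k IHk] Sk.
  exists 1, h; split=> // i ia x; rewrite scale1r //; apply: hg; lia.
have [i ia|b [h1 [Sb h1deg h1g h1h]]] := IHk; first by apply: Sk; lia.
have [c Sc kc] := Sk (a + k%:Z) ltac:(lia).
have [h2 [h2deg h2g h2h]] := lift_step (Pproj _) (degree_scale b gdeg)
  (cocycle_scale b gco) h1deg h1g kc.
exists (c * b), h2; split=> // [|i ia x|i ia x]; first exact: SM.
  by rewrite h2g ?scale_familyE ?scalerA //; lia.
by rewrite h2h ?h1h ?scalerA //; lia.
Qed.

(** With denominator 1 the components already chosen never change, so the successive extensions
    stabilize in each degree. *)
Lemma lift_exact (m : int) (g h : family) (a : int) : (forall i, projective (P i)) ->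
  degree (m - 1) g -> cocycle (m - 1) g -> degree m h ->
  (forall i, i < a -> forall x, dhom m h i x = g i x) ->
  (forall i, a <= i -> kills Y 1 (i + (m - 1))) ->
  exists h' : family, [/\ degree m h', forall i x, dhom m h' i x = g i x
    & forall i, i < a -> forall x, h' i x = h i x].
Proof.
move=> Pproj gdeg gco hdeg hg kY.
pose ok (k : nat) (f : family) := degree m f /\
  forall i, i < a + k%:Z -> forall x, dhom m f i x = g i x.
have /choice[next nextP] : forall kf : nat * family, exists f' : family, ok kf.1 kf.2 ->
    ok kf.1.+1 f' /\ forall i, i < a + kf.1%:Z -> forall x, f' i x = kf.2 i x.
  move=> [k f] /=; have [[fdeg fg]|] := pselect (ok k f); last by exists f.
  have [|f' [f'deg f'g f'f]] := lift_step (Pproj _) gdeg gco fdeg fg (b := 1).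
    by apply: kY; lia.
  exists f' => _; split=> [|i ia x]; last by rewrite f'f ?scale1r.
  by split=> // i ia x; rewrite f'g ?scale1r //; lia.
pose F := fix F k := if k is k'.+1 then next (k', F k') else h.
have okF k : ok k (F k).
  elim: k => [|k /(nextP (k, F k))[]//]; split=> // i ia x; apply: hg; lia.
have FS k i x : i < a + k%:Z -> F k.+1 i x = F k i x.
  by move=> ik; have [_ ->] := nextP (k, F k) (okF k).
have Fle k l i x : i < a + k%:Z -> (k <= l)%N -> F l i x = F k i x.
  move=> ik /subnKC<-; elim: (l - k)%N => [|j IHj]; rewrite ?addn0 // addnS FS //; lia.
(* The first stage at which the component of degree [i] is final. *)
pose K (i : int) : nat := if i < a then 0%N else `|i - a|%N.+1.
have KP i : i < a + (K i)%:Z by rewrite /K; case: ifP; lia.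
exists (fun i => F (K i) i); split=> [i x|i x|i ia x]; last 1 first.
- by rewrite /K ia.
- by have [+ _] := okF (K i); apply.
have [_ /(_ i (KP i) x) <-] := okF (K i); rewrite /dhom; congr (_ - _ *: _).
apply/esym/Fle; first exact: KP.
by rewrite /K; do 2 case: ifP; lia.
Qed.

(** Denominators are spent only in the finitely many degrees between [a] and [A]; beyond them
    [lift_exact] takes over, so one factor [b] suffices. *)
Lemma lift (S : R -> Prop) (m : int) (g h : family) (a A : int) :
  mult_closed S -> (forall i, projective (P i)) ->
  degree (m - 1) g -> cocycle (m - 1) g -> degree m h ->
  (forall i, i < a -> forall x, dhom m h i x = g i x) ->
  (forall i, a <= i -> exists2 b, S b & kills Y b (i + (m - 1))) ->
  (forall i, A <= i -> kills Y 1 (i + (m - 1))) ->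
  exists b (h' : family), [/\ S b, degree m h', forall i x, dhom m h' i x = b *: g i x
    & forall i, i < a -> forall x, h' i x = b *: h i x].
Proof.
move=> mS Pproj gdeg gco hdeg hg Sa SA.
have [|b [h1 [Sb h1deg h1g h1h]]] :=
    @lift_finite S m g h a `|A - a|%N mS Pproj gdeg gco hdeg hg.
  by move=> i ia; apply: Sa; lia.
have [|h2 [h2deg h2g h2h]] := lift_exact Pproj (degree_scale b gdeg)
    (cocycle_scale b gco) h1deg h1g.
  by move=> i ia; apply: SA; lia.
exists b, h2; split=> // i ia x; rewrite h2h ?h1h //; lia.
Qed.

(** A cocycle of degree [n] is a null-homotopy of the zero family of degree [n - 1], so [lift] also
    extends maps. The initial data are 0 below degree [a - 1], [k] in degree [a - 1], and in degree
    [a] a preimage [l] of [k d] up to sign. *)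
Lemma extend (S : R -> Prop) (a s A : int) (k : {linear P (a - 1) -> Y}) :
  mult_closed S -> (forall i, projective (P i)) ->
  (forall x, gcycle s (k x)) -> (forall x, gboundary s (k (dP a x))) ->
  (forall i, s < i -> exists2 b, S b & kills Y b i) ->
  (forall i, A <= i -> kills Y 1 i) ->
  exists b (f : family), [/\ S b, degree (s - (a - 1)) f, cocycle (s - (a - 1)) f
    & forall x, f (a - 1) x = b *: k x].
Proof.
move=> mS Pproj kcyc kbd Ss SA; set n := s - (a - 1).
have [||l lP] := projective_relation (N := Y) (Q := fun x y => gr (s + 1) y /\
    gd y = sg n *: k (dP a x)) (Pproj a).
- move=> c x x' y y' [ay dy] [ay' dy']; split.
    have ss := gr_submodule Y (s + 1).
    by apply: submoduleD => //; apply: submoduleZ.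
  by rewrite linearP dy dy' !linearP.
- move=> x; have := submoduleZ (gboundary_submodule Y s) (sg n) (kbd x).
  by move=> [y sy e]; exists y.
pose z : family := fun i => \0.
have [h1 h1a h1i] := @dep_update (fun i => {linear P i -> Y}) z (a - 1) k.
have [h2 h2a h2i] := @dep_update (fun i => {linear P i -> Y}) h1 a l.
have h2k : h2 (a - 1) = k by rewrite h2i // -subr_eq0 addrAC subrr.
have h20 i x : i < a - 1 -> h2 i x = 0 by move=> ia; rewrite h2i ?h1i //; lia.
have zdeg j : degree j z by move=> i x; apply: submodule0; apply: gr_submodule.
have [|||||b [f [Sb fdeg fco fk]]] := @lift S n z h2 (a + 1) (A - (n - 1)) mS Pproj (zdeg _).
- by move=> i x; rewrite /dhom /z /= linear0 scaler0 subr0.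
- move=> i x; have [e|ne] := eqVneq i a.
    subst i; rewrite h2a; have [] := lP x.
    by have -> : s + 1 = a + n by rewrite /n; ring.
  have [e|ne'] := eqVneq i (a - 1).
    subst i; rewrite h2k; have [] := kcyc x.
    by have {1}-> : s = a - 1 + n by rewrite /n; ring.
  by rewrite h2i // h1i //; apply: zdeg.
- move=> i ia x; rewrite /z /dhom.
  have [e|ne] := eqVneq i a.
    by subst i; rewrite h2a h2k; have [_ ->] := lP x; rewrite subrr.
  have [e|ne'] := eqVneq i (a - 1).
    by subst i; rewrite h2k h20; [have [_ ->] := kcyc x; rewrite scaler0 subrr|lia].
  have ia1 : i < a - 1 by lia.
  have ia2 : i - 1 < a - 1 by lia.
  by rewrite (h20 _ _ ia1) (h20 _ _ ia2) linear0 scaler0 subrr.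
- move=> i ia; apply: Ss; rewrite /n; lia.
- move=> i ia; apply: SA; lia.
exists b, f; split=> // [i x|x]; first by rewrite fco scaler0.
by rewrite fk ?h2k //; lia.
Qed.

End Cochains.

Arguments dhom {R P Y} n f i x.

Section Total.
Variables (R : comNzRingType) (X : complex R).
Local Notation T := (dfam X).

Definition total_d (y : T) : T := fun j => diff X (j + 1) j (y (j + 1)).

Fact total_d_linear : linear total_d.
Proof.
move=> a y z; apply: functional_extensionality_dep => j.
exact: (linearP (diff X (j + 1) j)).
Qed.

Definition total_gr (n : int) (y : T) : Prop := forall k, k != n -> y k = 0.

Fact total_gr_submodule n : submodule (total_gr n).
Proof.
split=> // a y z yn zn k kn; change (a *: y k + z k = 0).
by rewrite yn // zn // scaler0 addr0.
Qed.

Fact total_gr_d n y : total_gr n y -> total_gr (n - 1) (total_d y).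
Proof. by move=> yn k kn; rewrite /total_d yn ?linear0 //; lia. Qed.

Fact total_d_d y : total_d (total_d y) = 0.
Proof. by apply: functional_extensionality_dep => j; apply: diff_diff. Qed.

(** The product of all degrees. Homology only sees elements supported in one degree, so it serves as
    well as the direct sum. *)
Definition total : graded R :=
  @Graded R T (linear_map total_d_linear) total_gr total_gr_submodule total_gr_d total_d_d.

Definition inj_fun i (x : X i) : T := fun k => id_family X i k x.
Fact inj_linear i : linear (@inj_fun i).
Proof.
move=> a x y; apply: functional_extensionality_dep => k.
exact: (linearP (id_family X i k)).
Qed.
Definition inj i : {linear X i -> total} := linear_map (@inj_linear i).

Lemma inj_gr i x : gr i (inj i x).
Proof. by move=> k ki; rewrite /= /inj_fun id_family_off // eq_sym. Qed.

Lemma inj_diag i x : (inj i x : T) i = x. Proof. exact: id_family_diag. Qed.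

Lemma total_eq n (y z : total) : gr n y -> gr n z -> (y : T) n = (z : T) n -> y = z.
Proof.
move=> yn zn yz; apply: functional_extensionality_dep => k.
by have [->//|kn] := eqVneq k n; rewrite yn // zn.
Qed.

Lemma gr_inj n (y : total) : gr n y -> y = inj n ((y : T) n).
Proof. by move=> yn; apply: total_eq yn (inj_gr _) _; rewrite inj_diag. Qed.

Lemma inj_diff i j x : j + 1 = i -> gd (inj i x) = inj j (diff X i j x).
Proof.
move=> ji; subst i; apply: (@total_eq j); last first.
- change (diff X (j + 1) j ((inj (j + 1) x : T) (j + 1)) =
    (inj j (diff X (j + 1) j x) : T) j).
  by rewrite !inj_diag.
- exact: inj_gr.
by have := gr_d (inj_gr x); rewrite addrK.
Qed.

Lemma inj0 i : injective (inj i).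
Proof. by move=> x y xy; rewrite -[x]inj_diag xy inj_diag. Qed.

Lemma gcycle_inj n (x : X n) : gcycle n (inj n x) <-> cycle x.
Proof.
have e : gd (inj n x) = inj (n - 1) (diff X n (n - 1) x) by apply: inj_diff; rewrite subrK.
split=> [[_]|cx]; first by rewrite e -[RHS](linear0 (inj (n - 1))) => /inj0.
by split; [exact: inj_gr|rewrite e cx linear0].
Qed.

Lemma gboundary_inj n (x : X n) : gboundary n (inj n x) <-> boundary x.
Proof.
split=> [[z zn xz]|[y ->]]; last first.
  by exists (inj (n + 1) y); [exact: inj_gr|rewrite (@inj_diff _ n)].
exists ((z : T) (n + 1)); apply: inj0.
by rewrite xz (gr_inj zn) (@inj_diff _ n) // inj_diag.
Qed.

Lemma gcycleP n y : gcycle (Y := total) n y ->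
  exists2 x : X n, cycle x & y = inj n x.
Proof.
move=> cy; have yx := gr_inj (proj1 cy); exists ((y : T) n) => //.
by apply/gcycle_inj; rewrite -yx.
Qed.

Lemma inj_cocycle : cocycle 0 inj.
Proof.
move=> i x; rewrite /dhom (@inj_diff _ (i - 1)) ?subrK // /sg expr0 scale1r.
exact: subrr.
Qed.

Lemma inj_degree : degree (P := X) (Y := total) 0 inj.
Proof. by move=> i x; rewrite addr0; apply: inj_gr. Qed.

End Total.

(** * Maps that stay nonzero at a prime *)

Section NonzeroMaps.
Variables (R : comNzRingType) (P : complex R).
Hypothesis Pproj : forall i, projective (P i).
Variable N : int.
Hypothesis PN : forall n, n < N -> forall x : P n, x = 0.

(* [P] is exact below degree [a - 1] up to denominators in [S], so the cycles of
   degree [a - 1] are a direct summand up to denominators. *)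
Lemma retraction (S : R -> Prop) (a : int) : mult_closed S ->
  (forall i, i < a - 1 -> exists2 b, S b & kills (total P) b i) ->
  exists b (rho : {linear P (a - 1) -> total P}), [/\ S b,
    forall x, gcycle (a - 1) (rho x) & forall x, cycle x -> rho x = b *: inj P (a - 1) x].
Proof.
move=> mS SP; pose z : forall i, {linear P i -> total P} := fun i => \0.
have [M [MN Ma]] : exists M, M <= N /\ M <= a - 1.
  by have [le|lt] := leP N (a - 1); [exists N|exists (a - 1)]; lia.
have e : a - 1 = M + `|(a - 1)%R - M|%N%:Z by lia.
have [||i iM|b [h [Sb hdeg hinj _]]] := @lift_finite _ P (total P) S 1 (inj P) z M
   `|(a - 1)%R - M|%N mS Pproj (@inj_degree _ P) (@inj_cocycle _ P).
- by move=> i x; apply: submodule0; apply: gr_submodule.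
- move=> i iM x; have zE j (y : P j) : z j y = 0 by [].
  by rewrite (PN (lt_le_trans iM MN) x) linear0 /dhom !zE linear0 scaler0 subrr.
- by rewrite addr0; apply: SP; lia.
(* This is [b - h d], with [h] contracting [b] below degree [a - 1]. Its values are cycles because
   [d h d = b d], and on cycles it is multiplication by [b]. *)
pose rho0 x : total P := b *: inj P (a - 1) x +
  sg R 1 *: h (a - 1 - 1) (diff P (a - 1) (a - 1 - 1) x).
have rho_lin : linear rho0.
  move=> c x y; rewrite /rho0 (linearP (inj P _)) (linearP (diff P _ _)) (linearP (h _)).
  rewrite !scalerDr !scalerA addrACA.
  by rewrite ![c * _]mulrC.
exists b, (linear_map rho_lin); split=> //= x; last first.
  by move=> cx; rewrite /rho0 (cx : diff P _ _ x = 0) linear0 scaler0 addr0.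
have sa := gr_submodule (total P) (a - 1); split.
  apply: (submoduleD sa); apply: (submoduleZ sa); first exact: inj_gr.
  by have := hdeg (a - 1 - 1) (diff P (a - 1) (a - 1 - 1) x); rewrite subrK.
rewrite /rho0 linearD !linearZ (@inj_diff _ _ _ (a - 1 - 1)) ?subrK //.
have := hinj (a - 1 - 1) ltac:(lia) (diff P (a - 1) (a - 1 - 1) x).
rewrite /dhom diff_diff linear0 scaler0 subr0 => ->.
by rewrite /sg /= expr1 scaleN1r subrr.
Qed.

(** The localization of [H_n(Y)] at [p] is nonzero. *)
Definition alive (Y : graded R) (p : R -> Prop) (n : int) : Prop :=
  exists2 y : Y, gcycle n y & forall t, ~ p t -> ~ gboundary n (t *: y).

Definition homology_fg (Y : graded R) (n : int) : Prop :=
  fg_mod (gcycle (Y := Y) n) (gboundary n).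

Lemma not_alive_kills (Y : graded R) (p : R -> Prop) n : prime_ideal p ->
  homology_fg Y n -> ~ alive Y p n -> exists2 b, ~ p b & kills Y b n.
Proof.
move=> pp fgY na; have sb := gboundary_submodule Y n.
apply: (common_denominator (outside_mult pp) sb _ fgY) => // y cy.
apply: contrapT => /forall2NP ny; apply: na; exists y => // t nt yt.
by case: (ny t).
Qed.

(* [P -> H(P) -> R / p -> H(Y)], where the last map sends [1] to the class of
   [w], lifts to a map of complexes because [Y] is exact above the degree of [w]. *)
Lemma nonzero_hom (Y : graded R) (p : R -> Prop) (a s A : int) (w : Y) :
  prime_ideal p -> homology_fg (total P) (a - 1) -> alive (total P) p (a - 1) ->
  (forall i, i < a - 1 -> exists2 b, ~ p b & kills (total P) b i) ->
  (forall i, s < i -> exists2 b, ~ p b & kills Y b i) ->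
  (forall i, A <= i -> kills Y 1 i) ->
  gcycle s w -> (forall r, gboundary s (r *: w) <-> p r) ->
  exists f, [/\ degree (P := P) (Y := Y) (s - (a - 1)) f, cocycle (s - (a - 1)) f &
    forall t h, ~ p t -> degree (P := P) (Y := Y) (s - (a - 1) + 1) h ->
      ~ forall i x, dhom (P := P) (Y := Y) (s - (a - 1) + 1) h i x = t *: f i x].
Proof.
move=> pp fgP [v cv vp] Plow Yhigh YA cw pw; have mp := outside_mult pp.
have [sp p1 pM] := pp.
have [b [rho [nb rhoc rhob]]] := retraction mp Plow.
have sc := gcycle_submodule (total P) (a - 1).
have sb := gboundary_submodule (total P) (a - 1).
have [|Phi [lP tP nP [z [c [cz zc nc]]]]] := residue_functional pp sc sb fgP.
  by move=> t nt; exists v => //; apply: vp.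
have [||k kP] := projective_relation (N := Y)
    (Q := fun x y => exists2 c : R, Phi (rho x) c & y = c *: w) (@Pproj (a - 1)).
- move=> d x x' y y' [c1 xc1 ->] [c2 xc2 ->]; exists (d * c1 + c2).
    by rewrite linearP; apply: lP.
  by rewrite scalerDl scalerA.
- by move=> x; have [d xd] := tP _ (rhoc x); exists (d *: w), d.
have [||b' [f [nb' fdeg fco fk]]] := extend mp Pproj _ _ Yhigh YA (k := k).
- move=> x; have [d _ ->] := kP x; apply: submoduleZ cw; exact: gcycle_submodule.
- move=> x; have [d xd ->] := kP (diff P a (a - 1) x); apply/pw.
  apply: nP xd; rewrite rhob; last by rewrite /cycle diff_diff.
  apply: (submoduleZ sb); exists (inj P a x); first by rewrite subrK; apply: inj_gr.
  by rewrite (@inj_diff _ _ _ (a - 1)) ?subrK.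
exists f; split=> // t h nt hdeg hf.
have [u cu zu] := gcycleP cz.
have [d ud kd] := kP u.
(* On the cycle [u] the map [rho] is multiplication by [b], so [d] is congruent to [b c] modulo
   [p]. *)
have nd : ~ p d.
  move=> pd; have : p (b * c); last by move=> /pM[].
  rewrite -[b * c](subrK d); apply: idealD => //; apply: (nP 0).
    exact: submodule0.
  have := lP (-1) _ _ _ _ ud (lP (b - 1) _ _ _ _ zc zc).
  rewrite rhob // -zu scaleN1r scalerBl scale1r subrK addNr scaleN1r.
  by rewrite {1}/GRing.scale /= mulrBl mul1r subrK addrC.
(* At the cycle [u] a null-homotopy of [t f] makes [t b' d w] a boundary, and the class of [w] has
   annihilator [p]. *)
have : p (t * (b' * d)); last by move=> /pM[|/pM[]].
apply/pw; have := hf (a - 1) u; rewrite /dhom (cu : diff P _ _ u = 0) linear0.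
rewrite scaler0 subr0 fk kd !scalerA mulrA => <-.
exists (h (a - 1) u) => //.
by have := hdeg (a - 1) u; have -> : a - 1 + (s - (a - 1) + 1) = s + 1 by ring.
Qed.

End NonzeroMaps.

(** * Koszul cones and concentration of semidualizing complexes *)

Section Cone.
Variables (R : comNzRingType) (x : R) (Y : graded R).

(** The cone of multiplication by [x] on [Y], that is, the Koszul complex on one element with
    coefficients in [Y]. *)
Definition cone_d (u : Y * Y) : Y * Y := (gd u.1 + x *: u.2, - gd u.2).

Fact cone_d_linear : linear cone_d.
Proof.
move=> a u v; congr pair => /=.
  by rewrite (linearP gd) !scalerDr !scalerA [x * a]mulrC addrACA.
by rewrite (linearP gd) opprD scalerN.
Qed.

Definition cone_gr (n : int) (u : Y * Y) : Prop := gr n u.1 /\ gr (n - 1) u.2.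

Fact cone_gr_submodule n : submodule (cone_gr n).
Proof.
have s1 := gr_submodule Y n; have s2 := gr_submodule Y (n - 1).
split=> [|a u v [u1 u2] [v1 v2]]; first by split; apply: submodule0.
by split; apply: submoduleD => //; apply: submoduleZ.
Qed.

Fact cone_gr_d n u : cone_gr n u -> cone_gr (n - 1) (cone_d u).
Proof.
move=> [u1 u2]; split; first by apply: grD; [apply: gr_d|apply: grZ].
by apply/grN/gr_d.
Qed.

Fact cone_d_d u : cone_d (cone_d u) = 0.
Proof.
rewrite /cone_d /= (linearD gd) (linearZ_LR gd) (linearN gd) !gd_gd add0r scalerN.
by rewrite subrr !oppr0.
Qed.

Definition cone : graded R := @Graded R (Y * Y)%type (linear_map cone_d_linear)
  cone_gr cone_gr_submodule cone_gr_d cone_d_d.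

Lemma cone_cycle n (u : cone) : gcycle n u <->
  [/\ gr n u.1, gr (n - 1) u.2, gd u.2 = 0 & gd u.1 + x *: u.2 = 0].
Proof.
split=> [[[u1 u2]] /(congr1 (fun v : Y * Y => (v.1, v.2))) [e1 e2]|[u1 u2 e2 e1]].
  by split=> //; apply/eqP; rewrite -oppr_eq0; apply/eqP.
by split=> //; change (cone_d u = 0); rewrite /cone_d e1 e2 oppr0.
Qed.

Lemma cone_boundary n (u : cone) : gboundary n u <-> exists y z : Y,
  [/\ gr (n + 1) y, gr n z, u.1 = gd y + x *: z & u.2 = - gd z].
Proof.
split=> [[[y z] [/= yn zn] ->]|[y [z [yn zn e1 e2]]]].
  by exists y, z; split=> //; rewrite addrK in zn.
exists ((y, z) : Y * Y); first by split=> //=; rewrite addrK.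
by rewrite [u]surjective_pairing e1 e2.
Qed.

Lemma cone_inl_boundary n (y : Y) : gboundary n y -> gboundary (Y := cone) n (y, 0).
Proof.
move=> [z zn ->]; apply/cone_boundary; exists z, 0; split=> //=.
- exact: gr0.
- by rewrite scaler0 addr0.
by rewrite linear0 oppr0.
Qed.

(** From the exact sequence [H_n(Y) -> H_n(cone) -> H_(n-1)(Y)]. *)
Lemma cone_kills n b c : kills Y b (n - 1) -> kills Y c n -> kills cone (c * b) n.
Proof.
move=> kb kc u /cone_cycle[u1 u2 e2 e1].
have [t tn bt] := kb _ (conj u2 e2); rewrite subrK in tn.
have [|s sn cs] := kc (b *: u.1 + x *: t).
  split; first by apply: grD; apply: grZ.
  by rewrite linearD !linearZ /= -bt !scalerA [x * b]mulrC -!scalerA -scalerDr e1 scaler0.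
apply/cone_boundary; exists s, (- (c *: t)); split=> //=.
- by apply: grN; apply: grZ.
- by rewrite -cs scalerDr scalerN !scalerA [c * x]mulrC addrK.
by rewrite linearN opprK linearZ /= -bt scalerA.
Qed.

(** For a cycle [u], the boundary of [(0, u.1)] is [x *: u]. *)
Lemma cone_kills_self n : kills cone x n.
Proof.
move=> u /cone_cycle[u1 u2 e2 e1]; apply/cone_boundary; exists 0, u.1; split=> //=.
- exact: gr0.
- by rewrite linear0 add0r.
by apply/eqP; rewrite -subr_eq0 opprK addrC e1.
Qed.

(** By the same sequence [H_n(cone)] is generated by the image of [H_n(Y)] and by lifts [(- t, v)]
    of generators [v] of the kernel [Z'] of [x] on [H_(n-1)(Y)], where [x v = d t]; [Z'] is finitely
    generated by noetherianity. *)
Lemma cone_fg n : noetherian R -> homology_fg Y n -> homology_fg Y (n - 1) ->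
  homology_fg cone n.
Proof.
move=> noethR [s [sc sP]] fg1.
have sbc := gboundary_submodule cone n; have scc := gcycle_submodule cone n.
have sb := gboundary_submodule Y (n - 1); have sc1 := gcycle_submodule Y (n - 1).
have sc0 := gcycle_submodule Y n.
pose Z' (z : Y) := gcycle (n - 1) z /\ gboundary (n - 1) (x *: z).
have sZ' : submodule Z'.
  split=> [|a y z [cy by_] [cz bz]]; first by split; rewrite ?scaler0; apply: submodule0.
  split; first by apply: (submoduleD sc1) => //; apply: submoduleZ.
  by rewrite scalerDr scalerA mulrC -scalerA; apply: (submoduleD sb) => //; apply: submoduleZ.
have [|s' [s'Z s'P]] := fg_mod_sub noethR sZ' sb _ fg1; first by move=> z [].
have [s2 s2c s2P] : exists2 s2 : seq cone, (forall v, v \in s2 -> gcycle n v) &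
    forall z, span_mod (gboundary (n - 1)) s' z ->
    exists y : Y, span_mod (gboundary (Y := cone) n) s2 (y, z).
  elim: s' s'Z {s'P} => [|v s' IHs] s'Z.
    exists [::] => // z /= [t tn ->]; rewrite subrK in tn.
    exists (x *: (- t)); apply/cone_boundary; exists 0, (- t); split=> //=.
    - exact: gr0.
    - exact: grN.
    - by rewrite linear0 add0r.
    by rewrite linearN opprK.
  have [|s2 s2c s2P] := IHs; first by move=> z zs; apply: s'Z; rewrite inE zs orbT.
  have [[vn dv] [t tn xv]] : Z' v by apply: s'Z; rewrite inE eqxx.
  rewrite subrK in tn.
  exists ((- t, v) :: s2 : seq cone) => [w|z /= [a /s2P[y yz]]].
    rewrite inE => /predU1P[->|/s2c//]; apply/cone_cycle; split=> //=.
      exact: grN.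
    by rewrite linearN xv addNr.
  exists (y - a *: t), a; move: yz; congr (span_mod _ _ _).
  by congr pair; rewrite /= scalerN opprK subrK.
pose s1 : seq cone := map (fun y => (y, 0)) s.
have s1P y : span_mod (gboundary n) s y -> span_mod (gboundary (Y := cone) n) s1 (y, 0).
  rewrite /s1; elim: (s) y => [|v r IHr] y /=; first exact: cone_inl_boundary.
  move=> [a /IHr ya]; exists a; move: ya; congr (span_mod _ _ _).
  by congr pair; rewrite /= scaler0 subr0.
exists (s2 ++ s1); split=> [u|u cu].
  rewrite mem_cat => /orP[/s2c//|/mapP[y /sc[yn dy] ->]]; apply/cone_cycle; split=> //=.
  - exact: gr0.
  - exact: linear0.
  by rewrite dy scaler0 addr0.
have /cone_cycle[u1 u2 e2 e1] := cu.
have [|y uy] := s2P u.2.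
  apply: s'P; split=> //; exists (- u.1); rewrite ?subrK.
    exact: grN.
  by rewrite linearN; apply/eqP; rewrite -subr_eq0 opprK addrC e1.
have sS1 := span_mod_submodule s1 sbc; have sS := span_mod_submodule s2 sS1.
apply/span_mod_cat; rewrite -[u](subrK (y, u.2)); apply: (submoduleD sS).
  apply: span_mod_base => //.
  have -> : u - (y, u.2) = (u.1 - y, 0) by congr pair; rewrite /= subrr.
  have /cone_cycle[y1 _ _ ye] : gcycle (Y := cone) n (y, u.2).
    by apply: span_mod_closed uy => // v; apply: gboundary_cycle.
  apply/s1P/sP; split; first exact: grB.
  rewrite linearB; apply/eqP; rewrite subr_eq0; apply/eqP.
  by apply: (addIr (x *: u.2)); rewrite e1 ye.
by apply: span_mod_sub uy => v vb; apply: span_mod_base.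
Qed.

(** [H_n(Y) / x H_n(Y)] embeds in [H_n(cone)]; were the latter zero at [p], Nakayama's lemma would
    make [H_n(Y)] zero at [p]. *)
Lemma cone_alive (p : R -> Prop) n : prime_ideal p -> p x ->
  homology_fg Y n -> alive Y p n -> alive cone p n.
Proof.
move=> pp px [s [sc sP]] [y cy yp]; apply: contrapT => na.
have sb := gboundary_submodule Y n; have [sp _ _] := pp.
have [|t nt tP] := nakayama (s := s) pp sb.
  move=> v vs; have [vn dv] := sc v vs.
  have cv : gcycle (Y := cone) n (v, 0).
    apply/cone_cycle; split=> //=; [exact: gr0|exact: linear0|].
    by rewrite dv scaler0 addr0.
  apply: contrapT => /forall2NP nv; apply: na; exists (v, 0) => // t nt.
  move=> /cone_boundary[y' [z [/= yn zn tv z0]]]; case: (nv t) => //; apply.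
  have sI := ideal_span_submodule s sp sb.
  rewrite tv; apply: (submoduleD sI).
    by apply: ideal_span_base => //; exists y'.
  apply: ideal_span_scale => //; apply: sP; split=> //.
  by apply/eqP; rewrite -oppr_eq0 -z0 scaler0.
apply: (yp t nt).
apply: (span_mod_closed (Z := fun v => gboundary n (t *: v))) (sP y cy) => //.
  split=> [|a v w bv bw]; first by rewrite scaler0; apply: submodule0.
  rewrite scalerDr scalerA mulrC -scalerA.
  by apply: (submoduleD sb) => //; apply: submoduleZ.
by move=> v bv; apply: submoduleZ.
Qed.

End Cone.

(** * The homology of Hom(P, Y) under cones *)

Section HomInvariant.
Variables (R : comNzRingType) (p : R -> Prop) (P : complex R).
Hypothesis pp : prime_ideal p.
Local Notation family Y := (forall i, {linear P i -> gmod Y}).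

(* At the prime [p], the homology of Hom(P, Y) is [R / I] in degree 0, generated
   by the class of [e], and vanishes in the other degrees. *)
Definition hom_cyclic (Y : graded R) (e : family Y) (I : R -> Prop) : Prop :=
  [/\ ideal I, degree 0 e /\ cocycle 0 e,
      forall n f, degree n f -> cocycle n f ->
        exists t r (h : family Y), [/\ ~ p t, n != 0 -> r = 0, degree (n + 1) h
          & forall i x, t *: f i x = r *: e i x + dhom (n + 1) h i x],
      forall r (h : family Y), degree 1 h -> (forall i x, r *: e i x = dhom 1 h i x) ->
        exists2 t, ~ p t & I (t * r)
    & forall r, I r -> exists2 h : family Y, degree 1 h &
        forall i x, r *: e i x = dhom 1 h i x].

Definition adjoin (I : R -> Prop) (x : R) : R -> Prop := fun r => exists a, I (r - a * x).

Lemma adjoin_ideal I x : ideal I -> ideal (adjoin I x).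
Proof.
move=> sI; split=> [|c r s [a ra] [b sb]].
  by exists 0; rewrite mul0r subr0; apply: ideal0.
exists (c * a + b); have -> : c * r + s - (c * a + b) * x = c * (r - a * x) + (s - b * x) by ring.
by apply: idealD => //; apply: ideal_mull.
Qed.

Definition add_family (Y : graded R) (f g : family Y) : family Y := fun i => f i \+ g i.

Lemma dhom_add (Y : graded R) n (f g : family Y) i x :
  dhom n (add_family f g) i x = dhom n f i x + dhom n g i x.
Proof. by rewrite /dhom /= linearD scalerDr opprD addrACA. Qed.

Lemma degree_add (Y : graded R) n (f g : family Y) :
  degree n f -> degree n g -> degree n (add_family f g).
Proof. by move=> fn gn i x; apply: grD. Qed.

Section ConeFamily.
Variables (Y : graded R) (x : R).

Definition pair_fun (f g : family Y) i (u : P i) : cone x Y := (f i u, g i u).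
Fact pair_fun_linear f g i : linear (@pair_fun f g i).
Proof. by move=> a u v; rewrite /pair_fun !linearP. Qed.
Definition pair_family (f g : family Y) : family (cone x Y) :=
  fun i => linear_map (@pair_fun_linear f g i).

Lemma dhom_pair n (f g : family Y) i u : dhom n (pair_family f g) i u =
  (dhom n f i u + x *: g i u, - dhom (n - 1) g i u) :> Y * Y.
Proof.
congr pair; rewrite /= /dhom; first by rewrite addrAC.
by rewrite sgB1 scaleNr opprK opprD addrC.
Qed.

Lemma degree_pair n (f g : family Y) :
  degree n f -> degree (n - 1) g -> degree n (pair_family f g).
Proof. by move=> fn gn i u; split=> /=; [exact: fn|rewrite -addrA; exact: gn]. Qed.

Lemma family_pair (f : family (cone x Y)) :
  exists g h : family Y, forall i u, f i u = pair_family g h i u.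
Proof.
have l1 i : linear (fun u => (f i u : Y * Y).1) by move=> a u v; rewrite linearP.
have l2 i : linear (fun u => (f i u : Y * Y).2) by move=> a u v; rewrite linearP.
exists (fun i => linear_map (l1 i)), (fun i => linear_map (l2 i)) => i u.
exact: surjective_pairing.
Qed.

End ConeFamily.

Lemma dhom_ext (Y : graded R) n (f g : family Y) i u :
  (forall i u, f i u = g i u) -> dhom n f i u = dhom n g i u.
Proof. by move=> fg; rewrite /dhom !fg. Qed.

(** Hom(P, cone) is the cone of [x] on Hom(P, Y). Its homology is [R / (I + x)] in degree 0; the
    kernel of [x] on [R / I], which would sit in degree 1, vanishes at [p] by regularity. *)
Lemma cone_hom_cyclic (Y : graded R) (x : R) (e : family Y) (I : R -> Prop) :
  (forall r, I (x * r) -> exists2 t, ~ p t & I (t * r)) -> hom_cyclic e I ->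
  hom_cyclic (pair_family x e (fun i => \0)) (adjoin I x).
Proof.
move=> xreg [sI [edeg eco] He Hz Hi]; have [sp p1 pM] := pp.
have nM a b : ~ p a -> ~ p b -> ~ p (a * b) by move=> na nb /pM[].
pose z : family Y := fun i => \0.
have zE i u : z i u = 0 by [].
have zdeg n : degree n z by move=> i u; apply: gr0.
have dz n i u : dhom n z i u = 0 by rewrite /dhom !zE linear0 scaler0 subr0.
split.
- exact: adjoin_ideal.
- split; first exact: degree_pair.
  by move=> i u; rewrite dhom_pair eco dz oppr0 scaler0 addr0.
- move=> n f fdeg fco; have [g [h fgh]] := family_pair f.
  have gdeg : degree n g by move=> i u; have := fdeg i u; rewrite fgh => -[].
  have hdeg : degree (n - 1) h.
    by move=> i u; have := fdeg i u; rewrite fgh addrA => -[].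
  have fco' i u : dhom n g i u + x *: h i u = 0 /\ dhom (n - 1) h i u = 0.
    have := fco i u; rewrite (dhom_ext _ _ fgh) dhom_pair => -[e1 /eqP].
    by rewrite oppr_eq0 => /eqP e2.
  (* The second component [h] is a cocycle of degree [n - 1], null-homotopic at [p] unless [n = 1].
     In that case it is [r e] up to homotopy and a denominator; as [x h] is a boundary, [x r] is in
     [I] at [p], and so is [r]. *)
  have [t nt [k kdeg kh]] : exists2 t, ~ p t &
      exists2 k : family Y, degree n k & forall i u, t *: h i u = dhom n k i u.
    have [|t [r [k [nt r0 kdeg kh]]]] := He _ _ hdeg; first by move=> i u; case: (fco' i u).
    rewrite subrK in kdeg kh.
    have [n1|n1] := eqVneq n 1; last first.
      exists t => //; exists k => // i u; rewrite kh r0 ?scale0r ?add0r //.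
      by rewrite subr_eq0.
    subst n; pose w := scale_family (-1) (add_family (scale_family t g) (scale_family x k)).
    have [||t2 nt2 It2] := Hz (x * r) w.
    + by apply/degree_scale/degree_add; apply: degree_scale.
    + move=> i u; rewrite dhom_scale dhom_add !dhom_scale scaleN1r.
      have [/eqP + _] := fco' i u; rewrite addr_eq0 => /eqP->.
      have re : r *: e i u = t *: h i u - dhom 1 k i u by rewrite kh addrK.
      by rewrite -scalerA re scalerBr opprD scalerN opprK !scalerA [x * t]mulrC.
    have [|t3 nt3 It3] := xreg (t2 * r); first by rewrite mulrCA.
    have [k' k'deg k'h] := Hi _ It3.
    exists ((t3 * t2) * t); first by apply: (nM) => //; apply: (nM).
    exists (add_family k' (scale_family (t3 * t2) k)) => [|i u].
      by apply: degree_add => //; apply: degree_scale.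
    by rewrite -scalerA kh dhom_add dhom_scale -k'h scalerDr !scalerA mulrA.
  (* The null-homotopy [k] of [t h] corrects the first component into a cocycle of Hom(P, Y). *)
  pose g' := add_family (scale_family t g) (scale_family x k).
  have [||t' [r [w [nt' r0 wdeg gw]]]] := He n g'.
  + by apply: degree_add; apply: degree_scale.
  + move=> i u; rewrite dhom_add !dhom_scale -kh.
    have [/eqP + _] := fco' i u; rewrite addr_eq0 => /eqP->.
    by rewrite scalerN !scalerA [t * x]mulrC addNr.
  exists (t' * t), r, (pair_family x w (scale_family (- t') k)); split=> //.
  + exact: nM.
  + by apply: degree_pair => //; rewrite addrK; apply: degree_scale.
  move=> i u; rewrite dhom_pair fgh.
  have := gw i u; rewrite [g' i u]/(t *: g i u + x *: k i u) => gwE.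
  have -> : (t' * t) *: pair_family x g h i u = ((t' * t) *: g i u, (t' * t) *: h i u) by [].
  have -> : r *: pair_family x e z i u = (r *: e i u, r *: 0) by [].
  congr pair => /=.
    rewrite addrA -gwE scaleNr scalerN scalerDr !scalerA.
    by rewrite [x * t']mulrC addrK.
  by rewrite scaler0 add0r addrK dhom_scale scaleNr opprK -kh scalerA.
- move=> r f fdeg ef; have [w [v fwv]] := family_pair f.
  have wdeg : degree 1 w by move=> i u; have := fdeg i u; rewrite fwv => -[].
  have vdeg : degree 0 v.
    by move=> i u; have := fdeg i u; rewrite fwv addr0 => -[_]; rewrite /= addrK.
  have ef' i u : r *: e i u = dhom 1 w i u + x *: v i u /\ dhom 0 v i u = 0.
    have := ef i u; rewrite (dhom_ext _ _ fwv) dhom_pair => -[e1 e2]; split=> //.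
    by apply/eqP; rewrite -oppr_eq0 -e2; apply/eqP/scaler0.
  (* As [v] is a cocycle of degree 0, [t v] is homotopic to [r' e]; hence [t r - x r'] is in [I] at
     [p]. *)
  have [|t [r' [k [nt _ kdeg vk]]]] := He _ _ vdeg; first by move=> i u; case: (ef' i u).
  have [||t' nt' It'] := Hz (t * r - x * r') (add_family (scale_family t w) (scale_family x k)).
  + by apply: degree_add; apply: degree_scale.
  + move=> i u; rewrite dhom_add !dhom_scale scalerBl -!scalerA.
    have [-> _] := ef' i u; rewrite scalerDr [t *: (x *: _)]scalerA [t * x]mulrC -scalerA vk.
    by rewrite [x *: (_ *: _ + _)]scalerDr -!addrA; congr (_ + _); rewrite addrCA subrr addr0.
  exists (t' * t); first exact: nM.
  exists (t' * r'); move: It'; congr I; ring.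
move=> r [a ra]; have [k kdeg ke] := Hi _ ra.
exists (pair_family x k (scale_family a e)) => [|i u].
  by apply: degree_pair => //; apply: degree_scale.
rewrite dhom_pair subrr dhom_scale eco scaler0 oppr0 -ke.
have -> : r *: pair_family x e z i u = (r *: e i u, r *: 0) by [].
by rewrite scaler0 scale_familyE scalerBl scalerA [x * a]mulrC subrK.
Qed.

End HomInvariant.

(** * Concentration at a prime *)

Section LocalConcentration.
Variables (R : comNzRingType) (p : R -> Prop) (P : complex R).
Hypotheses (noethR : noetherian R) (pp : prime_ideal p).
Local Notation family Y := (forall i, {linear P i -> gmod Y}).

(* [xs] becomes a regular sequence on [R / I] after localization at [p]. *)
Fixpoint regular_at (I : R -> Prop) (xs : seq R) : Prop :=
  if xs is x :: xs' then
    (forall r, I (x * r) -> exists2 t, ~ p t & I (t * r)) /\ regular_at (adjoin I x) xs'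
  else True.

(** A power of [x], since each further cone doubles the exponent. *)
Definition nilpotent_on (Y : graded R) (x : R) : Prop :=
  exists k, forall n, kills Y (x ^+ k) n.

Lemma cone_nilpotent (Y : graded R) x y : nilpotent_on Y y -> nilpotent_on (cone x Y) y.
Proof.
by move=> [k ky]; exists (k + k)%N => n; rewrite exprD; apply: cone_kills; apply: ky.
Qed.

(** Iterated cones on [xs]: lying in [p] keeps degree [s] alive, regularity keeps the homology of
    Hom(P, Y) cyclic, and each cone makes its own element act nilpotently. *)
Lemma koszul_complex (xs : seq R) (Y : graded R) (e : family Y) (I : R -> Prop) (s A : int) :
  (forall x, x \in xs -> p x) -> regular_at I xs -> hom_cyclic p e I ->
  (forall n, homology_fg Y n) -> (forall n, A <= n -> kills Y 1 n) -> alive Y p s ->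
  exists (Y' : graded R) (e' : family Y') (I' : R -> Prop) (A' : int),
  [/\ hom_cyclic p e' I', forall n, homology_fg Y' n, forall n, A' <= n -> kills Y' 1 n,
      alive Y' p s & forall x, x \in xs \/ nilpotent_on Y x -> nilpotent_on Y' x].
Proof.
elim: xs Y e I A => [|x xs IHxs] Y e I A xsp reg inv fgY YA sY.
  by exists Y, e, I, A; split=> // x [].
have [xreg reg'] := reg.
have px : p x by apply: xsp; rewrite inE eqxx.
have [|n|n An||Y' [e' [I' [A' [inv' fg' YA' sY' nil]]]]] :=
    IHxs (cone x Y) _ _ (A + 1) _ reg' (cone_hom_cyclic pp xreg inv).
- by move=> y yxs; apply: xsp; rewrite inE yxs orbT.
- exact: cone_fg.
- by rewrite -[1]mulr1; apply: cone_kills; apply: YA; lia.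
- exact: cone_alive.
exists Y', e', I', A'; split=> // y; rewrite inE => -[/orP[/eqP->|yxs]|ny]; apply: nil.
- by right; exists 1%N => n; rewrite expr1; apply: cone_kills_self.
- by left.
by right; apply: cone_nilpotent.
Qed.

Lemma max_int (Q : int -> Prop) (s A : int) : Q s -> (forall n, A <= n -> ~ Q n) ->
  exists n, [/\ Q n, s <= n & forall m, n < m -> ~ Q m].
Proof.
move=> Qs QA; pose B k := `[< Q (A - k%:Z) >].
have sA : s < A by rewrite ltNge; apply/negP => /QA.
have eB : exists k, B k.
  by exists `|A - s|%N; apply/asboolP; have -> : A - `|A - s|%N%:Z = s by lia.
case: (ex_minnP eB) => k /asboolP Qk kmin; exists (A - k%:Z); split=> // [|m km Qm].
  have /kmin : B `|A - s|%N by apply/asboolP; have -> : A - `|A - s|%N%:Z = s by lia.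
  lia.
have mA : m < A by rewrite ltNge; apply/negP => /QA.
have /kmin : B `|A - m|%N by apply/asboolP; have -> : A - `|A - m|%N%:Z = m by lia.
lia.
Qed.

Lemma min_int (Q : int -> Prop) (s A : int) : Q s -> (forall n, n < A -> ~ Q n) ->
  exists n, [/\ Q n, n <= s & forall m, m < n -> ~ Q m].
Proof.
move=> Qs QA.
have [||n [Qn sn nmax]] := @max_int (fun n => Q (- n)) (- s) (- A + 1).
- by rewrite opprK.
- by move=> n An; apply: QA; lia.
exists (- n); split=> // [|m mn]; first by lia.
by rewrite -[m]opprK; apply: nmax; lia.
Qed.

Hypothesis Pproj : forall i, projective (P i).
Variables (N A : int) (xs : seq R).
Hypothesis PN : forall n, n < N -> forall x : P n, x = 0.
Hypothesis fgP : forall n, homology_fg (total P) n.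
Hypothesis PA : forall n, A <= n -> kills (total P) 1 n.
Hypothesis invP : hom_cyclic (Y := total P) p (inj P) (fun r => r = 0).
Hypothesis xs_p : forall x, x \in xs -> p x.
Hypothesis xs_regular : regular_at (fun r => r = 0) xs.
Hypothesis xs_primary : forall q : R -> Prop, prime_ideal q -> (forall r, q r -> p r) ->
  (forall x, x \in xs -> q x) -> forall r, p r -> q r.

Lemma alive_not_kills (Y : graded R) b n : alive Y p n -> kills Y b n -> p b.
Proof.
by move=> [y cy yp] kb; apply: contrapT => nb; apply: (yp b nb); apply: kb.
Qed.

(* Let [i] be the lowest degree alive at [p], and [s'] the highest one in the
   Koszul complex [Y] on [xs].  Prime ideals associated to [H_s'(Y)] inside [p]
   contain [xs], so [p] itself is associated, and there is a nonzero map
   [P -> H_i(P) -> R / p -> H_s'(Y)] of degree [s' - i]; hence [s' = i]. *)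
Lemma local_concentration i s : alive (total P) p i -> alive (total P) p s -> i = s.
Proof.
have [_ p1 _] := pp.
suff low i0 j : alive (total P) p i0 -> (forall m, m < i0 -> ~ alive (total P) p m) ->
    alive (total P) p j -> j = i0.
  move=> ai as_; have [|i0 [ai0 _ i0min]] := min_int (Q := alive (total P) p) (A := N) ai.
    move=> n nN [y [yn _] yp]; apply: (yp 1 p1); rewrite (gr_inj yn) (PN nN (y n)).
    by rewrite linear0 scaler0; apply: submodule0; apply: gboundary_submodule.
  by rewrite (low i0 i) // (low i0 s).
move=> ai0 i0min aj.
have [Y [e [I [A' [inv fgY YA aY nil]]]]] := koszul_complex xs_p xs_regular invP fgP PA aj.
have [|s' [as' js' s'max]] := max_int (Q := alive Y p) (A := A') aY.
  by move=> n An /alive_not_kills an; apply/p1/an/YA.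
have [u cu up] := as'; have sb := gboundary_submodule Y s'.
have mp := outside_mult pp.
(* Avoiding the complement of [p] keeps the associated prime inside [p]. It contains [xs], powers of
   which kill the homology, so it equals [p] by [xs_primary]. *)
have [|b [qp qS]] := associated_prime noethR sb mp (u := u); first by move=> t; apply: up.
set w := b *: u in qp qS.
have cw : gcycle s' w by apply: submoduleZ cu; apply: gcycle_submodule.
have qsub r : annihilator (gboundary s') w r -> p r.
  by move=> qr; apply: contrapT => nr; apply: qS qr.
have qE r : gboundary s' (r *: w) <-> p r.
  split; first exact: qsub.
  move=> pr; apply: (xs_primary qp qsub) pr => x xxs; have [|k kx] := nil x; first by left.
  have [_ q1 qM] := qp.
  have : annihilator (gboundary s') w (x ^+ k) by apply: kx.
  elim: k {kx} => [|k IHk]; first by rewrite expr0.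
  by rewrite exprS => /qM[].
have [|||||||f [fdeg fco fnz]] := @nonzero_hom _ P Pproj N PN Y p (i0 + 1) s' A' w pp;
  rewrite ?addrK //.
- move=> m /i0min; exact: not_alive_kills.
- move=> m /s'max; exact: not_alive_kills.
rewrite addrK in fdeg fco fnz.
have [_ _ Hinv _ _] := inv; have [t [r [h [nt r0 hdeg fh]]]] := Hinv _ _ fdeg fco.
(* Off degree 0 every cocycle is null-homotopic at [p], so [s' = i0]; then [i0 <= j <= s'] gives
   [j = i0]. *)
have [|s'i] := eqVneq (s' - i0) 0.
  have ij : i0 <= j by rewrite leNgt; apply/negP => /i0min; apply.
  lia.
case: (fnz t h nt hdeg) => k x; rewrite fh r0 // scale0r add0r //.
Qed.

End LocalConcentration.

(** * Chain maps and isomorphisms in the derived category *)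

Section ChainMaps.
Variable R : comNzRingType.
Implicit Types X Y Z : complex R.

Lemma boundary_submodule X n : submodule (@boundary R X n).
Proof.
split=> [|a x y [z ->] [t ->]]; first by exists 0; rewrite linear0.
by exists (a *: z + t); rewrite linearP.
Qed.

Lemma boundaryB X n (x y : X n) : boundary x -> boundary y -> boundary (x - y).
Proof. exact: (submoduleB (boundary_submodule X n)). Qed.

Lemma boundary_congr X n (x y : X n) : boundary (x - y) -> boundary x <-> boundary y.
Proof.
move=> xy; have sb := boundary_submodule X n; split=> [bx|]; last exact: submodule_cancel.
by rewrite -[y](subKr x); apply: boundaryB.
Qed.

Lemma cmap_cycle X Y (f : chain_map X Y) n (x : X n) : cycle x -> cycle (f n x).
Proof. by rewrite /cycle -(cmap_diff f) => ->; rewrite linear0. Qed.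

Lemma cmap_boundary X Y (f : chain_map X Y) n (x : X n) : boundary x -> boundary (f n x).
Proof. by move=> [y ->]; exists (f (n + 1) y); rewrite (cmap_diff f). Qed.

Lemma homotopic_boundary X Y (f g : chain_map X Y) n (x : X n) : homotopic f g ->
  cycle x -> boundary (f n x - g n x).
Proof.
by move=> [h hP] cx; exists (h n (n + 1) x); rewrite hP (cx : diff X _ _ x = 0) linear0 addr0.
Qed.

Lemma homotopic_refl X Y (f : chain_map X Y) : homotopic f f.
Proof. by exists (fun i j => \0) => n x; rewrite subrr /= linear0 addr0. Qed.

Lemma homotopic_eq X Y (f g : chain_map X Y) : (forall n x, f n x = g n x) -> homotopic f g.
Proof. by move=> fg; exists (fun i j => \0) => n x; rewrite fg subrr /= linear0 addr0. Qed.

Lemma quasi_iso_comp X Y Z (g : chain_map Y Z) (f : chain_map X Y) :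
  quasi_iso g -> quasi_iso f -> quasi_iso (chain_comp g f).
Proof.
move=> gq fq n; have [gi gs] := gq n; have [fi fs] := fq n; split=> [x cx gfx|z cz].
  by apply: fi => //; apply: gi gfx; apply: cmap_cycle.
have [y cy yz] := gs z cz; have [x cx xy] := fs y cy; exists x => //=.
apply: (submodule_cancel (boundary_submodule Z n)) yz; rewrite /= opprB addrA subrK -linearB.
exact: cmap_boundary.
Qed.

(** One composite with the inverse roof gives injectivity on homology, the other surjectivity.
    Homotopic maps agree on cycles up to boundaries, so both roofs are chased elementwise. *)
Lemma derived_iso_quasi_iso X Y (g : chain_map X Y) : derived_iso (roof_of g) -> quasi_iso g.
Proof.
move=> [b [[V [u [v [q [guv [W [u' [v' [q' e1 e2]]]]]]]]]
  [V2 [u2 [v2 [q2 [_ [W2 [u2' [v2' [q2' e3 e4]]]]]]]]]]] n; split=> [x cx gx|y cy].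
  have [_ /(_ x cx)[w cw /= wx]] := q' n.
  apply/(boundary_congr wx)/(boundary_congr (homotopic_boundary e1 cw)).
  apply/(boundary_congr (homotopic_boundary e2 cw)) => /=.
  have cu := cmap_cycle u' cw; have cv := cmap_cycle v cu.
  apply: cmap_boundary; have [/(_ _ cv) + _] := denom_qis b n; apply.
  apply/(boundary_congr (homotopic_boundary guv cu)) => /=.
  have gwx : boundary (g n (u n (u' n w)) - g n x) by rewrite -linearB; apply: cmap_boundary.
  exact/(boundary_congr gwx).
have [_ /(_ y cy)[w cw /= wy]] := q2' n.
exists (v2 n (u2' n w)); first by do 2 apply: cmap_cycle.
have h3 := homotopic_boundary e3 cw; have h4 := homotopic_boundary e4 cw.
rewrite /= in h3 h4.
have -> : g n (v2 n (u2' n w)) - y = (g n (v2 n (u2' n w)) - v2' n w) -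
  (denom b n (u2 n (u2' n w)) - v2' n w) + (denom b n (u2 n (u2' n w)) - y).
  by rewrite opprB !addrA !subrK.
apply: (submoduleD (boundary_submodule Y n)) wy.
exact: boundaryB.
Qed.

End ChainMaps.

(** * The homology of Hom(P, P) *)

Section HomTrivial.
Variables (R : comNzRingType) (P : complex R).
Local Notation family := (forall i, {linear P i -> total P}).

(** The homology of Hom(P, P) is [R] in degree 0, on the class of the identity, which appears here
    as [inj P]. *)
Definition hom_trivial : Prop :=
  (forall n (f : family), degree n f -> cocycle n f -> exists r (h : family),
    [/\ n != 0 -> r = 0, degree (n + 1) h
      & forall i x, f i x = r *: inj P i x + dhom (n + 1) h i x]) /\
  (forall r (h : family), degree 1 h -> (forall i x, r *: inj P i x = dhom 1 h i x) -> r = 0).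

Lemma hom_trivial_cyclic (p : R -> Prop) : prime_ideal p -> hom_trivial ->
  hom_cyclic (Y := total P) p (inj P) (fun r => r = 0).
Proof.
move=> [_ p1 _] [Hs Hi]; split.
- exact: submodule_zero.
- by split; [apply: inj_degree|apply: inj_cocycle].
- move=> n f fdeg fco; have [r [h [r0 hdeg fh]]] := Hs n f fdeg fco.
  by exists 1, r, h; split=> // i x; rewrite scale1r.
- by move=> r h hdeg rh; exists 1 => //; rewrite (Hi r h) // mulr0.
pose z : family := fun i => \0.
have zE i x : z i x = 0 by [].
move=> r ->; exists z => i x; first exact: gr0.
by rewrite /dhom !zE linear0 scaler0 subrr scale0r.
Qed.

Definition family_of_fun n (G : homc_obj P P n) i (x : P i) : total P :=
  fun j => homc_at G i j x.
Fact family_of_linear n (G : homc_obj P P n) i : linear (@family_of_fun n G i).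
Proof.
move=> a x y; apply: functional_extensionality_dep => j.
exact: (linearP (homc_at G i j)).
Qed.
Definition family_of n (G : homc_obj P P n) : family :=
  fun i => linear_map (@family_of_linear n G i).

Lemma family_of_degree n (G : homc_obj P P n) : degree n (family_of G).
Proof. by move=> i x k ki; rewrite /= /family_of_fun homc_at0. Qed.

Lemma dhom_family_of n (G : homc_obj P P n) m i x j : n = m + 1 ->
  homc_at (homc_diff_fun m G) i j x = (dhom n (family_of G) i x : dfam P) j.
Proof. by move=> nm; rewrite homc_diffE. Qed.

Definition of_family_fun (f : family) i j (x : P i) : P j := (f i x : dfam P) j.
Fact of_family_linear f i j : linear (@of_family_fun f i j).
Proof.
by move=> a x y; have := congr1 (fun F : dfam P => F j) (linearP (f i) a x y).
Qed.
Definition of_family (f : family) : hom_family P P := fun i j =>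
  to_hom (linear_map (@of_family_linear f i j)).

Fact of_family_in n f : degree n f -> of_family f \in homc_pred n.
Proof. by move=> fdeg; apply/asboolP => i j ij; apply: homP => x; apply: fdeg. Qed.

Lemma homothety_hom_trivial : quasi_iso (homothety P) -> hom_trivial.
Proof.
move=> hq; split=> [n f fdeg fco|r h hdeg rh].
  pose F : hom_complex P P n := MkHomc (of_family_in fdeg).
  have cF : cycle F.
    apply: homc_ext => i j x; rewrite (@dhom_family_of _ _ _ _ _ _) ?subrK //.
    exact: (congr1 (fun y : dfam P => y j) (fco i x)).
  have [_ /(_ F cF)[a _ [G FG]]] := hq n.
  (* [G] bounds the homothety minus [F], the opposite of the difference wanted; hence the factor
     -1. *)
  exists (stalk_val a : R), (scale_family (-1) (family_of G)); split=> [n0|i|i x].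
  - by rewrite (stalk_val0 a n0).
  - by apply/degree_scale/family_of_degree.
  rewrite dhom_scale scaleN1r; apply: functional_extensionality_dep => j.
  have := congr1 (fun H : homc_obj P P n => homc_at H i j x) FG.
  rewrite [RHS]dhom_family_of // => e.
  change ((f i x : dfam P) j = (stalk_val a : R) *: (id_family P i j x) -
    (dhom (n + 1) (family_of G) i x : dfam P) j).
  rewrite -e; change ((f i x : dfam P) j = (stalk_val a : R) *: (id_family P i j x) -
    ((stalk_val a : R) *: (id_family P i j x) - (f i x : dfam P) j)).
  by rewrite subKr.
have [/(_ (stalk_elt 0 (r : R^o))) + _] := hq 0; case=> //.
  pose H : hom_complex P P (0 + 1) := MkHomc (of_family_in hdeg).
  exists H; apply: homc_ext => i j x; rewrite [RHS]dhom_family_of //.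
  exact: (congr1 (fun y : dfam P => y j) (rh i x)).
by move=> y /(congr1 (@stalk_val _ _ 0)).
Qed.

End HomTrivial.

(** * Finiteness of the homology of a resolution *)

Section HomologicallyFinite.
Variable R : comNzRingType.

Lemma fg_mod_family (M : lmodType R) (Z B : M -> Prop) m (v : 'I_m -> M) : submodule B ->
  (forall k, Z (v k)) -> (forall z, Z z -> exists a : 'I_m -> R, B (z - \sum_k a k *: v k)) ->
  fg_mod Z B.
Proof.
move=> sB Zv ZB; have sS := span_mod_submodule [seq v k | k : 'I_m] sB.
exists [seq v k | k : 'I_m]; split=> [z /mapP[k _ ->]|z /ZB[a za]]; first exact: Zv.
apply: (submodule_cancel sS); first exact: (span_mod_base _ sB za).
apply: (submodule_sum sS) => k _; apply: (submoduleZ sS); apply: span_mod_mem => //.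
by apply: map_f; rewrite mem_enum.
Qed.

Variables (K P : complex R) (f : chain_map P K).
Hypotheses (finK : homologically_finite K) (fq : quasi_iso f).

Lemma homologically_finite_generators : exists m (z : 'I_m -> forall n, K n),
  (forall k, total_cycle (z k)) /\ forall n (x : P n), cycle x ->
    exists a : 'I_m -> R, boundary (f n x - \sum_k a k *: z k n).
Proof.
have [m [z [zc zP]]] := finK; exists m, z; split=> // n x cx.
pose w j := id_family K n j (f n x).
have [|a /(_ n)] := zP w; last first.
  by rewrite {1}/w id_family_diag; exists a.
have w0 j : j != n -> w j = 0 by move=> jn; rewrite /w id_family_off // eq_sym.
split=> [j|]; last by exists `|n|%N => j jn; apply: w0; apply: contraTneq jn => ->; rewrite ltnn.
have [->|/w0 wj] := eqVneq j n; last by rewrite /cycle wj linear0.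
by rewrite /w /cycle id_family_diag; apply: (cmap_cycle f).
Qed.

Lemma homologically_finite_bound : exists A : int, forall n, A <= n -> kills (total P) 1 n.
Proof.
have [m [z [zc zP]]] := homologically_finite_generators.
have /choice[N NP] : forall k, exists N : nat, forall n, (N < `|n|)%N -> z k n = 0.
  by move=> k; case: (zc k).
(* The sum of the bounds dominates each of them. *)
exists (\sum_k N k)%N.+1%:Z => n An y /gcycleP[x cx ->]; rewrite scale1r; apply/gboundary_inj.
have [+ _] := fq n; apply=> //; have [a] := zP n x cx.
rewrite big1 ?subr0 // => k _; rewrite NP ?scaler0 //.
by rewrite (bigD1 k) //= in An; lia.
Qed.

Lemma homologically_finite_fg n : homology_fg (total P) n.
Proof.
have [m [z [zc zP]]] := homologically_finite_generators.
have /choice[v vP] : forall k, exists v : P n, cycle v /\ boundary (f n v - z k n).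
  by move=> k; have [_ /(_ (z k n))[|v cv vz]] := fq n; [case: (zc k)|exists v].
have sb := boundary_submodule K n.
apply: (fg_mod_family (v := fun k => inj P n (v k))) => [|k|y /gcycleP[x cx ->]].
- exact: gboundary_submodule.
- by apply/gcycle_inj; case: (vP k).
have [a xa] := zP n x cx; exists a.
have -> : inj P n x - \sum_k a k *: inj P n (v k) = inj P n (x - \sum_k a k *: v k).
  rewrite (linearB (inj P n)) (linear_sum (inj P n)); congr (_ - _).
  by apply: eq_bigr => k _; rewrite (linearZ_LR (inj P n)).
apply/gboundary_inj; have [+ _] := fq n; apply.
  rewrite /cycle linearB linear_sum big1 => [|k _]; first by rewrite (cx : diff P _ _ x = 0) subrr.
  by rewrite linearZ; have [-> _] := vP k; apply: scaler0.
apply: (submodule_cancel sb) xa.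
rewrite linearB linear_sum opprB addrC addrA subrK -opprB -sumrB.
apply: (submoduleN sb); apply: (submodule_sum sb) => k _.
by rewrite linearZ -scalerBr; apply: (submoduleZ sb); case: (vP k).
Qed.

End HomologicallyFinite.

(** * Global concentration *)

Section Concentration.
Variables (R : idomainType) (P : complex R) (N A : int).
Hypothesis noethR : noetherian R.
Hypothesis Pproj : forall i, projective (P i).
Hypothesis PN : forall n, n < N -> forall x : P n, x = 0.
Hypothesis fgP : forall n, homology_fg (total P) n.
Hypothesis PA : forall n, A <= n -> kills (total P) 1 n.
Hypothesis Phom : hom_trivial P.

(** Otherwise [lift] contracts [P] up to some [b] in [S]: then [b] times the identity is
    null-homotopic, which forces [b = 0]. *)
Lemma homothety_not_null (S : R -> Prop) : mult_closed S -> ~ S 0 ->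
  ~ forall n, exists2 b, S b & kills (total P) b n.
Proof.
move=> mS S0 SP; pose z : forall i, {linear P i -> total P} := fun i => \0.
have zE i x : z i x = 0 by [].
have [||||b [h [Sb hdeg hb _]]] := @lift _ P (total P) S 1 (inj P) z N A mS Pproj
    (@inj_degree _ P) (@inj_cocycle _ P).
- by move=> i x; apply: gr0.
- by move=> i iN x; rewrite (PN iN x) linear0 /dhom !zE linear0 scaler0 subrr.
- by move=> i _; rewrite addr0; apply: SP.
- by move=> i iA; rewrite addr0; apply: PA.
have [_ Hi] := Phom.
by case: S0; rewrite -(Hi b h) // => i x; rewrite hb.
Qed.

Lemma alive_somewhere (p : R -> Prop) : prime_ideal p -> exists n, alive (total P) p n.
Proof.
move=> pp; apply: contrapT => /forallNP na; have [sp p1 _] := pp.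
apply: (homothety_not_null (outside_mult pp)) => [|n]; first by apply; apply: ideal0.
exact: not_alive_kills (na n).
Qed.

(* This is what the Cohen-Macaulay property provides. *)
Hypothesis CM : forall m : R -> Prop, prime_ideal m ->
  (forall J, ideal J -> (forall x, m x -> J x) -> ~ J 1 -> forall x, J x -> m x) ->
  exists xs : seq R, [/\ forall x, x \in xs -> m x, regular_at m (fun r => r = 0) xs
    & forall q : R -> Prop, prime_ideal q -> (forall r, q r -> m r) ->
        (forall x, x \in xs -> q x) -> forall r, m r -> q r].

Lemma concentration : exists n0, forall n, n != n0 -> kills (total P) 1 n.
Proof.
(* A degree alive at the zero ideal is alive at every prime, so [n0] is the same for all maximal
   ideals. A nonzero class in another degree has a proper annihilator, contained in some [m], and is
   alive at [m]. *)
have [n0 [y0 cy0 y0P]] := alive_somewhere (prime_zero R).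
exists n0 => n nn0 y cy; apply: contrapT => ny.
have sb := gboundary_submodule (total P) n.
have [m [pm ym mmax]] := exists_maximal_ideal noethR (annihilator_ideal y sb) ny.
have [xs [xsm xsreg xsprim]] := CM pm mmax.
have [sm _ _] := pm.
have ay : alive (total P) m n by exists y => // t nt ty; apply/nt/ym.
have ay0 : alive (total P) m n0.
  by exists y0 => // t nt; apply: y0P => t0; apply: nt; rewrite t0; apply: ideal0.
have invP := hom_trivial_cyclic pm Phom.
move: nn0; rewrite (local_concentration noethR pm Pproj PN fgP PA invP xsm xsreg xsprim ay ay0).
by rewrite eqxx.
Qed.

End Concentration.

(** * Complexes with homology in one degree *)

Section ShiftHomology.
Variables (R : comNzRingType) (X : complex R) (s : int).

Lemma signr_scale_eq0 (V : lmodType R) k (x : V) : (-1 : R) ^+ k *: x = 0 <-> x = 0.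
Proof.
split=> [e|->]; last exact: scaler0.
by rewrite -[x]scale1r -(sqrr_sign R k) expr2 -scalerA e scaler0.
Qed.

Lemma shift_cycle n (x : X (n - s)) :
  @cycle R (shift X s) n x <-> gcycle (n - s) (inj X (n - s) x).
Proof.
have e : gd (inj X (n - s) x) = inj X (n - 1 - s) (diff X (n - s) (n - 1 - s) x).
  by apply: inj_diff; ring.
split=> [/signr_scale_eq0 dx|[_]].
  by split; [exact: inj_gr|rewrite e dx linear0].
rewrite e -[RHS](linear0 (inj X (n - 1 - s))) => /inj0 dx.
by apply/signr_scale_eq0.
Qed.

Lemma shift_boundary n (x : X (n - s)) :
  @boundary R (shift X s) n x <-> gboundary (n - s) (inj X (n - s) x).
Proof.
have e y : gd (inj X (n + 1 - s) y) = inj X (n - s) (diff X (n + 1 - s) (n - s) y).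
  by apply: inj_diff; ring.
have ns : n - s + 1 = n + 1 - s by ring.
split=> [[y xy]|[z zn xz]].
  exists ((-1) ^+ `|s|%N *: inj X (n + 1 - s) y).
    by apply: grZ; rewrite ns; apply: inj_gr.
  by rewrite (linearZ_LR gd) e xy -(linearZ_LR (inj X (n - s))).
rewrite ns in zn; rewrite (gr_inj zn) e in xz.
exists ((-1) ^+ `|s|%N *: (z : dfam X) (n + 1 - s)); apply: (@inj0 _ X (n - s)).
rewrite xz; congr (inj X (n - s) _); set y := (z : dfam X) _.
change (diff X (n + 1 - s) (n - s) y =
  (-1) ^+ `|s|%N *: diff X (n + 1 - s) (n - s) ((-1) ^+ `|s|%N *: y)).
by rewrite linearZ /= scalerA -expr2 sqrr_sign scale1r.
Qed.

End ShiftHomology.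

(* [theta] identifies [H_n(X)] with [C], and the other homology modules vanish. *)
Definition presents (R : comNzRingType) (X : complex R) (n : int) (C : lmodType R)
    (theta : {linear total X -> C}) : Prop :=
  [/\ forall y, gboundary n y -> theta y = 0,
      forall y, gcycle n y -> theta y = 0 -> gboundary n y,
      forall c, exists2 y, gcycle n y & theta y = c
    & forall k, k != n -> kills (total X) 1 k].

Lemma presents_shift (R : comNzRingType) (X : complex R) (n s : int) (C : lmodType R)
    (theta : {linear total X -> C}) : presents n theta ->
  exists theta' : {linear total (shift X s) -> C}, presents (n + s) theta'.
Proof.
move=> [t0 ti ts tk].
have th_lin : linear (fun y : total (shift X s) =>
    theta (inj X (n + s - s) ((y : dfam (shift X s)) (n + s)))).
  by move=> a y z; rewrite -linearP -(linearP (inj X (n + s - s))).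
have ns : n + s - s = n by ring.
exists (linear_map th_lin); split=> /= [y [z zn ->]|y cy yn|c|k kn y cy].
- have : @boundary R (shift X s) (n + s) ((gd z : dfam (shift X s)) (n + s)).
    by exists ((z : dfam (shift X s)) (n + s + 1)).
  by move=> /shift_boundary; rewrite [X in gboundary X]ns => /t0.
- have [x cx yx] := gcycleP cy; rewrite yx in yn *; rewrite inj_diag in yn.
  apply/gboundary_inj/shift_boundary; rewrite [X in gboundary X]ns; apply: ti yn.
  by move/shift_cycle: cx; rewrite [X in gcycle X]ns.
- have [y cy <-] := ts c; rewrite -ns in cy; have [x cx yx] := gcycleP cy.
  exists (inj (shift X s) (n + s) x); last by rewrite inj_diag yx.
  by apply/gcycle_inj/shift_cycle; rewrite -yx.
have [x cx ->] := gcycleP cy; rewrite scale1r; apply/gboundary_inj/shift_boundary.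
rewrite -[inj _ _ _]scale1r; apply: tk; first by lia.
exact/shift_cycle.
Qed.

(** * The homology module is semidualizing *)

Section HomologyModule.
Variables (R : idomainType) (P : complex R) (N a : int).
Hypothesis Pproj : forall i, projective (P i).
Hypothesis PN : forall n, n < N -> forall x : P n, x = 0.
Hypothesis fgP : forall n, homology_fg (total P) n.
Hypothesis Phom : hom_trivial P.
Hypothesis Pa : forall n, n != a - 1 -> kills (total P) 1 n.

(** [theta] has to be defined on all of [total P], not only on cycles. As [P] is exact below degree
    [a - 1], [rho] projects onto the cycles of that degree, and [C] is the quotient of [P (a - 1)]
    by the elements that [rho] sends to boundaries. *)
Lemma homology_module : exists (C : lmodType R) (theta : {linear total P -> C}),
  presents (a - 1) theta.
Proof.
have [|b [rho [-> rhoc rhob]]] := retraction Pproj PN (a := a) (mult_closed_one R).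
  by move=> i ia; exists 1 => //; apply: Pa; lia.
have sb := gboundary_submodule (total P) (a - 1).
have sN : submodule (fun x => gboundary (a - 1) (rho x)).
  split=> [|c x y bx by_]; first by rewrite linear0; apply: submodule0.
  by rewrite linearP; apply: (submoduleD sb) => //; apply: submoduleZ.
have rhoE x : cycle x -> rho x = inj P (a - 1) x by move=> /rhob->; rewrite scale1r.
have [C [q [qs q0]]] := quotient_module sN.
have th_lin : linear (fun y : total P => q ((y : dfam P) (a - 1))).
  by move=> c y z; rewrite -linearP.
exists C, (linear_map th_lin); split=> /= [y by_|y cy /q0|c|]; last exact: Pa.
- apply/q0; have [x cx yx] := gcycleP (gboundary_cycle by_).
  by rewrite yx inj_diag rhoE // -yx.
- by have [x cx ->] := gcycleP cy; rewrite inj_diag rhoE.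
have [x <-] := qs c; have [x' cx' xx'] := gcycleP (rhoc x).
exists (rho x) => //; rewrite xx' inj_diag; apply/eqP; rewrite -subr_eq0 -linearB.
apply/eqP/q0; rewrite linearB xx' rhoE // subrr; exact: submodule0.
Qed.

Variables (C : lmodType R) (theta : {linear total P -> C}).
Hypothesis thetaP : presents (a - 1) theta.

Lemma homology_module_fg : finitely_generated C.
Proof.
have [t0 ti ts _] := thetaP; have [s [sc sP]] := fgP (a - 1).
exists [seq theta y | y <- s] => c; apply/spanned_span.
have [y cy <-] := ts c; move: (sP y cy) => {cy}.
elim: (s) y => [|v r IHr] y /=; first exact: t0.
by move=> [d /IHr yd]; exists d; move: yd; rewrite linearB linearZ.
Qed.

(** For nonzero [r] this would contradict [homothety_not_null] for the powers of [r], none of which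
    is 0 in a domain. *)
Lemma homology_homothety_inj (r : R) : (forall c : C, r *: c = 0) -> r = 0.
Proof.
move=> rC; have [t0 ti ts _] := thetaP.
pose S (b : R) := exists k, b = r ^+ k.
have mS : mult_closed S.
  by split=> [|_ _ [k ->] [l ->]]; [exists 0%N|exists (k + l)%N; rewrite exprD].
have PA n : a <= n -> kills (total P) 1 n by move=> an; apply: Pa; lia.
apply/eqP; apply: contrapT => /negP r0; apply: (homothety_not_null Pproj PN PA Phom mS).
  by move=> [k /esym/eqP]; rewrite expf_eq0 (negPf r0) andbF.
move=> n; have [->|na] := eqVneq n (a - 1); last by exists 1; [exists 0%N|exact: Pa].
exists r; first by exists 1%N.
move=> y cy; apply: ti; last by rewrite linearZ; apply: rC.
exact: submoduleZ (gcycle_submodule _ _) _ _ cy.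
Qed.

(** [P] stands for [C] as a target: its homology is [C] in degree [a - 1] and zero above, so a
    cocycle of Hom(P, C) lifts to a cocycle of Hom(P, P). *)
Lemma homology_lift (b : int) (k : {linear P (b - 1) -> C}) :
  (forall x, k (diff P b (b - 1) x) = 0) ->
  exists f : forall i, {linear P i -> total P},
  [/\ degree (a - 1 - (b - 1)) f, cocycle (a - 1 - (b - 1)) f
    & forall x, gcycle (a - 1) (f (b - 1) x) /\ theta (f (b - 1) x) = k x].
Proof.
move=> kd; have [t0 ti ts _] := thetaP.
have sc := gcycle_submodule (total P) (a - 1).
have [||l lP] := projective_relation (N := total P)
    (Q := fun x y => gcycle (a - 1) y /\ theta y = k x) (@Pproj (b - 1)).
- move=> c x x' y y' [cy ty] [cy' ty']; split; last by rewrite !linearP ty ty'.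
  by apply: (submoduleD sc) => //; apply: submoduleZ.
- by move=> x; have [y cy yx] := ts (k x); exists y.
have [|||||c [f [-> fdeg fco fl]]] := @extend _ P (total P) (fun b => b = 1) b (a - 1) a l
    (mult_closed_one R).
- exact: Pproj.
- by move=> x; case: (lP x).
- by move=> x; have [cy ty] := lP (diff P b (b - 1) x); apply: ti; rewrite ?ty.
- by move=> i ai; exists 1 => //; apply: Pa; lia.
- by move=> i ai; apply: Pa; lia.
by exists f; split=> // x; rewrite fl scale1r.
Qed.

(** The lift of [phi] to [P] has degree 0, so it is a scalar up to homotopy, and [theta] kills the
    homotopy term on cycles. *)
Lemma homology_homothety_surj (phi : {linear C -> C}) : exists r : R, forall c, phi c = r *: c.
Proof.
have [t0 ti ts _] := thetaP.
have [|f [fdeg fco fP]] := homology_lift (b := a) (k := phi \o theta \o inj P (a - 1)).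
  move=> x; change (phi (theta (inj P (a - 1) (diff P a (a - 1) x))) = 0).
  rewrite t0 ?linear0 // -(@inj_diff _ P a) ?subrK //.
  by exists (inj P a x) => //; rewrite subrK; apply: inj_gr.
rewrite subrr in fdeg fco.
have [Hs _] := Phom; have [r [h [_ hdeg fh]]] := Hs _ _ fdeg fco.
exists r => c; have [y cy <-] := ts c; have [x cx ->] := gcycleP cy.
have fx : theta (f (a - 1) x) = phi (theta (inj P (a - 1) x)) by case: (fP x).
rewrite -fx fh (linearD theta) (linearZ_LR theta) /dhom (cx : diff P _ _ x = 0) linear0.
rewrite scaler0 subr0 (t0 (gd _)) ?addr0 //; exists (h (a - 1) x) => //.
Qed.

(** The lift of [k] has nonzero degree, so it is null-homotopic, and [theta] composed with the
    homotopy is [l] up to sign. *)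
Lemma homology_ext (j0 j j2 : int) (k : {linear P j -> C}) : j0 + 1 = j -> j + 1 = j2 ->
  a - 1 < j -> (forall x, k (diff P j2 j x) = 0) ->
  exists l : {linear P j0 -> C}, forall x, k x = l (diff P j j0 x).
Proof.
move=> e0 e2 aj kd; have {}e0 : j0 = j2 - 1 - 1 by lia.
have {}e2 : j = j2 - 1 by lia.
subst j j0; have [t0 ti ts _] := thetaP.
have [f [fdeg fco fP]] := homology_lift kd.
have [Hs _] := Phom; have [r [h [r0 hdeg fh]]] := Hs _ _ fdeg fco.
exists ((- sg R (a - 1 - (j2 - 1) + 1)) \*: (theta \o h (j2 - 1 - 1))) => x.
have [_ <-] := fP x; rewrite fh r0; last by lia.
rewrite scale0r add0r /dhom (linearB theta) (linearZ_LR theta) (t0 (gd _)) ?sub0r -?scaleNr //.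
exists (h (j2 - 1) x) => //; have := hdeg (j2 - 1) x; congr (gr _ _); ring.
Qed.

End HomologyModule.

Section StalkResolution.
Variables (R : comNzRingType) (X : complex R) (s : int) (C : lmodType R).
Variable theta : {linear total X -> C}.
Hypothesis thetaP : presents (- s) theta.

Definition augmentation_fun n (x : shift X s n) : stalk C n :=
  stalk_elt n (theta (inj X (n - s) x)).

Fact augmentation_linear n : linear (@augmentation_fun n).
Proof.
move=> a x y; rewrite /augmentation_fun -linearP; congr (stalk_elt n _).
by rewrite -linearP; congr (theta _); rewrite -linearP.
Qed.

Fact augmentation_diff i j (x : shift X s i) :
  linear_map (@augmentation_linear j) (diff (shift X s) i j x) =
  diff (stalk C) i j (linear_map (@augmentation_linear i) x).
Proof.
have [t0 _ _ _] := thetaP; change (stalk_elt j (theta (inj X (j - s)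
  ((-1) ^+ `|s|%N *: diff X (i - s) (j - s) x))) = 0).
have [j0|/stalk_val0//] := eqVneq j 0.
suff t : theta (inj X (j - s) (diff X (i - s) (j - s) x)) = 0.
  by rewrite (linearZ_LR (inj X (j - s))) (linearZ_LR theta) t scaler0 linear0.
have [e|ne] := eqVneq i (j + 1); last by rewrite diff_shape ?linear0 //; lia.
rewrite -(@inj_diff _ X (i - s)); last by rewrite e; ring.
apply: t0; exists (inj X (i - s) x) => //.
have -> : - s + 1 = i - s by rewrite e j0; ring.
exact: inj_gr.
Qed.

Definition augmentation : chain_map (shift X s) (stalk C) :=
  ChainMap augmentation_diff.

Lemma augmentation_quasi_iso : quasi_iso augmentation.
Proof.
have [t0 ti ts tk] := thetaP; move=> n.
have [n0|nn0] := eqVneq n 0; last first.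
  split=> [x /shift_cycle cx _|y cy].
    by apply/shift_boundary; have := tk (n - s) ltac:(lia) _ cx; rewrite scale1r.
  exists 0; first exact: linear0.
  by exists 0; apply: stalk_val0.
split=> [x /shift_cycle cx [y xy]|y _].
  apply/shift_boundary; have ns : n - s = - s by rewrite n0 add0r.
  rewrite [X in gboundary X]ns; rewrite [X in gcycle X]ns in cx; apply: ti cx _.
  by rewrite -[LHS](stalk_eltK _ n0); exact: (congr1 (@stalk_val R C n) xy).
have [z cz zy] := ts (stalk_val y).
have ns : - s = n - s by rewrite n0 add0r.
rewrite ns in cz; have [x cx zx] := gcycleP cz.
exists x; first by apply/shift_cycle/gcycle_inj.
exists 0; rewrite linear0; apply/eqP; rewrite subr_eq0; apply/eqP/val_inj.
rewrite -[RHS]zy zx; exact: stalk_eltK.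
Qed.

End StalkResolution.

Section SemidualizingHomology.
Variables (R : idomainType) (P : complex R) (N a : int).
Hypothesis Pproj : forall i, projective (P i).
Hypothesis PN : forall n, n < N -> forall x : P n, x = 0.
Hypothesis fgP : forall n, homology_fg (total P) n.
Hypothesis Phom : hom_trivial P.
Hypothesis Pa : forall n, n != a - 1 -> kills (total P) 1 n.
Variables (C : lmodType R) (theta : {linear total P -> C}).
Hypothesis thetaP : presents (a - 1) theta.

Lemma homology_ext_vanishes n : (1 <= n)%N -> ext_vanishes n C C.
Proof.
move=> n1; pose s := 1 - a.
have thetaS : presents (- s) theta by have -> : - s = a - 1 by rewrite /s; ring.
exists (shift P s); split; first split.
- by move=> i; apply: Pproj.
- by exists (N + s) => i iN x; apply: (PN (n := i - s)); lia.
- by exists (augmentation thetaS); apply: augmentation_quasi_iso.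
move=> F cF.
pose k : {linear P (n%:Z - s) -> C} := @stalk_val R C 0 \o homc_at F n%:Z 0.
have [|||x|l lk] := homology_ext Pproj Phom Pa thetaP (j0 := n%:Z - 1 - s)
    (j := n%:Z - s) (j2 := n%:Z + 1 - s) (k := k).
- by ring.
- by ring.
- by rewrite /s; lia.
- have := congr1 (fun H : homc_obj (shift P s) (stalk C) (- n%:Z - 1) =>
    homc_at H (n%:Z + 1) 0 (x : shift P s (n%:Z + 1))) cF.
  rewrite [LHS]homc_diffE ?subrK // => e0.
  have {}e0 : 0 - (-1) ^+ `|- n%:Z|%N *: homc_at F (n%:Z + 1 - 1) 0
    (diff (shift P s) (n%:Z + 1) (n%:Z + 1 - 1) x) = 0 by exact: e0.
  move/eqP: e0; rewrite sub0r oppr_eq0 => /eqP/signr_scale_eq0 e0.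
  have aux i : i = n%:Z + 1 - 1 -> homc_at F i 0 (diff (shift P s) (n%:Z + 1) i x) = 0.
    by move=> ->.
  have := aux n%:Z; rewrite addrK => /(_ erefl)/(congr1 (@stalk_val R C 0)) => e1.
  have {}e1 : k ((-1) ^+ `|s|%N *: diff P (n%:Z + 1 - s) (n%:Z - s) x) = 0 by exact: e1.
  by move: e1; rewrite linearZ => /signr_scale_eq0.
(* [e] is the sign of the differential of Hom in degree [- n + 1] and [d] that of the shift; both
   are their own inverses. *)
set e := (-1) ^+ `|(- n%:Z + 1)%R|%N : R; set d := (-1) ^+ `|s|%N : R.
pose G0 i j := @stalk_elt R C j \o ((- (e * d)) \*: (l \o id_family (shift P s) i (n%:Z - 1))).
pose G : hom_family (shift P s) (stalk C) := fun i j => to_hom (G0 i j).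
have G_in : G \in homc_pred (- n%:Z + 1).
  apply/asboolP => i j ij; apply: homP => x.
  have [j0|j0] := eqVneq j 0; last by apply: stalk_val0.
  change (stalk_elt j (- (e * d) *: l (id_family (shift P s) i (n%:Z - 1) x)) = 0).
  rewrite id_family_off ?hom0E ?linear0 ?scaler0 ?linear0 //.
  by apply: contraNneq ij => ->; rewrite j0; apply/eqP; ring.
exists (MkHomc G_in); apply: homc_ext => i j x; rewrite [RHS]homc_diffE //.
have [j0|j0] := eqVneq j 0; last first.
  by transitivity (0 : stalk C j); [|apply/esym]; apply: stalk_val0.
subst j.
change (homc_at F i 0 x = 0 - e *: stalk_elt 0 (- (e * d) *:
  l (id_family (shift P s) (i - 1) (n%:Z - 1) (diff (shift P s) i (i - 1) x)))).
have -> : id_family (shift P s) (i - 1) (n%:Z - 1) (diff (shift P s) i (i - 1) x) =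
    diff (shift P s) i (n%:Z - 1) x.
  have [e1|ne] := eqVneq (i - 1) (n%:Z - 1); first by rewrite id_family_diff.
  by rewrite id_family_off // hom0E diff_shape //; lia.
have [e1|ne] := eqVneq i n%:Z; last first.
  have -> : diff (shift P s) i (n%:Z - 1) x = 0 by apply: diff_shape; lia.
  have -> : homc_at F i 0 = 0 by apply: homc_at0; lia.
  by rewrite hom0E !(linear0, scaler0, addr0).
subst i; apply: val_inj.
change (k x = 0 - e *: (- (e * d) *: l (d *: diff P (n%:Z - s) (n%:Z - 1 - s) x))).
rewrite (linearZ_LR l) -lk sub0r scaleNr scalerN opprK !scalerA.
have -> : e * (e * d) * d = (e ^+ 2) * (d ^+ 2) by ring.
by rewrite !sqrr_sign mul1r scale1r.
Qed.

Lemma homology_semidualizing : semidualizing_module C.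
Proof.
split; [exact: homology_module_fg thetaP| |exact: homology_ext_vanishes].
apply: inj_surj_bij => [r r' rr|phi].
  apply/eqP; rewrite -subr_eq0; apply/eqP.
  apply: (homology_homothety_inj Pproj PN Phom Pa thetaP) => c.
  have := congr1 (fun f : HomMod C C => f c) rr.
  by rewrite /= => e; rewrite scalerBl; apply/eqP; rewrite subr_eq0; apply/eqP.
have [r rP] := homology_homothety_surj Pproj Phom Pa thetaP phi.
by exists r; apply: homP => c; rewrite rP.
Qed.

End SemidualizingHomology.

(** * Linking complexes with the same homology module *)

Section Pullback.
Variables (R : comNzRingType) (X Y : complex R) (n : int) (C : lmodType R).
Variables (thX : {linear total X -> C}) (thY : {linear total Y -> C}).
Hypotheses (pX : presents n thX) (pY : presents n thY).

(* The fibre product, over [C] in degree [n], of the truncations of [X] and [Y]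
   in degrees [>= n]. *)
Definition pullback_pred k (u : X k * Y k) : Prop :=
  (k < n -> u = 0) /\ (k = n -> [/\ cycle u.1, cycle u.2
    & thX (inj X k u.1) = thY (inj Y k u.2)]).

Fact pullback_submodule k : submodule (@pullback_pred k).
Proof.
split=> [|a u v [u0 un] [v0 vn]].
  by split=> // _; split; rewrite /cycle ?linear0.
split=> [kn|kn]; first by rewrite u0 // v0 // scaler0 addr0.
have [u1 u2 u12] := un kn; have [v1 v2 v12] := vn kn; split=> /=.
- by rewrite /cycle linearP u1 v1 scaler0 addr0.
- by rewrite /cycle linearP u2 v2 scaler0 addr0.
change (thX (inj X k (a *: u.1 + v.1)) = thY (inj Y k (a *: u.2 + v.2))).
rewrite (linearP (inj X k)) (linearP (inj Y k)) (linearP thX) (linearP thY).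
by rewrite u12 v12.
Qed.

Definition pullback_obj k : lmodType R := submodule_type (@pullback_submodule k).

Definition pullback_diff_pair i j (w : pullback_obj i) : X j * Y j :=
  (diff X i j (submodule_incl w).1, diff Y i j (submodule_incl w).2).

Fact pullback_diff_in i j (w : pullback_obj i) : pullback_pred (pullback_diff_pair j w).
Proof.
rewrite /pullback_diff_pair; have [w0 wn] := submodule_inclP w.
case: (submodule_incl w) w0 wn => x y /= w0 wn.
have [e|ne] := eqVneq i (j + 1); last first.
  by rewrite !diff_shape //; exact: submodule0 (pullback_submodule j).
subst i; split=> [jn|jn].
  have [lt|eqn] : j + 1 < n \/ j + 1 = n by lia.
    by have [-> ->] := w0 lt; rewrite !linear0.
  have [cx cy _] := wn eqn; congr pair.
    by move: cx; rewrite /cycle addrK.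
  by move: cy; rewrite /cycle addrK.
have [x0 _ _ _] := pX; have [y0 _ _ _] := pY.
split; [exact: diff_diff|exact: diff_diff|].
change (thX (inj X j (diff X (j + 1) j x)) = thY (inj Y j (diff Y (j + 1) j y))).
rewrite -!(@inj_diff _ _ (j + 1)) // x0 ?y0 // -jn.
  by exists (inj Y (j + 1) y) => //; apply: inj_gr.
by exists (inj X (j + 1) x) => //; apply: inj_gr.
Qed.

Definition pullback_diff_fun i j (w : pullback_obj i) : pullback_obj j :=
  submodule_elt (pullback_submodule j) (pullback_diff_in j w).

Fact pullback_diff_linear i j : linear (@pullback_diff_fun i j).
Proof.
move=> a u v; apply: submodule_incl_inj; rewrite linearP /=.
by congr pair; rewrite /= linearP.
Qed.

Fact pullback_diff_shape i j : i != j + 1 ->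
  forall w, linear_map (@pullback_diff_linear i j) w = 0.
Proof.
move=> ij w; apply: submodule_incl_inj; rewrite linear0 /=.
by congr pair; rewrite /= diff_shape.
Qed.

Fact pullback_diff_diff i j k w : linear_map (@pullback_diff_linear j k)
  (linear_map (@pullback_diff_linear i j) w) = 0.
Proof.
by apply: submodule_incl_inj; rewrite linear0 /=; congr pair; rewrite /= diff_diff.
Qed.

Definition pullback : complex R := Complex pullback_diff_shape pullback_diff_diff.

Definition pullback_fst_fun k (w : pullback k) : X k := (submodule_incl w).1.
Definition pullback_snd_fun k (w : pullback k) : Y k := (submodule_incl w).2.
Fact pullback_fst_linear k : linear (@pullback_fst_fun k). Proof. by []. Qed.
Fact pullback_snd_linear k : linear (@pullback_snd_fun k). Proof. by []. Qed.

Definition pullback_fst : chain_map pullback X :=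
  @ChainMap R pullback X (fun k => linear_map (@pullback_fst_linear k)) (fun i j x => erefl).
Definition pullback_snd : chain_map pullback Y :=
  @ChainMap R pullback Y (fun k => linear_map (@pullback_snd_linear k)) (fun i j x => erefl).

(** In degree [n] the two components have the same image in [C], so one is a boundary when the other
    is; above [n] both homologies vanish. Preimages live in degrees above [n], where the fibre
    product imposes no condition. *)
Lemma pullback_boundary k (w : pullback k) : cycle w ->
  boundary (submodule_incl w).1 \/ boundary (submodule_incl w).2 -> boundary w.
Proof.
have [x0 xi _ xk] := pX; have [y0 yi _ yk] := pY.
move=> /(congr1 (@submodule_incl _ _ _ _))/(congr1 (fun u : X _ * Y _ => (u.1, u.2)))[cx cy].
have [w0 wn] := submodule_inclP w => bw.
have [kn|nk] := ltP k n.
  by exists 0; rewrite linear0; apply: submodule_incl_inj; rewrite w0 // linear0.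
have [b1 b2] : boundary (submodule_incl w).1 /\ boundary (submodule_incl w).2.
  have [kn|kn] := eqVneq k n; last first.
    split; apply/gboundary_inj; rewrite -[inj _ _ _]scale1r;
      [apply: xk|apply: yk] => //; exact/gcycle_inj.
  subst k; have [_ _ th] := wn erefl.
  case: bw => /gboundary_inj b; split; apply/gboundary_inj => //.
    by apply: yi; [apply/gcycle_inj|rewrite -th x0].
  by apply: xi; [apply/gcycle_inj|rewrite th y0].
have [x1 e1] := b1; have [y1 e2] := b2.
have xy1 : pullback_pred (x1, y1) by split; lia.
exists (submodule_elt (pullback_submodule (k + 1)) xy1); apply: submodule_incl_inj.
by rewrite [LHS]surjective_pairing /= /pullback_diff_pair /= -e1 -e2.
Qed.

Lemma pullback_lift k (x : X k) (y : Y k) : n <= k -> cycle x -> cycle y ->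
  (k = n -> thX (inj X k x) = thY (inj Y k y)) ->
  exists w : pullback k, cycle w /\ submodule_incl w = (x, y).
Proof.
move=> nk cx cy th.
have xy : pullback_pred (x, y) by split=> [kn|kn]; [lia|split=> //; apply: th].
exists (submodule_elt (pullback_submodule k) xy); split=> //.
apply: submodule_incl_inj; rewrite linear0; congr pair; [exact: cx|exact: cy].
Qed.

Lemma pullback_fst_quasi_iso : quasi_iso pullback_fst.
Proof.
have [x0 xi xs xk] := pX; have [y0 yi ys yk] := pY.
move=> k; split=> [w cw bw|x cx]; first by apply: pullback_boundary => //; left.
have [kn|nk] := ltP k n.
  exists 0; first exact: linear0.
  rewrite linear0 sub0r; apply: (submoduleN (boundary_submodule X k)).
  apply/gboundary_inj; rewrite -[inj _ _ _]scale1r; apply: xk; last exact/gcycle_inj.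
  by rewrite lt_eqF.
have [y cy th] : exists2 y : Y k, cycle y & k = n -> thX (inj X k x) = thY (inj Y k y).
  have [kn|kn] := eqVneq k n; last first.
    by exists 0; [exact: linear0|move=> e; rewrite e eqxx in kn].
  subst k; have [z /gcycleP[y cy ->] zx] := ys (thX (inj X n x)).
  by exists y.
have [w [cw wE]] := pullback_lift nk cx cy th; exists w => //.
by rewrite /= /pullback_fst_fun wE subrr; apply: submodule0; apply: boundary_submodule.
Qed.

Lemma pullback_snd_quasi_iso : quasi_iso pullback_snd.
Proof.
have [x0 xi xs xk] := pX; have [y0 yi ys yk] := pY.
move=> k; split=> [w cw bw|y cy]; first by apply: pullback_boundary => //; right.
have [kn|nk] := ltP k n.
  exists 0; first exact: linear0.
  rewrite linear0 sub0r; apply: (submoduleN (boundary_submodule Y k)).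
  apply/gboundary_inj; rewrite -[inj _ _ _]scale1r; apply: yk; last exact/gcycle_inj.
  by rewrite lt_eqF.
have [x cx th] : exists2 x : X k, cycle x & k = n -> thX (inj X k x) = thY (inj Y k y).
  have [kn|kn] := eqVneq k n; last first.
    by exists 0; [exact: linear0|move=> e; rewrite e eqxx in kn].
  subst k; have [z /gcycleP[x cx ->] zx] := xs (thY (inj Y n y)).
  by exists x.
have [w [cw wE]] := pullback_lift nk cx cy th; exists w => //.
by rewrite /= /pullback_snd_fun wE subrr; apply: submodule0; apply: boundary_submodule.
Qed.

End Pullback.

Section DerivedIso.
Variable R : comNzRingType.

(** Both roofs are composed over [W] itself. The situation is symmetric in [f] and [g], so this
    yields both composites. *)
Lemma roof_comp_inverse (X Y W : complex R) (f : chain_map W X) (g : chain_map W Y)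
    (fq : quasi_iso f) (gq : quasi_iso g) :
  roof_comp (Roof fq g) (Roof gq f) (roof_of (chain_id X)).
Proof.
exists W, (chain_id W), (chain_id W), (quasi_iso_comp fq (chain_id_qis W)).
split; first exact: homotopic_refl.
exists W, (chain_id W), f; split.
- exact: (quasi_iso_comp (quasi_iso_comp fq (chain_id_qis W)) (chain_id_qis W)).
- exact: homotopic_eq.
exact: homotopic_eq.
Qed.

Lemma derived_iso_roof (X Y W : complex R) (f : chain_map W X) (g : chain_map W Y) :
  quasi_iso f -> quasi_iso g -> exists a : roof X Y, derived_iso a.
Proof.
move=> fq gq; exists (Roof fq g), (Roof gq f).
by split; apply: roof_comp_inverse.
Qed.

Fact shift_map_diff (X Y : complex R) (f : chain_map X Y) (s : int) i j (x : shift X s i) :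
  f (j - s) (diff (shift X s) i j x) = diff (shift Y s) i j (f (i - s) x).
Proof. by rewrite /= linearZ /= (cmap_diff f). Qed.

Definition shift_map (X Y : complex R) (f : chain_map X Y) (s : int) :
    chain_map (shift X s) (shift Y s) :=
  @ChainMap R (shift X s) (shift Y s) (fun i => f (i - s)) (@shift_map_diff X Y f s).

Lemma shift_map_quasi_iso (X Y : complex R) (f : chain_map X Y) (s : int) :
  quasi_iso f -> quasi_iso (shift_map f s).
Proof.
move=> fq n; have [fi fs] := fq (n - s); split=> [x|y].
  move=> /shift_cycle/gcycle_inj cx /shift_boundary/gboundary_inj bx.
  exact/shift_boundary/gboundary_inj/fi.
move=> /shift_cycle/gcycle_inj cy; have [x cx xy] := fs y cy.
exists x; first exact/shift_cycle/gcycle_inj.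
exact/shift_boundary/gboundary_inj.
Qed.

Lemma presents_comp (X : complex R) n (C D : lmodType R) (theta : {linear total X -> C})
    (phi : {linear C -> D}) : bijective phi -> presents n theta -> presents n (phi \o theta).
Proof.
move=> [psi phiK psiK] [t0 ti ts tk]; split=> //= [y by_|y cy|d].
- by rewrite t0 // linear0.
- by rewrite -(linear0 phi) => /(can_inj phiK); apply: ti.
by have [y cy yd] := ts (psi d); exists y => //; rewrite yd psiK.
Qed.

Lemma presents_shift_isomorphic (K K' P P' : complex R) (f : chain_map P K)
    (f' : chain_map P' K') n n' (C : lmodType R) (theta : {linear total P -> C})
    (theta' : {linear total P' -> C}) :
  quasi_iso f -> quasi_iso f' -> presents n theta -> presents n' theta' ->
  shift_isomorphic K K'.
Proof.
move=> fq fq' pn pn'; have [th] := presents_shift (n - n') pn'.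
rewrite subrKC => pth; exists (n - n').
apply: (derived_iso_roof (W := pullback pn pth)).
  exact: quasi_iso_comp fq (pullback_fst_quasi_iso pn pth).
exact: quasi_iso_comp (shift_map_quasi_iso _ fq') (pullback_snd_quasi_iso pn pth).
Qed.

End DerivedIso.

(** * Regular sequences and chains of primes in localizations *)

Lemma prime_idealr_pack (S : comNzRingType) (p : S -> Prop) : prime_ideal p ->
  exists q : prime_idealr S, forall x, x \in q <-> p x.
Proof.
move=> [sp p1 pM]; pose P : {pred S} := fun x => `[< p x >].
have Pi : idealr_closed P.
  split; first by apply/asboolP; exact: ideal0.
    by apply/negP => /asboolP.
  by move=> a u v /asboolP pu /asboolP pv; apply/asboolP; apply: idealD => //; apply: ideal_mull.
have PM : prime_idealr_closed P.
  move=> u v /asboolP/pM[pu|pv]; apply/orP; first by left; apply/asboolP.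
  by right; apply/asboolP.
pose q : prime_idealr S := HB.pack (P : S -> bool) (isIdealr.Build S P Pi)
  (isPrimeIdealrClosed.Build S P PM).
by exists q => x; split=> [/asboolP|px]; last exact/asboolP.
Qed.

(* Primes containing a sequence which is regular at [m] have height at least its
   length: [y] is regular modulo [I] at [c 0], so some prime over [I] inside
   [c 0] avoids [y]. *)
Lemma regular_chain (R : comNzRingType) (m q : R -> Prop) (ys : seq R) (I : R -> Prop) :
  noetherian R -> prime_ideal m -> prime_ideal q -> (forall x, q x -> m x) ->
  ideal I -> (forall x, I x -> q x) -> (forall y, y \in ys -> q y) -> regular_at m I ys ->
  exists c : nat -> R -> Prop, [/\ c (size ys) = q,
    forall k, (k <= size ys)%N -> [/\ prime_ideal (c k), forall x, I x -> c k x
      & forall x, c k x -> m x]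
    & forall k, (k < size ys)%N -> (forall x, c k x -> c k.+1 x) /\
        exists2 x, c k.+1 x & ~ c k x].
Proof.
move=> noethR pm pq qm; elim: ys I => [|y ys IHys] I sI Iq ysq /=.
  by exists (fun=> q); split.
have [sq _ _] := pq; have [sm m1 mM] := pm; move=> [yreg reg].
have [||z zys|c [cq cP cS]] := IHys (adjoin I y) _ _ _ reg.
- exact: adjoin_ideal.
- move=> x [a ax]; rewrite -[x](subrK (a * y)); apply: idealD; [by []|exact: Iq|].
  by apply: ideal_mull => //; apply: ysq; rewrite inE eqxx.
- by apply: ysq; rewrite inE zys orbT.
have [[s0 c01 c0M] Ic0 c0m] := cP 0%N isT.
have Ic0' x : I x -> c 0%N x by move=> Ix; apply: Ic0; exists 0; rewrite mul0r subr0.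
have c0y : c 0%N y by apply: Ic0; exists 1; rewrite mul1r subrr; apply: ideal0.
have cancel u n : I (u * y ^+ n) -> exists2 t, ~ m t & I (t * u).
  elim: n u => [|n IHn] u; first by rewrite expr0 mulr1; exists 1; rewrite ?mul1r.
  rewrite exprS mulrA => /IHn[t nt tu]; have [|t' nt' t'u] := yreg (t * u).
    by move: tu; congr I; ring.
  by exists (t' * t); [move=> /mM[]|rewrite -mulrA].
(* A prime avoiding [S] lies in [c 0] and misses [y]. [S] does not meet [I]: by regularity, if
   [u * y ^+ n] is in [I], then so is some [t * u] with [t] outside [m], which forces [u] into
   [c 0]. *)
pose S x := exists u n, ~ c 0%N u /\ x = u * y ^+ n.
have [||p [pp Ip Sp]] := exists_prime_ideal noethR sI (S := S).
- split; first by exists 1, 0%N; rewrite expr0 mulr1.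
  move=> _ _ [u [k [nu ->]]] [v [l [nv ->]]]; exists (u * v), (k + l)%N.
  by split; [move=> /c0M[]|rewrite exprD; ring].
- move=> _ [u [k [nu ->]]] /cancel[t nt /Ic0'/c0M[/c0m//|//]].
have pc x : p x -> c 0%N x.
  move=> px; apply: contrapT => nx; apply: (Sp x) px.
  by exists x, 0%N; rewrite expr0 mulr1.
exists (fun k => if k is k'.+1 then c k' else p); split=> // [[|k] kys|[|k] kys].
- by split=> // x /pc/c0m.
- have [pk Ik mk] := cP k kys; split=> // x Ix.
  by apply: Ik; exists 0; rewrite mul0r subr0.
- split=> //; exists y => //; apply: Sp; exists 1, 1%N; by rewrite mul1r expr1.
exact: cS.
Qed.

Section FractionIdentities.
Variables (F : fieldType) (a b c d x y : F).

Lemma frac_subM : b != 0 -> d != 0 -> y != 0 ->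
  a / b - c / d * (x / y) = (a * (d * y) - c * x * b) / (b * (d * y)).
Proof. by move=> b0 d0 y0; field; rewrite b0 d0 y0. Qed.

Lemma frac_subM_cancel : b != 0 -> d != 0 -> y != 0 ->
  a / b - c * y / (d * b) * (x / y) = (d * a - c * x) / (d * b).
Proof. by move=> b0 d0 y0; field; rewrite b0 d0 y0. Qed.

Lemma frac_addM : b != 0 -> d != 0 -> y != 0 ->
  a / b * (x / y) + c / d = (a * x * d + c * (b * y)) / (b * y * d).
Proof. by move=> b0 d0 y0; field; rewrite b0 d0 y0. Qed.

End FractionIdentities.

Section LocalRing.
Variables (R : idomainType) (m : prime_idealr R).
Local Notation S := (localization m).

Lemma localization_frac (a s : R) : s \notin m ->
  exists z : S, loc_val z = tofrac a / tofrac s.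
Proof.
move=> sm; have zin : tofrac a / tofrac s \in localization_pred m.
  by apply/asboolP; exists a, s.
by exists (MkLocalization zin).
Qed.

Lemma localization_num_den : exists num den : S -> R, forall z, den z \notin m /\
  loc_val z = tofrac (num z) / tofrac (den z).
Proof.
have /choice[f fP] : forall z : S, exists u : R * R, u.2 \notin m /\
    loc_val z = tofrac u.1 / tofrac u.2.
  by case=> z zin /=; have /asboolP[a [s [sm ->]]] := zin; exists (a, s).
by exists (fun z => (f z).1), (fun z => (f z).2).
Qed.

Lemma notin_mul s t : s \notin m -> t \notin m -> s * t \notin m.
Proof. by move=> sm tm; rewrite prime_idealrM negb_or sm. Qed.

Lemma notin_neq0 s : s \notin m -> tofrac s != 0.
Proof. by rewrite tofrac_eq0; apply: contraNneq => ->; apply: idealr0. Qed.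

Lemma frac_eq (a b s t : R) : s \notin m -> t \notin m ->
  tofrac a / tofrac s = tofrac b / tofrac t -> a * t = b * s.
Proof.
move=> /notin_neq0 s0 /notin_neq0 t0 /eqP; rewrite eqr_div // -!tofracM tofrac_eq.
exact: eqP.
Qed.

(* [I] and the span of [s] have the same localization. *)
Definition same_at (I : R -> Prop) (s : seq S^o) : Prop :=
  forall (z : S) (a b : R), b \notin m -> loc_val z = tofrac a / tofrac b ->
    span_mod (fun y => y = 0) s z <-> exists2 t, t \notin m & I (t * a).

Lemma same_at_nil : same_at (fun r => r = 0) [::].
Proof.
move=> z a b bm za; have b0 := notin_neq0 bm; split=> /= [z0|[t tm /eqP]].
  exists 1; first by rewrite idealr1.
  apply/eqP; rewrite mul1r -tofrac_eq0 -(mulfVK b0 (tofrac a)) -za z0.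
  by rewrite mul0r.
rewrite mulf_eq0 => /orP[/eqP t0|/eqP a0]; first by rewrite t0 idealr0 in tm.
by apply: val_inj; rewrite /= za a0 tofrac0 mul0r.
Qed.

Variables num den : S -> R.
Hypothesis numP : forall z, den z \notin m /\ loc_val z = tofrac (num z) / tofrac (den z).

Lemma same_at_cons (I : R -> Prop) (s : seq S^o) (x : S) :
  same_at I s -> same_at (adjoin I (num x)) ((x : S^o) :: s).
Proof.
move=> Is z a b bm za; have [dm xE] := numP x.
split=> [[c zc]|[t tm [c tc]]].
  have [cm cE] := numP c.
  have [||t tm It] := proj1 (Is _ (a * (den c * den x) - num c * num x * b)
      (b * (den c * den x)) _ _) zc.
  - by apply: notin_mul => //; apply: notin_mul.
  - rewrite tofracB !tofracM.
    change (loc_val z - loc_val c * loc_val x = (tofrac a * (tofrac (den c) * tofrac (den x)) -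
      tofrac (num c) * tofrac (num x) * tofrac b) / (tofrac b * (tofrac (den c) * tofrac (den x)))).
    by rewrite za cE xE frac_subM // notin_neq0.
  exists (t * (den c * den x)); first by apply: notin_mul => //; apply: notin_mul.
  by exists (t * num c * b); move: It; congr I; ring.
(* With this [c'] the difference [z - c' x] is [(t a - c num x) / (t b)], whose numerator is in
   [I]. *)
have [c' c'E] := localization_frac (c * den x) (notin_mul tm bm).
exists c'; apply/(Is _ (t * a - c * num x) (t * b)).
- exact: notin_mul.
- change (loc_val z - loc_val c' * loc_val x = tofrac (t * a - c * num x) / tofrac (t * b)).
  rewrite tofracB !tofracM za c'E xE !tofracM.
  by rewrite frac_subM_cancel // notin_neq0.
by exists 1; rewrite ?idealr1 // mul1r.
Qed.

(** [catrev], because the recursion of [regular_at] adjoins each element in front of the earlier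
    ones. *)
Lemma localization_regular_at (xs pre : seq S^o) (I : R -> Prop) : same_at I pre ->
  (forall i (y : S), (i < size xs)%N ->
    span_mod (fun y => y = 0) (catrev (take i xs) pre) ((xs`_i : S) * y : S) ->
    span_mod (fun y => y = 0) (catrev (take i xs) pre) y) ->
  regular_at (fun r => r \in m) I (map num xs).
Proof.
elim: xs pre I => [|x xs IHxs] pre I Ipre reg //=; split=> [r Ir|].
  have [dm xE] := numP x.
  have [z zE] := @localization_frac r 1 (negbT (idealr1 m)).
  have [|t tm It] := proj1 (Ipre z r 1 (negbT (idealr1 m)) zE).
    apply: (reg 0%N z isT) => /=; apply/(Ipre _ (num x * r) (den x)) => //.
      change (loc_val x * loc_val z = tofrac (num x * r) / tofrac (den x)).
      by rewrite xE zE tofrac1 divr1 tofracM mulrAC.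
    by exists 1; rewrite ?idealr1 // mul1r.
  by exists t => //; apply/negP.
apply: (IHxs ((x : S^o) :: pre)); first exact: same_at_cons.
by move=> i y ixs; apply: (reg i.+1 y).
Qed.

(** The extension of [p] to the localization, described by numerators. Denominators lie outside [m],
    hence outside [p], so membership is the same for every way of writing the fraction. *)
Lemma num_prime (p : R -> Prop) : prime_ideal p -> (forall x, p x -> x \in m) ->
  prime_ideal (fun z : S => p (num z)) /\
  forall (z : S) a b, b \notin m -> loc_val z = tofrac a / tofrac b -> p (num z) <-> p a.
Proof.
move=> [sp p1 pM] pm.
have rep (z : S) a b : b \notin m -> loc_val z = tofrac a / tofrac b -> p (num z) <-> p a.
  move=> bm za; have [dm zE] := numP z.
  have e : num z * b = a * den z by apply: frac_eq; rewrite // -zE.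
  split=> pz.
    have : p (a * den z) by rewrite -e; apply: ideal_mulr.
    by move=> /pM[//|/pm]; rewrite (negPf dm).
  have : p (num z * b) by rewrite e; apply: ideal_mulr.
  by move=> /pM[//|/pm]; rewrite (negPf bm).
have r1 : (1 : R) \notin m by rewrite idealr1.
split=> //; split; first split.
- apply/(rep 0 0 1) => //; last exact: ideal0.
  by change (0 = tofrac 0 / tofrac 1 :> {fraction R}); rewrite tofrac0 mul0r.
- move=> a x y px py; have [am aE] := numP a; have [xm xE] := numP x; have [ym yE] := numP y.
  apply/(rep _ (num a * num x * den y + num y * (den a * den x)) (den a * den x * den y)).
  + by apply: notin_mul => //; apply: notin_mul.
  + change (loc_val a * loc_val x + loc_val y = tofrac (num a * num x * den y +
      num y * (den a * den x)) / tofrac (den a * den x * den y)).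
    rewrite aE xE yE tofracD !tofracM.
    by rewrite frac_addM // notin_neq0.
  by apply: idealD => //; [apply: ideal_mulr => //; apply: ideal_mull|apply: ideal_mulr].
- move=> pn1; apply: p1; apply/(rep 1 1 1) => //.
  by change (1 = tofrac 1 / tofrac 1 :> {fraction R}); rewrite tofrac1 divr1.
move=> x y; have [xm xE] := numP x; have [ym yE] := numP y.
have e : loc_val (x * y : S) = tofrac (num x * num y) / tofrac (den x * den y).
  change (loc_val x * loc_val y = tofrac (num x * num y) / tofrac (den x * den y)).
  by rewrite xE yE !tofracM mulf_div.
by move=> /(rep _ _ _ (notin_mul xm ym) e)/pM.
Qed.

Lemma localization_chain n (c : nat -> R -> Prop) :
  (forall k, (k <= n)%N -> prime_ideal (c k) /\ forall x, c k x -> x \in m) ->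
  (forall k, (k < n)%N -> (forall x, c k x -> c k.+1 x) /\ exists2 x, c k.+1 x & ~ c k x) ->
  prime_chain S n.
Proof.
move=> cP cS.
have /choice[p pP] : forall k : 'I_n.+1, exists p : prime_idealr S,
    forall z, z \in p <-> c k (num z).
  move=> k; have [pk km] := cP k (ltnSE (ltn_ord k)).
  by have [pz _] := num_prime pk km; apply: prime_idealr_pack.
have mono i j x : (i <= j)%N -> (j <= n)%N -> c i x -> c j x.
  move=> /subnKC<-; elim: (j - i)%N => [|k IHk]; rewrite ?addn0 // addnS => kn cx.
  by have [cS' _] := cS _ kn; apply/cS'/IHk => //; apply: ltnW.
exists p => i j ij; have jn := ltnSE (ltn_ord j).
split; first by move=> z /pP ci; apply/pP; apply: mono ci => //; apply: ltnW.
have [_ [x cx nx]] := cS i (leq_trans ij jn).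
have r1 : (1 : R) \notin m by rewrite idealr1.
have [z zE] := localization_frac x r1.
exists z.
  apply/pP; have [pj jm] := cP j jn; have [_ rep] := num_prime pj jm.
  by apply/(rep _ _ _ r1 zE); apply: mono cx.
apply/negP => /pP ci; have [pi im] := cP i (leq_trans (ltnW ij) jn).
by have [_ rep] := num_prime pi im; apply/nx/(rep _ _ _ r1 zE).
Qed.

End LocalRing.

(** Numerators of a regular sequence of length [d], the dimension of the localization. A prime
    strictly inside [m] containing them would end a chain of length [d], and [m] on top would make
    one of length [d + 1]. *)
Lemma cohen_macaulay_sequence (R : idomainType) (m : R -> Prop) :
  noetherian R -> cohen_macaulay R -> prime_ideal m ->
  (forall J, ideal J -> (forall x, m x -> J x) -> ~ J 1 -> forall x, J x -> m x) ->
  exists xs : seq R, [/\ forall x, x \in xs -> m x, regular_at m (fun r => r = 0) xs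
    & forall q : R -> Prop, prime_ideal q -> (forall r, q r -> m r) ->
        (forall x, x \in xs -> q x) -> forall r, m r -> q r].
Proof.
move=> noethR CM pm mmax; have [M Mm] := prime_idealr_pack pm.
have Mmax : maximal_ideal M.
  move=> J MJ x xJ; apply/Mm; apply: (mmax (fun y => y \in J)) => //.
  - split=> [|a u v uJ vJ]; first exact: idealr0.
    by apply: rpredD => //; apply: idealMr.
  - by move=> y /Mm; apply: MJ.
  by rewrite idealr1.
have [d [[_ dim] [[xs xsd [xsreg xs1]] _]]] := CM M Mmax.
have [num [den numP]] := localization_num_den M.
have E : (fun r => r \in M : Prop) = m.
  by apply: functional_extensionality_dep => r; apply/propext/Mm.
have reg : regular_at m (fun r => r = 0) (map num xs).
  rewrite -E; apply: (localization_regular_at numP (@same_at_nil R M)) => i y ixs.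
  have sub (s t : seq (localization M)^o) z : {subset s <= t} ->
      span_mod (fun y => y = 0) s z -> span_mod (fun y => y = 0) t z.
    move=> st; apply: span_mod_closed; first exact: span_mod_submodule (submodule_zero _).
      by move=> v ->; exact: submodule0 (span_mod_submodule _ (submodule_zero _)).
    by move=> v /st; apply: span_mod_mem; apply: submodule_zero.
  move=> xy; apply: (sub (take i xs)) => [v|]; first by rewrite catrevE cats0 mem_rev.
  apply/spanned_span/xsreg => //; apply/spanned_span.
  by apply: sub xy => v; rewrite catrevE cats0 mem_rev.
(* A term with numerator outside [m] would be a unit and generate the whole ring. *)
have xsm x : x \in map num xs -> m x.
  move=> /mapP[z zxs ->]; apply/Mm; apply: contrapT => /negP nz; apply: xs1.
  have [w wE] := localization_frac (den z) nz; have [dm zE] := numP z.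
  apply/spanned_span.
  have -> : (1 : (localization M)^o) = w *: (z : (localization M)^o).
    apply: val_inj; change (1 = loc_val w * loc_val z).
    by rewrite wE zE mulf_div [tofrac (den z) * _]mulrC divff // mulf_neq0 // (@notin_neq0 _ M).
  apply: submoduleZ; first exact: span_mod_submodule (submodule_zero _).
  by apply: span_mod_mem => //; apply: submodule_zero.
exists (map num xs); split=> // q pq qm xsq r mr; apply: contrapT => nr.
have [||c [cq cP cS]] := regular_chain noethR pm pq qm (I := fun r => r = 0) _ _ xsq reg.
- exact: submodule_zero.
- by move=> x ->; apply: ideal0; case: pq.
rewrite size_map xsd in cq cP cS.
suff /dim : prime_chain (localization M) d.+1 by rewrite ltnn.
apply: (localization_chain numP (c := fun k => if (k <= d)%N then c k else m)) => k kd.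
  case: ifP => [kd'|_]; last by split=> // x /Mm.
  by have [pk _ km] := cP k kd'; split=> // x /km/Mm.
rewrite -ltnS kd; case: ltnP => [kd'|dk]; first exact: cS.
have -> : k = d by apply/eqP; rewrite eqn_leq dk -ltnS kd.
by rewrite cq; split=> //; exists r.
Qed.

(** * Finiteness of the set of semidualizing complexes *)

Lemma semidualizing_complex_presents (R : idomainType) (K : complex R) :
  noetherian R -> cohen_macaulay R -> semidualizing_complex K ->
  exists (P : complex R) (f : chain_map P K) n (C : lmodType R)
    (theta : {linear total P -> C}),
  [/\ quasi_iso f, presents n theta & semidualizing_module C].
Proof.
move=> noethR CM [finK [P [[Pproj [N PN] [f fq]] homP]]].
have Phom := homothety_hom_trivial (derived_iso_quasi_iso homP).
have [A PA] := homologically_finite_bound finK fq.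
have fgP := homologically_finite_fg finK fq.
have [|n0 Pn0] := concentration noethR Pproj PN fgP PA Phom.
  by move=> m pm mmax; apply: cohen_macaulay_sequence.
(* The lemmas on the homology module write its degree as [a - 1]; here [a = n0 + 1]. *)
have Pa n : n != n0 + 1 - 1 -> kills (total P) 1 n by rewrite addrK; apply: Pn0.
have [C [theta pC]] := homology_module Pproj PN Pa.
exists P, f, (n0 + 1 - 1), C, theta; split; [exact: fq|exact: pC|].
exact: (homology_semidualizing Pproj PN fgP Phom Pa pC).
Qed.

Lemma cohen_macaulay_S_finite (R : idomainType) : noetherian R -> normal_domain R ->
  finite_divisor_class_group R -> cohen_macaulay R -> S_finite R.
Proof.
move=> noethR normR fCl CM.
have [k [x xP]] := semidualizing_classes noethR normR fCl.
(* A complex is labelled by [x i] when some complex quasi-isomorphic to it has [x i] as its only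
   homology; equal labels give shift-isomorphic complexes. *)
pose F (K : complex R) (C : lmodType R) := exists (P : complex R) (f : chain_map P K) n
  (theta : {linear total P -> C}), quasi_iso f /\ presents n theta.
apply: (@finitely_many_preimage _ _ k x _ F) => [K|K K' i].
  move=> /(semidualizing_complex_presents noethR CM)[P [f [n [C [theta [fq pn sC]]]]]].
  have [i [phi phib]] := xP C sC; exists i, P, f, n, (phi \o theta).
  by split=> //; apply: presents_comp.
move=> _ _ [P [f [n [th [fq pn]]]]] [P' [f' [n' [th' [fq' pn']]]]].
exact: presents_shift_isomorphic fq fq' pn pn'.
Qed.

Theorem corollary3p5 (R : idomainType) (R_noetherian : noetherian R)
    (R_normal : normal_domain R) (finite_Cl : finite_divisor_class_group R) :
  S0_finite R /\ (cohen_macaulay R -> S_finite R).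
Proof.
split; first exact: normal_S0_finite.
exact: cohen_macaulay_S_finite.
Qed.
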